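(* Let $\mu$ be a measure of compact support on $\mathbb{R}$ and let $E\subset\operatorname{supp}(\mu)$ be a compact set that is essentially perfect and has $C(E)>0$. Suppose the equilibrium measure $\rho_E$ is absolutely continuous with respect to $\mu$, and that for some subsequence $n(1)<n(2)<\cdots$ the monic orthogonal polynomials $P_n(x;d\mu)$ satisfy $\|P_{n(j)}\|_{L^2(\mathbb{R},d\mu)}^{1/n(j)}\to C(E)$. Then the zero counting measures $\nu_{n(j)}$ of $P_{n(j)}$ converge weakly to $\rho_E$.
   Context: Capacity: $C(K)=\exp(-\inf\{\iint\log|x-y|^{-1}d\nu d\nu:\nu\text{ probability measure on }K\})$ for compact $K$; for $C(K)>0$ the equilibrium measure $\rho_K$ is the unique probability measure on $K$ attaining the infimum. A compact $E\subset\mathbb{R}$ is essentially perfect if $|E\cap(x-\delta,x+\delta)|>0$ (Lebesgue measure) for every $x\in E$ and $\delta>0$. The zero counting measure of $P_n$ is $\frac1n\sum\delta_{z_j}$ over zeros with multiplicity. *)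

(* Defs.v *)
From HB Require Import structures.
From mathcomp Require Import all_boot all_order all_algebra.
From mathcomp Require Import all_classical all_reals all_analysis.
From mathcomp Require Import polyrcf.

Set Implicit Arguments.
Unset Strict Implicit.
Unset Printing Implicit Defensive.

Import Order.TTheory GRing.Theory Num.Theory.
Import numFieldNormedType.Exports.

Local Open Scope classical_set_scope.
Local Open Scope ring_scope.

Section Defs.
Variable R : realType.

Definition log_kernel (x y : R) : \bar R :=
  if x == y then +oo%E else (- ln `|x - y|)%:E.

Definition log_energy (nu : probability R R) : \bar R :=
  (\int[nu]_x \int[nu]_y log_kernel x y)%E.

Definition prob_on (K : set R) (nu : probability R R) : Prop :=
  nu (~` K) = 0%E.

Definition min_energy (K : set R) : \bar R :=
  ereal_inf [set log_energy nu | nu in [set nu | prob_on K nu]].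

Definition capacity (K : set R) : \bar R := expeR (- min_energy K)%E.

(* rho is the equilibrium measure of K: a probability measure on K
   attaining the infimum of the energy (unique when C(K) > 0) *)
Definition equilibrium_measure (K : set R) (rho : probability R R) : Prop :=
  prob_on K rho /\ log_energy rho = min_energy K.

Definition measure_support (mu : {measure set R -> \bar R}) : set R :=
  [set x | forall e : R, 0 < e -> (0 < mu [set` `](x - e)%R, (x + e)%R[])%E].

Definition essentially_perfect (E : set R) : Prop :=
  forall x, E x -> forall d : R, 0 < d ->
    (0 < (@lebesgue_measure R) (E `&` [set` `](x - d)%R, (x + d)%R[]))%E.

Definition monic_OP (mu : {measure set R -> \bar R}) (n : nat) (p : {poly R})
  : Prop :=
  [/\ p \is monic, size p = n.+1 &
      forall k : nat, (k < n)%N -> (\int[mu]_x (p.[x] * x ^+ k)%:E)%E = 0%E].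

Definition zero_counting_integral (p : {poly R}) (f : R -> R) : R :=
  ((size p).-1%:R)^-1 * \sum_(z <- rootsR p) (mup z p)%:R * f z.

End Defs.

Definition L2norm (R : realType) (mu : {measure set R -> \bar R}) (p : {poly R})
  : \bar R := Lnorm mu 2%:E (fun x => (p.[x])%:E).

(* Main.v *)
(* Put [U^m x = \int - ln |x - y| dm(y)], let [nu] be the zero counting measure and
   [gamma = - ln C(E)] the minimal energy. Strict concavity of the logarithm on the
   gaps of [supp rho], together with essential perfectness, gives [supp rho = E] and
   [U^rho <= gamma], with a gain away from [E]. The norm asymptotics, Markov's
   inequality and [rho << mu] force [U^nu >= gamma - o(1)] off a set of small
   [rho]-measure; integrating against [rho], where
   [\int U^nu drho = \int U^rho dnu <= gamma], turns this into
   [U^nu -> gamma] in [L^1(rho)] and puts almost all zeros near [E].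
   No weak limit point of [nu] is taken: the logarithm is replaced by a polynomial
   kernel, diagonal in the Chebyshev basis with positive coefficients, for which the
   energy of [nu - rho] is a sum of squares of differences of Chebyshev moments and
   is shown to be [o(1)]. *)
Require Import Defs.
From HB Require Import structures.
From mathcomp Require Import all_boot all_order all_algebra.
From mathcomp Require Import all_classical all_reals all_analysis.
From mathcomp Require Import polyrcf measurable_realfun.
From mathcomp Require Import ring lra zify.
Set Implicit Arguments.
Unset Strict Implicit.
Unset Printing Implicit Defensive.
Import Order.TTheory GRing.Theory Num.Theory.
Import numFieldNormedType.Exports.
Local Open Scope classical_set_scope.
Local Open Scope ring_scope.

(** * The Chebyshev expansion of the logarithmic kernel *)

Section LogKernel.
Context {R : realType}.
Implicit Types (r u x y t : R) (k N : nat).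

(** The zero measure has atoms, so its own logarithmic energy is [+oo]; hence a finite kernel. Abel
    summation at a radius [r < 1] keeps the coefficients nonnegative and stays below the logarithm
    up to a small error, which serves the energies of [nu] and of [rho]. The cross term enters with
    a minus sign and needs a lower bound: there the loss against the logarithm is [smoothing], and
    [good_set] makes it small for all positions of a zero at once. The diagonal part of the energy
    of [nu] is controlled through the Lipschitz constant of the kernel, by averaging over intervals
    that carry [rho]-mass; this is where [supp rho = E] matters. The Lipschitz constant and the
    maximum depend on the kernel, so the kernel is fixed before the tolerance on the potentials of
    the zeros. On [[- A, A]] the logarithm is shifted by [ln (4 * A)]: potentials become integrals
    of nonnegative functions, to which Tonelli and Fatou apply directly, and the shift is the same
    for all competitors because they have mass one. *)

Fixpoint cheb (k : nat) : {poly R} :=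
  if k is k1.+1 then
    if k1 is k2.+1 then 2%:P * 'X * cheb k1 - cheb k2 else 'X
  else 1.

Lemma chebSS k : cheb k.+2 = 2%:P * 'X * cheb k.+1 - cheb k.
Proof. by []. Qed.

Lemma cheb_cos k t : (cheb k).[cos t] = cos (k%:R * t).
Proof.
suff : (cheb k).[cos t] = cos (k%:R * t) /\ (cheb k.+1).[cos t] = cos (k.+1%:R * t).
  by case.
elim: k => [|k [IH1 IH2]]; first by rewrite /= hornerC hornerX mul0r cos0 mul1r.
split=> //; rewrite chebSS !hornerE IH1 IH2.
have -> : k.+2%:R * t = k.+1%:R * t + t by rewrite -(natr1 k.+1) mulrDl mul1r.
have -> : k%:R * t = k.+1%:R * t - t by rewrite -(natr1 k) mulrDl mul1r addrK.
by rewrite cosB cosD; ring.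
Qed.

Arguments cheb : simpl never.

(** The right-hand side is [|1 - r e^(iu)|^2 = (1 - r)^2 + 2 r (1 - cos u)]. *)
Lemma poisson_den_ge r u : 0 <= r < 1 -> (1 - r) ^+ 2 <= 1 - 2 * r * cos u + r ^+ 2.
Proof.
move=> /andP[r0 _]; have := cos_le1 u => c1.
have : 0 <= r * (1 - cos u) by rewrite mulr_ge0 ?subr_ge0.
by nra.
Qed.

Lemma poisson_den_gt0 r u : 0 <= r < 1 -> 0 < 1 - 2 * r * cos u + r ^+ 2.
Proof.
move=> rr; apply: lt_le_trans (poisson_den_ge u rr).
by move: rr => /andP[_ r1]; rewrite exprn_gt0// subr_gt0.
Qed.

(** Real part of the geometric sum of [r^k e^(i(k+1)u)] with the denominator cleared; the last term
    is the exact remainder. *)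
Lemma sum_poisson r u N :
  (\sum_(k < N) r ^+ k * cos (k.+1%:R * u)) * (1 - 2 * r * cos u + r ^+ 2) =
  cos u - r - r ^+ N * (cos (N.+1%:R * u) - r * cos (N%:R * u)).
Proof.
elim: N => [|N IH]; first by rewrite big_ord0 expr0 !mul0r cos0 !mul1r; ring.
rewrite big_ord_recr /= mulrDl IH.
have -> : N.+2%:R * u = N.+1%:R * u + u by rewrite -(natr1 N.+1) mulrDl mul1r.
have -> : N%:R * u = N.+1%:R * u - u by rewrite -(natr1 N) mulrDl mul1r addrK.
by rewrite cosB cosD (exprS r N); ring.
Qed.

(** Truncation of the series of [- ln |1 - r e^(iu)|]. *)
Definition logsum N u r : R :=
  \sum_(k < N) r ^+ k.+1 / k.+1%:R * cos (k.+1%:R * u).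

Lemma is_derive_logsum N u r : is_derive r 1 (logsum N u)
  (\sum_(k < N) r ^+ k * cos (k.+1%:R * u)).
Proof.
pose q : {poly R} := \sum_(k < N) (cos (k.+1%:R * u) / k.+1%:R) *: 'X^(k.+1).
rewrite (_ : logsum N u = horner q); last first.
  apply/funext => z; rewrite /logsum /q horner_sum; apply: eq_bigr => k _.
  by rewrite !hornerE; ring.
apply: is_derive_eq; rewrite (raddf_sum deriv) horner_sum; apply: eq_bigr => k _.
rewrite /= derivZ derivXn !hornerE hornerMn !hornerE -mulr_natr /=.
by field; rewrite nat1r pnatr_eq0.
Qed.

(** Instead of summing a power series, the difference is differentiated in [r]: by [sum_poisson] its
    derivative is exactly the remainder of the geometric sum, and it vanishes at [r = 0], so the
    mean value theorem gives a bound uniform in [u]. *)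
Lemma logsum_approx N u r : 0 <= r < 1 ->
  `|logsum N u r + ln (1 - 2 * r * cos u + r ^+ 2) / 2| <= 2 * r ^+ N / (1 - r) ^+ 2.
Proof.
move=> /andP[r0 r1].
pose p s : R := 1 - 2 * s * cos u + s ^+ 2.
pose f s : R := logsum N u s + ln (p s) / 2.
pose df s : R := \sum_(k < N) s ^+ k * cos (k.+1%:R * u) + (s - cos u) / p s.
have dp (s : R) : is_derive s 1 p (2 * s - 2 * cos u).
  rewrite (_ : p = horner (1 - (2 * cos u) *: 'X + 'X^2)); last first.
    by apply/funext => z; rewrite !hornerE /p; ring.
  apply: is_derive_eq.
  rewrite derivD derivB derivZ derivX derivC derivXn !hornerE /=; ring.
have dfE (s : R) : 0 <= s < 1 -> is_derive s 1 f (df s).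
  move=> s01; rewrite /f /df.
  have p0 := poisson_den_gt0 u s01.
  have dl : is_derive (p s) 1 (@ln R) (p s)^-1 by exact: is_derive1_ln.
  have dlp := @is_derive1_comp _ (@ln R) p s _ _ dl (dp s).
  have dlp2 : is_derive s 1 (fun s => ln (p s) / 2) ((s - cos u) / p s).
    rewrite (_ : (fun s => _) = (2^-1 : R) \*: (@ln R \o p)); last first.
      by apply/funext => z /=; rewrite -[_ *: _]/(_ * _) mulrC.
    apply: is_derive_eq; rewrite -[_ *: _]/(_ * _).
    by field; rewrite gt_eqF.
  exact: is_deriveD (is_derive_logsum N u s) dlp2.
have f0 : f 0 = 0.
  rewrite /f /p mulr0 mul0r subr0 expr0n addr0 ln1 mul0r addr0 /logsum.
  by rewrite big1// => k _; rewrite expr0n !mul0r.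
change (`|f r| <= 2 * r ^+ N / (1 - r) ^+ 2).
have [r_eq0|rn0] := eqVneq r 0.
  rewrite r_eq0 f0 normr0 subr0 expr1n divr1.
  by apply: mulr_ge0 => //; apply: exprn_ge0.
have r_gt0 : 0 < r by rewrite lt_neqAle eq_sym rn0.
have dfb (s : R) : 0 <= s <= r -> `|df s| <= 2 * r ^+ N / (1 - r) ^+ 2.
  move=> /andP[s0 sr]; have s01 : 0 <= s < 1 by rewrite s0 (le_lt_trans sr).
  have p0 := poisson_den_gt0 u s01.
  have -> : df s = - s ^+ N * (cos (N.+1%:R * u) - s * cos (N%:R * u)) / p s.
    apply/(mulIf (lt0r_neq0 p0)).
    rewrite /df mulrDl sum_poisson -!/(p s) !mulfVK ?gt_eqF//; ring.
  rewrite normrM normfV (gtr0_norm p0) normrM normrN (ger0_norm (exprn_ge0 _ s0)).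
  apply: ler_pM.
  - by rewrite mulr_ge0 ?exprn_ge0.
  - by rewrite invr_ge0 ltW.
  - rewrite mulrC ler_pM ?exprn_ge0 //; last by rewrite lerXn2r.
    rewrite (le_trans (ler_normB _ _))// (_ : 2 = 1 + 1 :> R)// lerD ?cos_max//.
    rewrite normrM ger0_norm// -[1]mulr1 ler_pM ?cos_max//.
    by case/andP : s01 => _ /ltW.
  - rewrite lef_pV2 ?posrE ?exprn_gt0 ?subr_gt0//.
    apply: le_trans (poisson_den_ge u s01).
    case/andP : s01 => _ s1; rewrite lerXn2r ?nnegrE ?subr_ge0 ?(ltW r1) ?(ltW s1)//.
    by rewrite lerB.
have fc : {within `[0, r], continuous f}.
  apply: derivable_within_continuous => z; rewrite in_itv /= => /andP[z0 zr].
  by have [] := dfE z; rewrite ?z0 ?(le_lt_trans zr).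
have fd x : x \in `]0, r[ -> is_derive x 1 f (df x).
  rewrite in_itv /= => /andP[x0 xr]; apply: dfE.
  by rewrite ltW// (lt_trans xr).
have [c + E] := MVT r_gt0 fd fc.
rewrite in_itv /= => /andP[c0 cr].
rewrite -[f r]subr0 -f0 E subr0 normrM (gtr0_norm r_gt0).
rewrite -[leRHS]mulr1 ler_pM ?dfb ?(ltW c0) ?(ltW cr) ?(ltW r1) //.
Qed.

(** Product-to-sum formula for cosines. The term [k = 0] on the right has coefficient [2 / 0 = 0] by
    the convention on inverses. *)
Lemma logsum_cheb N r (s t : R) :
  logsum N (s - t) r + logsum N (s + t) r =
  \sum_(k < N.+1) (2 * r ^+ k / k%:R) * (cheb k).[cos s] * (cheb k).[cos t].
Proof.
rewrite big_ord_recl /= invr0 mulr0 !mul0r add0r -big_split /=.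
apply: eq_bigr => k _.
by rewrite /bump !add1n !cheb_cos mulrBr mulrDr cosB cosD; ring.
Qed.

(** In the proof [a] and [b] are [|1 - e^(i(s-t))|^2] and [|1 - e^(i(s+t))|^2], with product
    [4 (cos s - cos t)^2]; each factor of [p] is [(1 - r)^2] plus [r a] or [r b]. The [9] bounds
    [a + b + (1 - r)^2]. *)
Lemma poisson_den_mul r (s t : R) :
  0 <= r <= 1 ->
  let p := (1 - 2 * r * cos (s - t) + r ^+ 2) * (1 - 2 * r * cos (s + t) + r ^+ 2) in
  r ^+ 2 * (2 * (cos s - cos t)) ^+ 2 <= p /\
  p <= 4 * (cos s - cos t) ^+ 2 + 9 * (1 - r) ^+ 2.
Proof.
move=> /andP[r0 r1] p.
set a := 2 * (1 - cos (s - t)); set b := 2 * (1 - cos (s + t)).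
have ab : a * b = (2 * (cos s - cos t)) ^+ 2.
  have := sin2cos2 s; have := sin2cos2 t; rewrite /a /b cosB cosD => Et Es.
  have -> : (2 * (cos s - cos t)) ^+ 2 =
    4 * ((1 - cos s * cos t) ^+ 2 - (1 - cos s ^+ 2) * (1 - cos t ^+ 2)) by ring.
  by rewrite -Et -Es; ring.
have a0 : 0 <= a by rewrite mulr_ge0 ?subr_ge0 ?cos_le1.
have b0 : 0 <= b by rewrite mulr_ge0 ?subr_ge0 ?cos_le1.
have a4 : a <= 4 by rewrite /a; have := cos_geN1 (s - t); lra.
have b4 : b <= 4 by rewrite /b; have := cos_geN1 (s + t); lra.
set h := (1 - r) ^+ 2.
have h0 : 0 <= h by rewrite sqr_ge0.
have h1 : h <= 1 by rewrite expr_le1 ?subr_ge0//; lra.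
have pE : p = (h + r * a) * (h + r * b) by rewrite /p /h /a /b; ring.
have ra : r * a <= a by rewrite ler_piMl.
have rb : r * b <= b by rewrite ler_piMl.
have ra0 : 0 <= r * a by rewrite mulr_ge0.
have rb0 : 0 <= r * b by rewrite mulr_ge0.
split.
  rewrite -ab pE (_ : r ^+ 2 * (a * b) = (r * a) * (r * b)); last by ring.
  by rewrite ler_pM// lerDr.
have -> : 4 * (cos s - cos t) ^+ 2 = a * b by rewrite ab; ring.
rewrite pE (@le_trans _ _ ((h + a) * (h + b)))//.
  by rewrite ler_pM ?addr_ge0 ?lerD.
have -> : (h + a) * (h + b) = a * b + h * (a + b + h) by ring.
by rewrite lerD2l mulrC ler_wpM2r//; lra.
Qed.

(* The Abel means of [- ln |x - y| = ln 2 + \sum_(k > 0) (2 / k) T_k x T_k y]: a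
   polynomial kernel, positive up to its constant term, squeezed between
   [ln 4 - ln (|x - y|^2 + eps^2) / 2] and [ln 4 - ln |x - y|]. *)
Lemma cheb_kernel (eps delta : R) (k0 : nat) :
  0 < eps -> 0 < delta -> (0 < k0)%N ->
  exists (a : nat -> R) (N : nat), [/\ forall k, 0 <= a k, k0%:R^-1 <= a k0,
    (k0 < N)%N & forall x y, `|x| <= 1 -> `|y| <= 1 ->
    let K := ln 8 + \sum_(k < N) a k * (cheb k).[x] * (cheb k).[y] in
    (x != y -> K <= ln (4 / `|x - y|) + delta) /\
    ln 4 - ln ((x - y) ^+ 2 + eps ^+ 2) / 2 - delta <= K].
Proof.
move=> e0 d0 k00.
(* For [r = 1 - h]: [h <= eps / 2] absorbs the [9 (1 - r)^2] of [poisson_den_mul] into [4 eps^2],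
   [h <= delta / 4] makes [- ln r <= delta / 2], and [h <= 1 / (2 k0)] keeps [r ^+ k0 >= 1 / 2],
   hence [a k0 >= 1 / k0]. *)
pose h : R := Num.min (Num.min (eps / 2) (delta / 4)) (Num.min (k0%:R^-1 / 2) (1 / 2)).
have k0r : (0 : R) < k0%:R by rewrite ltr0n.
have hgt0 : 0 < h by rewrite !lt_min !divr_gt0 ?invr_gt0.
have he : h <= eps / 2 by rewrite !ge_min lexx.
have hd : h <= delta / 4 by rewrite !ge_min lexx !orbT.
have hk : h <= k0%:R^-1 / 2 by rewrite !ge_min lexx !orbT.
have h2 : h <= 1 / 2 by rewrite !ge_min lexx !orbT.
pose r := 1 - h.
have r2 : 1 / 2 <= r by rewrite /r; lra.
have r1 : r < 1 by rewrite /r; lra.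
have rgt0 : 0 < r by lra.
have r01 : 0 <= r < 1 by rewrite ltW.
have rk : 1 / 2 <= r ^+ k0.
  have bern (k : nat) : 1 - k%:R * h <= r ^+ k.
    elim: k => [|k IH]; first by rewrite mul0r subr0 expr0.
    rewrite exprS; apply: (@le_trans _ _ (r * (1 - k%:R * h))); last by rewrite ler_pM2l.
    rewrite /r -natr1; have : (0 : R) <= k%:R by [].
    by nra.
  apply: le_trans (bern k0).
  have : k0%:R * h <= k0%:R * (k0%:R^-1 / 2) by rewrite ler_pM2l.
  by rewrite mulrA divff ?gt_eqF// => ?; lra.
have lnr : - ln r <= delta / 2.
  rewrite -lnV ?posrE//.
  have := @le_ln1Dx _ (r^-1 - 1); rewrite (addrC 1) subrK.
  have : r^-1 - 1 <= 2 * h.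
    rewrite -(ler_pM2r rgt0) mulrBl mulVf ?gt_eqF// mul1r /r; nra.
  have : -1 < r^-1 - 1 by rewrite ltrBrDr addrC subrr invr_gt0.
  by move=> H1 H2 /(_ H1); lra.
have [N [Nk HN]] : exists N, (k0 <= N)%N /\ 4 * r ^+ N / (1 - r) ^+ 2 <= delta / 2.
  have cv : r ^+ n @[n --> \oo] --> 0.
    by apply: cvg_expr; rewrite ger0_norm ?ltW.
  have c0 : 0 < delta / 8 * (1 - r) ^+ 2 by rewrite mulr_gt0 ?divr_gt0// exprn_gt0// subr_gt0.
  move/cvgrPdist_le : cv => /(_ _ c0) [M _ HM].
  exists (maxn k0 M); split; first exact: leq_maxl.
  have := HM (maxn k0 M) (leq_maxr _ _).
  rewrite sub0r normrN ger0_norm => [H|]; last by rewrite exprn_ge0 ?(ltW rgt0).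
  rewrite ler_pdivrMr ?exprn_gt0 ?subr_gt0//.
  lra.
exists (fun k => 2 * r ^+ k / k%:R), N.+1; split => //.
- by move=> k; rewrite divr_ge0// mulr_ge0// exprn_ge0// ltW.
- by rewrite -[leLHS]mul1r ler_pM2r ?invr_gt0//; lra.
move=> x y x1 y1 K.
have xI : x \in `[(-1), 1] by rewrite in_itv /= -ler_norml.
have yI : y \in `[(-1), 1] by rewrite in_itv /= -ler_norml.
have KE : K = ln 8 + (logsum N (acos x - acos y) r + logsum N (acos x + acos y) r).
  by rewrite logsum_cheb !acosK.
have := logsum_approx N (acos x - acos y) r01.
have := logsum_approx N (acos x + acos y) r01.
have [] := @poisson_den_mul r (acos x) (acos y) _; first by rewrite !ltW.
have pu0 := poisson_den_gt0 (acos x - acos y) r01.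
have pv0 := poisson_den_gt0 (acos x + acos y) r01.
rewrite !acosK//; move: pu0 pv0 KE; clearbody K.
set lu := logsum _ _ _; set lv := logsum _ _ _.
set pu := (1 - _ + _); set pv := (1 - _ + _) => pu0 pv0 -> lo hi Hv Hu.
have lnpp : ln pu + ln pv = ln (pu * pv) by rewrite lnM.
have {}Hu : `|lu + ln pu / 2| <= delta / 4 by apply: le_trans Hu _; lra.
have {}Hv : `|lv + ln pv / 2| <= delta / 4 by apply: le_trans Hv _; lra.
move: Hu Hv; rewrite !ler_norml => /andP[Hu1 Hu2] /andP[Hv1 Hv2].
(* [ln 8] is the shift [ln 4] of the target plus the [ln 2] that opens the Chebyshev expansion of
   the logarithm. *)
have ln84 : ln 8 = ln 4 + ln (2 : R) by rewrite -lnM ?posrE//; congr ln; ring.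
split.
  move=> xy; have d0' : 0 < `|x - y| by rewrite normr_gt0 subr_eq0.
  rewrite lnM ?posrE ?invr_gt0// lnV ?posrE//.
  have : ln (r ^+ 2 * (2 * (x - y)) ^+ 2) <= ln (pu * pv).
    rewrite ler_ln ?posrE ?(mulr_gt0 pu0 pv0)//.
    by rewrite mulr_gt0 ?(exprn_gt0 _ rgt0)// exprn_even_gt0//= mulf_neq0 ?subr_eq0.
  rewrite -exprMn -real_normK ?num_real// !normrM (gtr0_norm rgt0) (@gtr0_norm _ 2)//.
  rewrite lnXn ?mulr_gt0// !lnM ?posrE ?mulr_gt0//.
  by rewrite -[_ *+ 2]mulr_natl; lra.
have : ln (pu * pv) <= ln (4 * ((x - y) ^+ 2 + eps ^+ 2)).
  rewrite ler_ln ?posrE ?(mulr_gt0 pu0 pv0)//; last first.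
    by rewrite mulr_gt0// ltr_wpDl ?sqr_ge0 ?exprn_gt0.
  apply: le_trans hi _; rewrite mulrDr lerD2l /r opprD addNKr ?opprK.
  nra.
rewrite lnM ?posrE ?ltr_wpDl ?sqr_ge0 ?exprn_gt0//.
have ln42 : ln 4 = ln 2 + ln (2 : R) by rewrite -lnM ?posrE//; congr ln; ring.
by lra.
Qed.

End LogKernel.

Arguments cheb {R} k : simpl never.

(** * Polynomial approximation *)

Section Weierstrass.
Context {R : realType}.
Implicit Types (x t : R) (n k : nat) (phi psi : nat -> R).

(* The Bernstein polynomial [\sum_k 'C(n, k) phi k X^k (1 - X)^(n - k)]. *)
Fixpoint bernstein n phi : {poly R} :=
  if n is m.+1 then
    (1 - 'X) * bernstein m phi + 'X * bernstein m (fun k => phi k.+1)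
  else (phi 0%N)%:P.

Lemma bernsteinS n phi x : (bernstein n.+1 phi).[x] =
  (1 - x) * (bernstein n phi).[x] + x * (bernstein n (fun k => phi k.+1)).[x].
Proof. by rewrite /= !hornerE. Qed.

Lemma bernsteinD n phi psi x : (bernstein n (fun k => phi k + psi k)).[x] =
  (bernstein n phi).[x] + (bernstein n psi).[x].
Proof.
elim: n phi psi => [|n IH] phi psi; first by rewrite /= !hornerC.
by rewrite !bernsteinS !IH; ring.
Qed.

Lemma bernsteinZ n c phi x :
  (bernstein n (fun k => c * phi k)).[x] = c * (bernstein n phi).[x].
Proof.
elim: n phi => [|n IH] phi; first by rewrite /= !hornerC.
by rewrite !bernsteinS !IH; ring.
Qed.

Lemma bernstein_cst n c x : (bernstein n (fun=> c)).[x] = c.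
Proof.
by elim: n => [|n IH]; [rewrite /= hornerC|rewrite bernsteinS !IH; ring].
Qed.

(** Second moment of a binomial variable about [- c]: squared bias plus variance [n x (1 - x)]. The
    free shift [c] lets the induction pass, since the recursion replaces [k] by [k + 1]. *)
Lemma bernstein_sqr n c x : (bernstein n (fun k => (k%:R + c) ^+ 2)).[x] =
  (n%:R * x + c) ^+ 2 + n%:R * x * (1 - x).
Proof.
elim: n c => [|n IH] c; first by rewrite /= hornerC; ring.
rewrite bernsteinS IH.
rewrite (_ : (fun k => _) = (fun k => (k%:R + (c + 1)) ^+ 2)); last first.
  by apply/funext => k; rewrite -natr1; ring.
by rewrite IH -natr1; ring.
Qed.

Lemma bernstein_le n phi psi x : 0 <= x <= 1 -> (forall k, phi k <= psi k) ->
  (bernstein n phi).[x] <= (bernstein n psi).[x].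
Proof.
move=> /andP[x0 x1]; elim: n phi psi => [|n IH] phi psi le; first by rewrite /= !hornerC.
by rewrite !bernsteinS lerD// ler_wpM2l ?subr_ge0// IH.
Qed.

(** Uniform continuity handles [|s - t| < d]; beyond that distance boundedness does, because
    [(s - t)^2 / d^2 >= 1]. The quadratic majorant is one that [bernstein_sqr] evaluates exactly. *)
Lemma continuous_sqr_bound (f : R -> R) (A M e : R) : continuous f ->
  (forall x, `|f x| <= M) -> 0 < e ->
  exists2 C, 0 <= C & forall t s, `|t| <= A -> `|f s - f t| <= e + C * (s - t) ^+ 2.
Proof.
move=> cf fM e0.
have [d d0 Hd] : exists2 d, 0 < d & forall t, t \in `[- A, A] ->
    forall s, `|s - t| < d -> `|f s - f t| <= e.
  have := @segment_compact R (- A) A => /compact_near_coveringP.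
  move=> /(_ R (0 : R)^'+ (fun d t => forall s, `|s - t| < d -> `|f s - f t| <= e)).
  case.
    move=> t _.
    have e2 : 0 < e / 2 by rewrite divr_gt0.
    have /cvgrPdist_le/(_ _ e2) := cf t.
    move=> /nbhs_ballP[r /= r0 Hr].
    exists (ball t (r / 2), [set d | d < r / 2]).
      split; first by apply: nbhsx_ballx; rewrite divr_gt0.
      by apply: nbhs_right_lt; rewrite divr_gt0.
    move=> [t' d] /= [bt dr] s sd.
    have H1 : `|f t - f t'| <= e / 2.
      by apply: Hr; apply: lt_le_trans bt _; lra.
    have H2 : `|f t - f s| <= e / 2.
      apply: Hr; rewrite /ball /=.
      have -> : t - s = (t - t') - (s - t') by ring.
      apply: le_lt_trans (ler_normB _ _) _.
      by rewrite /ball /= in bt; lra.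
    have -> : f s - f t' = (f t - f t') - (f t - f s) by ring.
    by apply: le_trans (ler_normB _ _) _; lra.
  move=> r /= r0 Hr; exists (r / 2); first by rewrite divr_gt0.
  move=> t tA; apply: Hr => //=; rewrite ?divr_gt0//.
  by rewrite sub0r normrN gtr0_norm ?divr_gt0//; move: r0 => /=; lra.
have M0 : 0 <= M by apply: le_trans (fM 0).
exists (2 * M / d ^+ 2); first by rewrite divr_ge0 ?sqr_ge0 ?mulr_ge0//.
move=> t s tA; have tA' : t \in `[- A, A] by rewrite in_itv /= -ler_norml.
have [sd|sd] := ltP `|s - t| d.
  apply: le_trans (Hd _ tA' _ sd) _.
  by rewrite lerDl mulr_ge0 ?sqr_ge0// divr_ge0 ?sqr_ge0 ?mulr_ge0//.
apply: le_trans (ler_normB _ _) _.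
apply: (@le_trans _ _ (2 * M)); first by have := fM s; have := fM t; lra.
rewrite -[leLHS]add0r lerD ?(ltW e0)//.
rewrite mulrAC ler_pdivlMr ?exprn_gt0// ler_wpM2l ?mulr_ge0//.
by rewrite -[leRHS]real_normK ?num_real// lerXn2r ?nnegrE ?(ltW d0).
Qed.

Lemma weierstrass (f : R -> R) (A M e : R) : continuous f ->
  (forall x, `|f x| <= M) -> 0 < A -> 0 < e ->
  exists p : {poly R}, forall t, `|t| <= A -> `|f t - p.[t]| <= e.
Proof.
move=> cf fM A0 e0.
have e2 : 0 < e / 2 by rewrite divr_gt0.
have [C C0 HC] := continuous_sqr_bound A cf fM e2.
pose D := C * (2 * A) ^+ 2.
have D0 : 0 <= D by rewrite mulr_ge0 ?sqr_ge0.
have [n n0 Hn] : exists2 n, (0 < n)%N & D / n%:R <= e / 2.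
  exists (Num.truncn (D / (e / 2))).+1 => //.
  rewrite ler_pdivrMr// mulrC -ler_pdivrMr//.
  by rewrite ltW// truncnS_gt.
have nr : (0 : R) < n%:R by rewrite ltr0n.
(* Nodes with [k > n] lie outside [[- A, A]], but [bernstein_le] compares all [k]; this is why
   [continuous_sqr_bound] confines only [t] and leaves [s] free. *)
pose phi k := f (2 * A * (k%:R / n%:R) - A).
exists (bernstein n phi \Po ((2 * A)^-1 *: ('X + A%:P))) => t tA.
rewrite horner_comp !hornerE.
set x := _^-1 * _.
have tE : t = 2 * A * x - A by rewrite /x; field; rewrite gt_eqF.
have x01 : 0 <= x <= 1.
  move: tA; rewrite ler_norml /x => /andP[t1 t2].
  rewrite mulr_ge0 ?invr_ge0 ?mulr_ge0 ?(ltW A0)//=; last by lra.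
  by rewrite mulrC ler_pdivrMr ?mulr_gt0//; lra.
have bd k : `|phi k - f t| <= e / 2 + D / n%:R ^+ 2 * (k%:R + - (n%:R * x)) ^+ 2.
  apply: le_trans (HC _ _ tA) _; rewrite lerD2l {1}tE /D.
  rewrite le_eqVlt; apply/orP; left; apply/eqP; field.
  by rewrite gt_eqF.
have var : (bernstein n (fun k => e / 2 + D / n%:R ^+ 2 * (k%:R + - (n%:R * x)) ^+ 2)).[x]
    <= e.
  rewrite (bernsteinD n (fun=> e / 2)
    (fun k => D / n%:R ^+ 2 * (k%:R + - (n%:R * x)) ^+ 2)).
  rewrite (bernsteinZ n _ (fun k => (k%:R + - (n%:R * x)) ^+ 2)).
  rewrite bernstein_cst (bernstein_sqr n (- (n%:R * x))) subrr expr0n add0r.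
  have -> : D / n%:R ^+ 2 * (n%:R * x * (1 - x)) = D / n%:R * (x * (1 - x)).
    by field; rewrite gt_eqF.
  have xx : x * (1 - x) <= 1 by move: x01 => /andP[? ?]; nra.
  have : D / n%:R * (x * (1 - x)) <= D / n%:R by rewrite ler_piMr ?divr_ge0.
  by lra.
have lo k : f t - (e / 2 + D / n%:R ^+ 2 * (k%:R + - (n%:R * x)) ^+ 2) <= phi k.
  by have := bd k; rewrite ler_distl => /andP[].
have hi k : phi k <= f t + (e / 2 + D / n%:R ^+ 2 * (k%:R + - (n%:R * x)) ^+ 2).
  by have := bd k; rewrite ler_distl => /andP[].
have := bernstein_le n x01 hi; have := bernstein_le n x01 lo.
set q := (fun k => e / 2 + _) in var *.
rewrite (_ : (fun k => f t - q k) = (fun k => f t + -1 * q k)); last first.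
  by apply/funext => k; rewrite mulN1r.
rewrite (bernsteinD n (fun=> f t) (fun k => -1 * q k)) (bernsteinZ n _ q).
rewrite (bernsteinD n (fun=> f t) q) !bernstein_cst => H1 H2.
by rewrite ler_norml; apply/andP; split; lra.
Qed.

(** The rescaled Chebyshev polynomials span all polynomials: [y T_(k+1) = (T_(k+2) + T_k) / 2]
    trades powers of [y = x / A] for other indices. Stated for a predicate, so that integrability
    and convergence pass together from the moments to polynomials. *)
Lemma poly_cheb_ind (A : R) (Q : (R -> R) -> Prop) : 0 < A ->
  (forall k, Q (fun x => (cheb k).[x / A])) ->
  (forall c g, Q g -> Q (fun x => c * g x)) ->
  (forall g h, Q g -> Q h -> Q (fun x => g x + h x)) ->
  forall p : {poly R}, Q (horner p).
Proof.
move=> A0 QT QZ QD.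
have Qm m k : Q (fun x => (x / A) ^+ m * (cheb k).[x / A]).
  elim: m k => [|m IH] k.
    by rewrite (_ : (fun x => _) = (fun x => (cheb k).[x / A]))//; apply/funext=> x; rewrite expr0 mul1r.
  case: k => [|k].
    rewrite (_ : (fun x => _) = (fun x => (x / A) ^+ m * (cheb 1).[x / A]))//.
    by apply/funext=> x; rewrite hornerC hornerX exprSr mulr1.
  rewrite (_ : (fun x => _) = (fun x => 2^-1 * ((x / A) ^+ m * (cheb k.+2).[x / A]) +
     2^-1 * ((x / A) ^+ m * (cheb k).[x / A]))).
    by apply: QD; apply: QZ.
  apply/funext=> x; rewrite exprSr; move: (x / A) (_ ^+ m) => y z.
  by rewrite chebSS !hornerE /=; field.
have QX m : Q (fun x => x ^+ m).
  rewrite (_ : (fun x => _) = (fun x => A ^+ m * ((x / A) ^+ m * (cheb 0).[x / A]))).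
    exact: QZ.
  by apply/funext=> x; rewrite hornerC mulr1 -exprMn mulrC divfK ?gt_eqF.
move=> p.
have -> : horner p = (fun x => \sum_(i < size p) p`_i * x ^+ i).
  by apply/funext => x; rewrite horner_coef.
elim: (size p) => [|n IH].
  rewrite (_ : (fun x => _) = (fun x => 0 * x ^+ 0)); first exact: QZ.
  by apply/funext => x; rewrite big_ord0 mul0r.
rewrite (_ : (fun x => _) = (fun x => \sum_(i < n) p`_i * x ^+ i + p`_n * x ^+ n)).
  by apply: QD => //; apply: QZ.
by apply/funext => x; rewrite big_ord_recr.
Qed.

Lemma horner_lipschitz (p : {poly R}) (A : R) : 0 <= A ->
  exists2 L, 0 <= L & forall x y, `|x| <= A -> `|y| <= A ->
    `|p.[x] - p.[y]| <= L * `|x - y|.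
Proof.
(* The bound [B] on the values is carried along because the product in the Horner step needs it. *)
move=> A0; suff [L [B [L0 B0 H]]] : exists L B, [/\ 0 <= L, 0 <= B & forall x, `|x| <= A ->
    `|p.[x]| <= B /\ forall y, `|y| <= A -> `|p.[x] - p.[y]| <= L * `|x - y|].
  by exists L => // x y xA yA; have [_] := H x xA; exact.
elim/poly_ind: p => [|p c [L [B [L0 B0 H]]]].
  exists 0, 0; split=> // x _; rewrite horner0 normr0; split=> // y _.
  by rewrite horner0 subrr normr0 mul0r.
exists (B + A * L), (B * A + `|c|); split; rewrite ?addr_ge0 ?mulr_ge0// => x xA.
have [HB HL] := H _ xA.
rewrite !hornerE; split.
  by apply: le_trans (ler_normD _ _) _; rewrite lerD2r normrM ler_pM.
move=> y yA; have {}HL := HL _ yA.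
rewrite !hornerE (_ : _ - _ = p.[x] * (x - y) + (p.[x] - p.[y]) * y); last by ring.
apply: le_trans (ler_normD _ _) _; rewrite !normrM mulrDl lerD ?ler_wpM2r//.
by rewrite (mulrC A) mulrAC ler_pM.
Qed.

End Weierstrass.

(** * Logarithmic energy *)

Section Support.
Context {R : realType}.
Implicit Types (mu : {measure set R -> \bar R}) (x : R).

(** Null intervals with rational endpoints, indexed through [unpickle]; countably many of them cover
    the complement of the support, which is therefore open and null. *)
Let rat_itv mu (k : nat) : set R :=
  if unpickle k is Some (a, b) then
    if mu [set` `](ratr a : R), (ratr b : R)[] == 0%E then [set` `](ratr a : R), (ratr b : R)[] else set0
  else set0.

Let measure_supportC mu : ~` measure_support mu = \bigcup_k rat_itv mu k.
Proof.
apply/seteqP; split=> [x|x [k _]].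
  move=> /existsNP[e /not_implyP[e0 /negP]]; rewrite -leNgt => me.
  have [a ha] := @rat_in_itvoo R (x - e) x ltac:(by rewrite ltrBlDr ltrDl).
  have [b hb] := @rat_in_itvoo R x (x + e) ltac:(by rewrite ltrDl).
  move: ha hb; rewrite !in_itv /= => /andP[a1 a2] /andP[b1 b2].
  exists (pickle (a, b)); [exact: I|].
  rewrite /rat_itv pickleK; case: eqP => [_|]; first by rewrite /= in_itv /= a2.
  case; apply/eqP; rewrite eq_le measure_ge0 andbT; apply: le_trans me.
  apply: le_measure; rewrite ?inE//; apply: subset_itvW => //; exact: ltW.
rewrite /rat_itv; case: unpickle => // -[a b]; case: eqP => // m0 /=.
rewrite in_itv /= => /andP[a1 a2] /(_ (Num.min (x - ratr a) (ratr b - x))).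
rewrite lt_min !subr_gt0 a1 a2 => /(_ isT); apply/negP; rewrite -leNgt -m0.
apply: le_measure; rewrite ?inE// => y /=; rewrite !in_itv /= => /andP[y1 y2].
have le1 : Num.min (x - ratr a) (ratr b - x) <= x - ratr a by rewrite ge_min lexx.
have le2 : Num.min (x - ratr a) (ratr b - x) <= ratr b - x by rewrite ge_min lexx orbT.
by apply/andP; split; lra.
Qed.

Lemma closed_measure_support mu : closed (measure_support mu).
Proof.
rewrite -openC measure_supportC; apply: bigcup_open => k _.
rewrite /rat_itv; case: unpickle => [[a b]|]; last exact: open0.
by case: ifP => _; [exact: interval_open|exact: open0].
Qed.

Lemma measurable_measure_support mu : measurable (measure_support mu).
Proof. by apply: closed_measurable; exact: closed_measure_support. Qed.

Lemma measure_supportC0 mu : mu (~` measure_support mu) = 0%E.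
Proof.
apply: measure_negligible.
  by apply: measurableC; exact: measurable_measure_support.
rewrite measure_supportC; apply: negligible_bigcup => k.
rewrite /rat_itv; case: unpickle => [[a b]|]; last exact: negligible_set0.
case: eqP => [m0|_]; last exact: negligible_set0.
by apply/negligibleP.
Qed.

End Support.

Section Concentrated.
Context {R : realType} (mu : {measure set R -> \bar R}).
Hypothesis muT : (mu setT < +oo)%E.
Implicit Types (S : set R) (f : R -> R).

Lemma integrable_bounded_on S f M : measurable S -> mu (~` S) = 0%E ->
  measurable_fun setT f -> (forall x, S x -> `|f x| <= M) ->
  mu.-integrable setT (EFin \o f).
Proof.
move=> mS S0 mf fM.
have mEf : measurable_fun setT (EFin \o f) by exact/measurable_EFinP.
apply/integrableP; split => //.
have M0 : (0 <= (`|M|)%:E)%E by rewrite lee_fin.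
apply: le_lt_trans (integral_le_bound (`|M|)%:E measurableT mEf M0 _) _.
  exists (~` S); split => //; first exact: measurableC.
  move=> x /= H Sx; apply: H => _; rewrite lee_fin.
  by apply: le_trans (fM _ Sx) (ler_norm _).
by rewrite lte_mul_pinfty.
Qed.

End Concentrated.

(** * The logarithm shifted to a nonnegative kernel *)

Section TruncatedLog.
Context {R : realType} (A : R).
Implicit Types (x y d : R) (m : {measure set R -> \bar R}) (nu : probability R R).

(* On [[-A, A]] this is [- ln |d|] shifted to be nonnegative; the value at [0]
   is junk, the correct value [+oo] being restored in [elog]. *)
Definition tlog d : R := Num.max 0 (ln (4 * A) - ln `|d|).

Definition elog x y : \bar R := if x == y then +oo%E else (tlog (x - y))%:E.

Lemma tlog_ge0 d : 0 <= tlog d.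
Proof. by rewrite /tlog le_max lexx. Qed.

Lemma elog_ge0 x y : (0 <= elog x y)%E.
Proof. by rewrite /elog; case: ifP => // _; rewrite lee_fin tlog_ge0. Qed.

Lemma tlogN d : tlog (- d) = tlog d.
Proof. by rewrite /tlog normrN. Qed.

Lemma tlogC x y : tlog (x - y) = tlog (y - x).
Proof. by rewrite -tlogN opprB. Qed.

Lemma elogC x y : elog x y = elog y x.
Proof. by rewrite /elog eq_sym tlogC. Qed.

Lemma tlogE d : d != 0 -> `|d| <= 4 * A -> tlog d = ln (4 * A) - ln `|d|.
Proof.
move=> d0 dA; have d1 : 0 < `|d| by rewrite normr_gt0.
by apply/max_idPr; rewrite subr_ge0 ler_ln// posrE (lt_le_trans d1).
Qed.

Lemma measurable_tlog : measurable_fun setT tlog.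
Proof.
apply: measurable_maxr => //; apply: measurable_funB => //.
by apply: measurableT_comp => //; exact: measurable_normr.
Qed.

Lemma measurable_tlog_sub x : measurable_fun setT (fun y => tlog (x - y)).
Proof.
apply: measurableT_comp; first exact: measurable_tlog.
exact: measurable_funB.
Qed.

Lemma measurable_elog2 : measurable_fun setT (fun z : R * R => elog z.1 z.2).
Proof.
apply: measurable_fun_ifT => //; first exact: measurable_fun_eqr.
apply/measurable_EFinP; apply: measurableT_comp; first exact: measurable_tlog.
exact: measurable_funB.
Qed.

Lemma measurable_elog x : measurable_fun setT (elog x).
Proof.
apply: measurable_fun_ifT => //; first exact: measurable_fun_eqr.
by apply/measurable_EFinP; exact: measurable_tlog_sub.
Qed.

Lemma log_kernelE x y : 0 < A -> `|x| <= A -> `|y| <= A ->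
  log_kernel x y = (elog x y - (ln (4 * A))%:E)%E.
Proof.
move=> A0 xA yA; rewrite /log_kernel /elog; case: eqVneq => // xy.
rewrite tlogE ?subr_eq0//; last first.
  by apply: le_trans (ler_normB _ _) _; lra.
by rewrite -EFinB; congr EFin; ring.
Qed.

(** The integral of [f] may be [+oo], so additivity for integrable functions does not apply. The
    negative part of [g = f - c] is at most [c], hence has finite integral, and the identity follows
    from [g^\+ + c = f + g^\-], whose two sides are sums of nonnegative functions. *)
Lemma ge0_integralB_cst (nu : probability R R) (f : R -> \bar R) (c : R) :
  measurable_fun setT f -> (forall x, 0 <= f x)%E -> 0 <= c ->
  (\int[nu]_x (f x - c%:E) = \int[nu]_x f x - c%:E)%E.
Proof.
move=> mf f0 c0.
pose g x := (f x - c%:E)%E.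
have mg : measurable_fun setT g by apply: emeasurable_funB.
have gE x : (g^\+ x + c%:E = f x + g^\- x)%E.
  rewrite funeposE funenegE /g; case: (f x) (f0 x) => [r r0||] //.
    rewrite -EFinB -EFinN -!EFin_max -!EFinD; congr EFin.
    by rewrite /Num.max; case: ltP => ?; case: ltP => ?; lra.
  by move=> _; rewrite /= maxye maxNye addye// adde0.
have gc x : (g^\- x <= c%:E)%E.
  rewrite funenegE /g ge_max lee_fin c0 andbT; case: (f x) (f0 x) => [r r0||] //.
    by rewrite -EFinB -EFinN lee_fin; move: r0; rewrite lee_fin; lra.
  by rewrite leNye.
have icst : (\int[nu]_x c%:E)%E = c%:E.
  by rewrite integral_cst//= probability_setT mule1.
have nfin : (\int[nu]_x g^\- x)%E \is a fin_num.
  rewrite ge0_fin_numE ?integral_ge0//.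
  apply: (@le_lt_trans _ _ (\int[nu]_x c%:E)%E); last by rewrite icst ltry.
  by apply: ge0_le_integral => //; exact: measurable_funeneg.
have E : (\int[nu]_x g^\+ x + c%:E = \int[nu]_x f x + \int[nu]_x g^\- x)%E.
  rewrite -[X in (_ + X)%E]icst -ge0_integralD//; last exact: measurable_funepos.
  rewrite -ge0_integralD//; last exact: measurable_funeneg.
  by apply: eq_integral => x _; exact: gE.
rewrite [LHS]integralE -/g.
set p := (\int[nu]_x g^\+ x)%E in E *; set q := (\int[nu]_x g^\- x)%E in nfin E *.
case: q nfin E => // q _; set F := (\int[nu]_x f x)%E.
by case: p => [p||]; case: F => [F||] //= [] E; congr EFin; lra.
Qed.

End TruncatedLog.

Section Energy.
Context {R : realType} (A : R) (A1 : 1 <= A).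
Implicit Types (x y : R) (m : {finite_measure set R -> \bar R}) (nu : probability R R).

Let A0 : 0 < A. Proof. exact: lt_le_trans A1. Qed.

Lemma ln4A_ge0 : 0 <= ln (4 * A).
Proof. by rewrite ln_ge0//; have := A1; lra. Qed.

Definition epot m x : \bar R := (\int[m]_y elog A x y)%E.

Lemma epot_ge0 m x : (0 <= epot m x)%E.
Proof. by apply: integral_ge0 => y _; exact: elog_ge0. Qed.

Lemma measurable_epot m : measurable_fun setT (epot m).
Proof.
have := @measurable_fun_fubini_tonelli_F _ _ _ _ _ m _ (measurable_elog2 A).
by apply=> z; exact: elog_ge0.
Qed.

Definition energy (m1 m2 : {finite_measure set R -> \bar R}) : \bar R :=
  (\int[m1]_x epot m2 x)%E.

Lemma energy_ge0 m1 m2 : (0 <= energy m1 m2)%E.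
Proof. by apply: integral_ge0 => y _; exact: epot_ge0. Qed.

Lemma energyC m1 m2 : energy m1 m2 = energy m2 m1.
Proof.
rewrite /energy /epot.
rewrite (@fubini_tonelli _ _ _ _ _ m1 m2 _ (measurable_elog2 A))/=; last first.
  by move=> z; exact: elog_ge0.
by apply: eq_integral => y _; apply: eq_integral => x _; rewrite elogC.
Qed.

Lemma ae_on nu (S : set R) (P : R -> Prop) : measurable S -> nu (~` S) = 0%E ->
  (forall x, S x -> P x) -> {ae nu, forall x, P x}.
Proof.
move=> mS S0 H; exists (~` S); split => //; first exact: measurableC.
by move=> x /= nP Sx; exact/nP/H.
Qed.

Lemma measurable_log_kernel2 :
  measurable_fun setT (fun z : R * R => log_kernel z.1 z.2).
Proof.
apply: measurable_fun_ifT => //; first exact: measurable_fun_eqr.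
apply/measurable_EFinP; apply: measurable_funN; apply: measurableT_comp => //.
by apply: measurableT_comp => //; exact: measurable_funB.
Qed.

Lemma measurable_log_kernel x : measurable_fun setT (log_kernel x).
Proof.
apply: measurable_fun_ifT => //; first exact: measurable_fun_eqr.
apply/measurable_EFinP; apply: measurable_funN; apply: measurableT_comp => //.
by apply: measurableT_comp => //; exact: measurable_funB.
Qed.

(** On [[- A, A]] the signed [log_kernel] and the nonnegative [elog] differ by the constant
    [ln (4 * A)], which a probability measure integrates to itself, first in the inner and then in
    the outer integral. *)
Lemma log_energyE nu : nu (~` `[- A, A]) = 0%E ->
  log_energy nu = (energy nu nu - (ln (4 * A))%:E)%E.
Proof.
move=> nuA; have mA : measurable (`[- A, A] : set R) by [].
have mpot : measurable_fun setT (fun x => epot nu x - (ln (4 * A))%:E)%E.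
  by apply: emeasurable_funB => //; exact: measurable_epot.
have inner x : `|x| <= A ->
    (\int[nu]_y log_kernel x y = epot nu x - (ln (4 * A))%:E)%E.
  move=> xA; rewrite -ge0_integralB_cst ?ln4A_ge0//; last 2 first.
  - exact: measurable_elog.
  - by move=> y; exact: elog_ge0.
  apply: ae_eq_integral => //; first exact: measurable_log_kernel.
  - by apply: emeasurable_funB => //; exact: measurable_elog.
  apply: (ae_on mA nuA) => y /=; rewrite in_itv /= -ler_norml => yA _.
  exact: log_kernelE.
rewrite /log_energy -ge0_integralB_cst ?ln4A_ge0//; last 2 first.
- exact: measurable_epot.
- by move=> y; exact: epot_ge0.
apply: ae_eq_integral => //.
  pose k (z : R * R) := log_kernel z.1 z.2.
  rewrite (_ : (fun x => _) = (fun x => \int[nu]_y k^\+ (x, y) - \int[nu]_y k^\- (x, y))%E).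
    apply: emeasurable_funB.
      apply: (measurable_fun_fubini_tonelli_F (k^\+)%E) => //.
      by apply: measurable_funepos; exact: measurable_log_kernel2.
    apply: (measurable_fun_fubini_tonelli_F (k^\-)%E) => //.
    by apply: measurable_funeneg; exact: measurable_log_kernel2.
  apply/funext => x; rewrite integralE; congr (_ - _)%E; apply: eq_integral => y _.
  - by rewrite !funeposE.
  - by rewrite !funenegE.
by apply: (ae_on mA nuA) => x /=; rewrite in_itv /= -ler_norml => xA _; exact: inner.
Qed.

(** At an atom [elog x x = +oo] makes the potential infinite, and the atom charges that same point
    again in the outer integral. *)
Lemma energy_atomless nu x : (energy nu nu < +oo)%E -> nu [set x] = 0%E.
Proof.
move=> fin; apply/eqP; rewrite eq_le measure_ge0 andbT leNgt; apply/negP => nux.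
have step (f : R -> \bar R) : measurable_fun setT f -> (forall y, 0 <= f y)%E ->
    (f x * nu [set x] <= \int[nu]_y f y)%E.
  move=> mf f0.
  rewrite -integral_cst//.
  apply: (@le_trans _ _ (\int[nu]_(y in [set x]) f y)%E).
    by rewrite le_eqVlt; apply/orP; left; apply/eqP; apply: eq_integral => y; rewrite inE => ->.
  by apply: ge0_subset_integral.
have potx : epot nu x = +oo%E.
  apply/eqP; rewrite -leye_eq; apply: le_trans (step _ (measurable_elog A x) (elog_ge0 A x)).
  by rewrite /elog eqxx gt0_mulye.
have := step _ (measurable_epot nu) (epot_ge0 nu).
by rewrite potx gt0_mulye// leye_eq => /eqP E; move: fin; rewrite /energy E ltxx.
Qed.

Lemma epot_real nu x : nu [set x] = 0%E ->
  epot nu x = (\int[nu]_y (tlog A (x - y))%:E)%E.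
Proof.
move=> nux; apply: ae_eq_integral => //.
- exact: measurable_elog.
- by apply/measurable_EFinP; exact: measurable_tlog_sub.
exists [set x]; split => // y /= H; apply: contrapT => yx; apply: H => _.
by rewrite /elog; case: eqVneq => // E; case: yx.
Qed.

End Energy.

(** * First variation of the energy at its minimizer *)

Section Variation.
Context {R : realType}.
Local Notation measR := {measure set R -> \bar R}.

(** Normalizing a measure of mass one leaves its values unchanged and yields a bundled probability;
    the Dirac mass only fills the default slot of [mnormalize]. *)
Lemma prob_of_measure (m : measR) : m setT = 1%E ->
  exists nu : probability R R, forall B, nu B = m B.
Proof.
move=> m1; pose P := mnormalize m (dirac (0 : R)).
by exists P => B; rewrite /P /= /mnormalize m1 /= onee_eq0 /= invr1 mule1.
Qed.

Lemma ge0_integral_mrestr (m : measR) (D : set R) (mD : measurable D) (f : R -> \bar R) :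
  measurable_fun setT f -> (forall x, 0 <= f x)%E ->
  (\int[mrestr m mD]_x f x = \int[m]_(x in D) f x)%E.
Proof.
move=> mf f0.
have D0 : mrestr m mD (~` D) = 0%E by rewrite /mrestr setICl measure0.
rewrite (@ge0_negligible_integral _ _ _ _ setT (~` D))//; last exact: measurableC.
rewrite setDE setTI setCK.
by apply: eq_measure_integral => B mB BD; rewrite /= /mrestr ((setIidPl _ _).2 BD).
Qed.

Lemma prob_restr (m : measR) (D : set R) : measurable D -> (0 < m D)%E -> (m D < +oo)%E ->
  exists nu : probability R R, (forall B, nu B = m (B `&` D) * (fine (m D))^-1%:E)%E /\
   forall f : R -> \bar R, measurable_fun setT f -> (forall x, 0 <= f x)%E ->
    (\int[nu]_x f x = (fine (m D))^-1%:E * \int[m]_(x in D) f x)%E.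
Proof.
move=> mD m0 moo.
have Dfin : m D \is a fin_num by rewrite ge0_fin_numE.
have D0 : 0 < fine (m D) by rewrite fine_gt0// m0.
have i0 : 0 <= (fine (m D))^-1 by rewrite invr_ge0 ltW.
pose m1 := mscale (NngNum i0) (mrestr m mD).
have [|nu nuE] := @prob_of_measure m1.
  rewrite /m1 /= /mscale /= /mrestr setTI -[X in (_ * X)%E]fineK// -EFinM mulVf//.
  by rewrite gt_eqF.
exists nu; split=> [B|f mf f0]; first by rewrite nuE /m1 /= /mscale /= /mrestr muleC.
rewrite (eq_measure_integral m1) => [|B _ _]; last exact: nuE.
by rewrite ge0_integral_mscale// ge0_integral_mrestr.
Qed.

Lemma prob_mix (rho lam : probability R R) (t : R) : 0 <= t <= 1 ->
  exists nu : probability R R,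
   (forall B, nu B = (1 - t)%:E * rho B + t%:E * lam B)%E /\
   forall f : R -> \bar R, measurable_fun setT f -> (forall x, 0 <= f x)%E ->
    (\int[nu]_x f x = (1 - t)%:E * \int[rho]_x f x + t%:E * \int[lam]_x f x)%E.
Proof.
move=> /andP[t0 t1]; have s0 : 0 <= 1 - t by rewrite subr_ge0.
pose m := measure_add (mscale (NngNum s0) rho) (mscale (NngNum t0) lam).
have mE B : m B = ((1 - t)%:E * rho B + t%:E * lam B)%E.
  by rewrite /m measure_addE.
have [|nu nuE] := @prob_of_measure m.
  by apply: etrans (mE _) _; rewrite !probability_setT !mule1 -EFinD subrK.
exists nu; split=> [B|f mf f0]; first exact: etrans (nuE B) (mE B).
rewrite (eq_measure_integral m) => [|B _ _]; last exact: nuE.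
by rewrite ge0_integral_measure_add// !ge0_integral_mscale.
Qed.

(* Comparing the energy of [rho] with that of [(1 - t) rho + t lam], [t -> 0]. *)
Lemma energy_variation (A g : R) (E : set R) (rho lam : probability R R) :
  rho (~` E) = 0%E -> lam (~` E) = 0%E -> energy A rho rho = g%:E ->
  (forall nu : probability R R, nu (~` E) = 0%E -> (g%:E <= energy A nu nu)%E) ->
  (energy A lam lam < +oo)%E -> (g%:E <= energy A lam rho)%E.
Proof.
move=> rhoE lamE gE gmin lamfin.
have := energy_ge0 A lam rho; case jE : (energy A lam rho) => [j||]// _; last by rewrite leey.
have := energy_ge0 A lam lam; case lE : (energy A lam lam) lamfin => [l||]// _ l0.
rewrite lee_fin leNgt; apply/negP => jg.
(* The energy of the mixture is [g - 2 t (g - j) + t^2 (g - 2 j + l)]; with [t c <= g - j] the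
   quadratic term cannot make up for the linear one, and the energy falls below [g]. *)
pose c := `|g - 2 * j + l| + 1.
have c0 : 0 < c by rewrite ltr_wpDl.
pose t := Num.min (1 / 2) ((g - j) / c).
have t0 : 0 < t by rewrite lt_min !divr_gt0// subr_gt0.
have t2 : t <= 1 / 2 by rewrite ge_min lexx.
have tc : t * c <= g - j by rewrite -ler_pdivlMr// ge_min lexx orbT.
have t01 : 0 <= t <= 1 by rewrite ltW//=; lra.
have [nu [nuE nuI]] := prob_mix rho lam t01.
have /gmin : nu (~` E) = 0%E by rewrite nuE rhoE lamE !mule0 adde0.
have en (m : {finite_measure set R -> \bar R}) :
    energy A nu m = ((1 - t)%:E * energy A rho m + t%:E * energy A lam m)%E.
  rewrite /energy nuI//; first exact: measurable_epot.
  by move=> x; exact: epot_ge0.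
rewrite en [energy A rho nu]energyC [energy A lam nu]energyC !en.
rewrite [energy A rho lam]energyC gE jE lE.
rewrite -[X in (_ <= X)%E -> _]/(((1 - t) * ((1 - t) * g + t * j) +
  t * ((1 - t) * j + t * l))%:E) lee_fin.
have : t * (g - 2 * j + l) <= t * c.
  by rewrite ler_pM2l// (le_trans (ler_norm _))// lerDl.
by nra.
Qed.

End Variation.

(** * The equilibrium potential *)

Section Potential.
Context {R : realType}.
Implicit Types (x y : R) (k : R -> R).
Variable rho : probability R R.
Hypothesis atomless : forall x, rho [set x] = 0%E.

Definition pot k x : \bar R := (\int[rho]_y (k (x - y))%:E)%E.

Lemma measurable_sub k x : measurable_fun setT k ->
  measurable_fun setT (fun y => k (x - y)).
Proof. by move=> mk; apply: measurableT_comp => //; exact: measurable_funB. Qed.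

(** Lower semicontinuity of a potential, by Fatou's lemma along the sequence [u]. Continuity of the
    kernel off [0] is enough, which covers both [tlog] and [smoothing], whose values at [0] are
    conventional. *)
Lemma pot_le_lim k (u : nat -> R) x (M : \bar R) :
  measurable_fun setT k -> (forall d, 0 <= k d) ->
  (forall d, d != 0 -> {for d, continuous k}) ->
  u n @[n --> \oo] --> x -> (forall n, pot k (u n) <= M)%E -> (pot k x <= M)%E.
Proof.
move=> mk k0 ck ux uM.
have mfk z : measurable_fun setT (fun y => (k (z - y))%:E).
  by apply/measurable_EFinP; exact: measurable_sub.
(* Changing the integrand on the null set [y = x] makes it converge everywhere. *)
pose cut z y : \bar R := if y == x then 0%E else (k (z - y))%:E.
have mcut z : measurable_fun setT (cut z).
  by apply: measurable_fun_ifT => //; exact: measurable_fun_eqr.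
have cut0 z y : setT y -> (0 <= cut z y)%E.
  by move=> _; rewrite /cut; case: ifP => // _; rewrite lee_fin.
have potE z : pot k z = (\int[rho]_y cut z y)%E.
  apply: ae_eq_integral => //; exists [set x]; split => //; first exact: atomless.
  move=> y /= H; apply: contrapT => yx; apply: H => _.
  by rewrite /cut; case: eqP.
rewrite potE.
have -> : (\int[rho]_y cut x y = \int[rho]_y limn_einf (fun n => cut (u n) y))%E.
  apply: eq_integral => y _; apply/esym; rewrite /cut; case: eqVneq => yx.
    by have [] := @cvg_limn_einf_sup R (fun=> 0%E) 0%E (@cvg_cst _ _ _ _ _).
  have fc : (k (u n - y))%:E @[n --> \oo] --> (k (x - y))%:E.
    apply: cvg_EFin; first exact: nearW.
    apply: (@cvg_comp _ _ _ (fun n => u n - y) k _ (nbhs (x - y))).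
      by apply: cvgB => //; exact: cvg_cst.
    by apply: ck; rewrite subr_eq0 eq_sym.
  by have [] := cvg_limn_einf_sup fc.
apply: le_trans (fatou rho measurableT (fun n => mcut (u n)) (fun n => cut0 (u n))) _.
rewrite limn_einf_lim; apply: lime_le; first exact: is_cvg_einfs.
apply: nearW => n; apply: le_trans (uM n); rewrite potE.
by apply: ereal_inf_lbound; exists n => /=.
Qed.

End Potential.

Section ConstantBounds.
Context {R : realType} (m : {measure set R -> \bar R}) (D : set R) (f : R -> \bar R) (c : R).
Hypotheses (mD : measurable D) (mf : measurable_fun setT f) (f0 : forall x, (0 <= f x)%E).

Lemma integral_le_cst : (forall x, D x -> f x <= c%:E)%E ->
  (\int[m]_(x in D) f x <= c%:E * m D)%E.
Proof.
move=> fc; rewrite -integral_cst//; apply: ge0_le_integral => //.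
exact: measurable_funTS.
Qed.

Lemma integral_ge_cst : 0 <= c -> (forall x, D x -> c%:E <= f x)%E ->
  (c%:E * m D <= \int[m]_(x in D) f x)%E.
Proof.
move=> c0 fc; rewrite -integral_cst//; apply: ge0_le_integral => //.
exact: measurable_funTS.
Qed.

End ConstantBounds.

Section Equilibrium.
Context {R : realType} (A : R) (A1 : 1 <= A) (E : set R) (rho : probability R R) (g : R).
Hypothesis mE : measurable E.
Hypothesis rhoE : rho (~` E) = 0%E.
Hypothesis gE : energy A rho rho = g%:E.
Hypothesis gmin : forall nu : probability R R, nu (~` E) = 0%E -> (g%:E <= energy A nu nu)%E.
Implicit Types (x y : R) (D : set R).

Let atomless x : rho [set x] = 0%E.
Proof. by apply: (@energy_atomless _ A); rewrite gE ltry. Qed.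

Lemma epotE x : epot A rho x = pot rho (tlog A) x.
Proof. exact: epot_real. Qed.

(** Tests [energy_variation] with [m] restricted to [D] and normalized. The majorant [h] of the
    potential of that restriction certifies its finite energy; it will be the potential of [rho]
    when [m = rho] and a constant when [m] is Lebesgue measure. *)
Lemma average_epot (m : {measure set R -> \bar R}) (h : R -> \bar R) D :
  measurable D -> D `<=` E -> (0 < m D)%E -> (m D < +oo)%E ->
  measurable_fun setT h -> (forall x, 0 <= h x)%E ->
  (forall x, \int[m]_(y in D) elog A x y <= h x)%E ->
  (\int[m]_(x in D) h x < +oo)%E ->
  (g%:E * m D <= \int[m]_(x in D) epot A rho x)%E.
Proof.
move=> mD DE D0 Doo mh h0 hh hoo.
have [lam [lamE lamI]] := prob_restr mD D0 Doo.
set c := (fine (m D))^-1 in lamE lamI.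
have c0 : 0 < c by rewrite invr_gt0 fine_gt0// D0.
have lE : lam (~` E) = 0%E.
  rewrite lamE (_ : ~` E `&` D = set0) ?measure0 ?mul0e//.
  by rewrite setIC; apply/disjoints_subset; rewrite setCK.
have := energy_variation rhoE lE gE gmin.
have -> : energy A lam rho = (c%:E * \int[m]_(x in D) epot A rho x)%E.
  rewrite /energy lamI//; first exact: measurable_epot.
  exact: epot_ge0.
have -> : (energy A lam lam < +oo)%E.
  have le1 x : (epot A lam x <= c%:E * h x)%E.
    rewrite /epot lamI; [|exact: measurable_elog|exact: elog_ge0].
    by rewrite lee_pmul2l// lte_fin.
  apply: (@le_lt_trans _ _ (\int[lam]_x (c%:E * h x))%E).
    apply: ge0_le_integral => //.
    - by move=> x _; exact: epot_ge0.
    - exact: measurable_epot.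
    - by apply: measurable_funeM.
  rewrite ge0_integralZl//; last by rewrite lee_fin ltW.
  rewrite lamI// muleA -EFinM lte_mul_pinfty//.
  by rewrite lee_fin mulr_ge0 ?ltW.
have d0 : (0 < (fine (m D))%:E)%E by rewrite lte_fin fine_gt0// D0.
have dc : ((fine (m D))%:E * c%:E = 1)%E by rewrite -EFinM mulfV// gt_eqF.
move=> /(_ isT) /(lee_wpmul2l (ltW d0)); rewrite muleA dc mul1e.
by rewrite fineK ?ge0_fin_numE// muleC.
Qed.

(** Otherwise some [F n] has positive mass within [E]; the normalized restriction of [rho] to it has
    finite energy and averages the potential to at most [g - 1 / (n + 1)], against
    [average_epot]. *)
Lemma pot_lt_null : rho [set x | (epot A rho x < g%:E)%E] = 0%E.
Proof.
have mU := measurable_epot A rho.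
pose F (n : nat) := [set x | (epot A rho x <= (g - n.+1%:R^-1)%:E)%E].
have mF n : measurable (F n).
  by rewrite -[F n]setTI; exact: emeasurable_fun_infty_c.
have F0 n : rho (F n `&` E) = 0%E.
  apply/eqP; rewrite eq_le measure_ge0 andbT leNgt; apply/negP => Fpos.
  have mD : measurable (F n `&` E) by exact: measurableI.
  have Doo : (rho (F n `&` E) < +oo)%E by apply: le_lt_trans (ltry 1); exact: probability_le1.
  have H1 x : (\int[rho]_(y in F n `&` E) elog A x y <= epot A rho x)%E.
    apply: ge0_subset_integral => //; first exact: measurable_elog.
    by move=> y _; exact: elog_ge0.
  have H2 : (\int[rho]_(x in F n `&` E) epot A rho x < +oo)%E.
    apply: (@le_lt_trans _ _ (energy A rho rho)); last by rewrite gE ltry.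
    by apply: ge0_subset_integral => // x _; exact: epot_ge0.
  have H := average_epot mD (@subIsetr _ _ _) Fpos Doo mU (epot_ge0 A rho) H1 H2.
  have H3 : (\int[rho]_(x in F n `&` E) epot A rho x <=
      (g - n.+1%:R^-1)%:E * rho (F n `&` E))%E.
    by apply: integral_le_cst => //; [exact: epot_ge0|move=> x []].
  move: (le_trans H H3); rewrite lee_pmul2r ?ge0_fin_numE// lee_fin.
  by rewrite lerDl oppr_ge0 leNgt invr_gt0 ltr0n.
have : rho.-negligible ((\bigcup_n (F n `&` E)) `|` ~` E).
  apply: negligibleU; last by apply/negligibleP => //; exact: measurableC.
  apply: negligible_bigcup => n.
  by apply: (negligibleP _ _).2 (F0 n); exact: measurableI.
move=> N; apply/negligibleP; last first.
  apply: negligibleS N => x /= xg.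
  have [Ex|nEx] := pselect (E x); [left|by right].
  have [n hn] : exists n : nat, (epot A rho x <= (g - n.+1%:R^-1)%:E)%E.
    have := epot_ge0 A rho x; case: (epot A rho x) xg => [r||]// rg _.
    rewrite lte_fin -subr_gt0 in rg.
    exists (Num.truncn (g - r)^-1); rewrite lee_fin.
    rewrite lerBrDl addrC -lerBrDl -[leRHS]invrK lef_pV2 ?posrE ?invr_gt0//.
    by rewrite ltW// truncnS_gt.
  by exists n.
by rewrite -[X in measurable X]setTI; exact: emeasurable_fun_infty_o.
Qed.

(** The potential is at least [g] almost everywhere by [pot_lt_null] and has [rho]-mean exactly [g],
    so no excess can have positive mass. *)
Lemma pot_gt_null : rho [set x | (g%:E < epot A rho x)%E] = 0%E.
Proof.
have mU := measurable_epot A rho.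
pose F (n : nat) := [set x | ((g + n.+1%:R^-1)%:E <= epot A rho x)%E].
have mF n : measurable (F n).
  by rewrite -[F n]setTI; exact: emeasurable_fun_c_infty.
have F0 n : rho (F n) = 0%E.
  pose G := [set x | (g%:E <= epot A rho x)%E] `\` F n.
  have mG0 : measurable [set x | (g%:E <= epot A rho x)%E].
    by rewrite -[X in measurable X]setTI; exact: emeasurable_fun_c_infty.
  have mG : measurable G by exact: measurableD.
  have dis : [disjoint F n & G] by apply/disj_set2P; rewrite /G setDIK.
  have FG : (rho (F n) + rho G = 1)%E.
    rewrite -measureU//; last exact/disj_set2P.
    rewrite (_ : F n `|` G = ~` [set x | (epot A rho x < g%:E)%E]).
      apply: etrans (probability_setC rho _) _; last by rewrite pot_lt_null sube0.
      by rewrite -[X in measurable X]setTI; exact: emeasurable_fun_infty_o.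
    apply/seteqP; split => x /=.
      case=> [Fx|[]]; last by move=> /= gx _; apply/negP; rewrite -leNgt.
      apply/negP; rewrite -leNgt; apply: le_trans Fx.
      by rewrite lee_fin lerDl invr_ge0.
    move=> /negP; rewrite -leNgt => gx.
    by have [Fx|nFx] := pselect (F n x); [left|right].
  have g0 : 0 <= g by have := energy_ge0 A rho rho; rewrite gE lee_fin.
  have le1 : ((g + n.+1%:R^-1)%:E * rho (F n) + g%:E * rho G <= g%:E)%E.
    rewrite -[leRHS]gE /energy.
    apply: (@le_trans _ _ (\int[rho]_(x in F n `|` G) epot A rho x)%E).
      rewrite ge0_integral_setU//; last 2 first.
      - exact: measurable_funTS.
      - by move=> x _; exact: epot_ge0.
      apply: leeD.
        by apply: integral_ge_cst => //; exact: addr_ge0.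
      by apply: integral_ge_cst => //; move=> x [].
    apply: ge0_subset_integral => //; first exact: measurableU.
    by move=> x _; exact: epot_ge0.
  have Ffin : rho (F n) \is a fin_num by exact: fin_num_measure.
  have Gfin : rho G \is a fin_num by exact: fin_num_measure.
  have F0 : 0 <= fine (rho (F n)) by rewrite fine_ge0.
  have Fa := fineK Ffin; have Gb := fineK Gfin.
  move: FG le1 F0; rewrite -Fa -Gb.
  move: (fine (rho (F n))) (fine (rho G)) => a b.
  move=> [ab1] le1 a0; congr EFin; apply/eqP; rewrite eq_le a0 andbT.
  have n0 : 0 < n.+1%:R^-1 :> R by rewrite invr_gt0.
  rewrite -(pmulr_rle0 _ n0).
  have E1 : b = 1 - a by rewrite -ab1; ring.
  have {}le1 : (g + n.+1%:R^-1) * a + g * b <= g := le1.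
  by move: le1; rewrite E1; move: (n.+1%:R^-1 : R) => d; nra.
have : rho.-negligible (\bigcup_n F n).
  by apply: negligible_bigcup => n; exact: (negligibleP _ (mF n)).2 (F0 n).
move=> N; apply/negligibleP; last first.
  apply: negligibleS N => x /= xg.
  have [n hn] : exists n : nat, ((g + n.+1%:R^-1)%:E <= epot A rho x)%E.
    case: (epot A rho x) xg => [r||]//; last by move=> _; exists 0%N; rewrite leey.
    rewrite lte_fin -subr_gt0 => rg.
    exists (Num.truncn (r - g)^-1); rewrite lee_fin.
    rewrite addrC -lerBrDr -[leRHS]invrK lef_pV2 ?posrE ?invr_gt0//.
    by rewrite ltW// truncnS_gt.
  by exists n.
by rewrite -[X in measurable X]setTI; exact: emeasurable_fun_o_infty.
Qed.

End Equilibrium.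

(** * Strict concavity of the logarithm and potentials in gaps *)

Section Gap.
Context {R : realType}.

(** Tangent inequality with a quadratic gain. Applying [ln w <= w - 1] to [w = sqrt (u / d)] rather
    than to [u / d] leaves [(w - 1)^2] to spare, and [u - d = (w - 1) (w + 1) d] with
    [(w + 1) d = sqrt (u d) + d <= 2 D]. *)
Lemma ln_tangent (u d D : R) : 0 < u <= D -> 0 < d <= D ->
  ln u <= ln d + (u / d - 1) - (u - d) ^+ 2 / (4 * D ^+ 2).
Proof.
move=> /andP[u0 uD] /andP[d0 dD].
pose w := Num.sqrt (u / d).
have ud0 : 0 < u / d by rewrite divr_gt0.
have w0 : 0 < w by rewrite sqrtr_gt0.
have wE : u / d = w ^+ 2 by rewrite sqr_sqrtr// ltW.
have lnw : ln w <= w - 1.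
  by have := @le_ln1Dx _ (w - 1); rewrite (addrC 1) subrK; apply; lra.
have -> : ln u = ln d + 2 * ln w.
  have lw2 : ln (u / d) = 2 * ln w by rewrite wE lnXn// mulr_natl.
  by move: lw2; rewrite ln_div ?posrE//; lra.
have uE : u = w ^+ 2 * d by rewrite -wE divfK// gt_eqF.
rewrite wE -!addrA lerD2l.
suff : (u - d) ^+ 2 / (4 * D ^+ 2) <= (w - 1) ^+ 2 by lra.
have D0 : 0 < D by exact: lt_le_trans dD.
rewrite ler_pdivrMr ?mulr_gt0 ?exprn_gt0//.
have -> : (u - d) ^+ 2 = (w - 1) ^+ 2 * ((w + 1) * d) ^+ 2 by rewrite uE; ring.
rewrite ler_wpM2l ?sqr_ge0//.
have wd : w * d <= D.
  have : (w * d) ^+ 2 <= D ^+ 2.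
    rewrite (_ : (w * d) ^+ 2 = u * d); last by rewrite uE; ring.
    by rewrite expr2 ler_pM// ?(ltW u0) ?(ltW d0).
  by rewrite ler_sqr ?nnegrE ?(ltW D0)// mulr_ge0 ?(ltW w0) ?(ltW d0).
have -> : 4 * D ^+ 2 = (D + D) ^+ 2 by ring.
have wd0 : 0 <= (w + 1) * d by rewrite mulr_ge0 ?addr_ge0 ?(ltW w0) ?(ltW d0).
rewrite lerXn2r ?nnegrE ?addr_ge0 ?(ltW D0)//.
by rewrite mulrDl mul1r lerD.
Qed.

Context (A : R) (A1 : 1 <= A) (S : set R) (rho : probability R R) (g : R).
Hypothesis cS : closed S.
Hypothesis SA : S `<=` `[- A, A].
Hypothesis rhoS : rho (~` S) = 0%E.
Hypothesis atomless : forall x, rho [set x] = 0%E.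
Hypothesis US : forall x, S x -> (pot rho (tlog A) x <= g%:E)%E.
Implicit Types (x y : R).

(** A pointwise convexity inequality is integrated against [rho]; the points [a] and [b], where
    [tlog] takes its junk value, are null. Points outside the convex hull of [S] will use [a = b]
    and [p = 1]. *)
Lemma pot_convex x (a b p q c : R) : S a -> S b -> 0 <= p -> 0 <= q -> p + q = 1 -> 0 <= c ->
  (forall y, S y -> y != a -> y != b ->
    tlog A (x - y) + c <= p * tlog A (a - y) + q * tlog A (b - y)) ->
  (pot rho (tlog A) x <= (g - c)%:E)%E.
Proof.
move=> Sa Sb p0 q0 pq c0 H.
have mt z : measurable_fun setT (fun y => (tlog A (z - y))%:E).
  by apply/measurable_EFinP; exact: measurable_tlog_sub.
have t0 z y : (0 <= (tlog A (z - y))%:E)%E by rewrite lee_fin tlog_ge0.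
have : (pot rho (tlog A) x + c%:E <= p%:E * pot rho (tlog A) a + q%:E * pot rho (tlog A) b)%E.
  rewrite -ge0_integralZl// -ge0_integralZl//.
  rewrite -ge0_integralD//; last 4 first.
  - by move=> y _; rewrite mule_ge0.
  - by apply: measurable_funeM.
  - by move=> y _; rewrite mule_ge0.
  - by apply: measurable_funeM.
  have -> : c%:E = (\int[rho]_y (cst c%:E y))%E.
    by rewrite integral_cst//= probability_setT mule1.
  rewrite -ge0_integralD//.
  apply: ae_ge0_le_integral => //.
  - by move=> y _; rewrite adde_ge0.
  - exact: emeasurable_funD.
  - by move=> y _; rewrite adde_ge0// mule_ge0.
  - by apply: emeasurable_funD; apply: measurable_funeM.
  have N : rho.-negligible (~` S `|` [set a] `|` [set b]).
    apply: negligibleU; first apply: negligibleU.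
    - by apply: (negligibleP _ _).2 rhoS; apply: measurableC; exact: closed_measurable.
    - exact: (negligibleP _ (measurable_set1 _)).2 (atomless _).
    - exact: (negligibleP _ (measurable_set1 _)).2 (atomless _).
  apply: negligibleS N => y /= nle; apply: contrapT => yN; apply: nle => _.
  have [Sy ya yb] : [/\ S y, y != a & y != b].
    split; [apply: contrapT => nSy|apply/eqP => ya|apply/eqP => yb]; apply: yN;
      [by left; left|by left; right|by right].
  exact: H.
move=> le1.
have le2 : (p%:E * pot rho (tlog A) a + q%:E * pot rho (tlog A) b <= g%:E)%E.
  rewrite [leRHS](_ : _ = (p%:E * g%:E + q%:E * g%:E)%E).
    by apply: leeD; apply: lee_wpmul2l; rewrite ?lee_fin// US.
  by rewrite -!EFinM -EFinD -mulrDl pq mul1r.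
by rewrite EFinB leeBrDr//; apply: le_trans le2.
Qed.

Lemma compact_support_set : compact S.
Proof.
apply: (subclosed_compact cS (@segment_compact _ (- A) A)) => //.
Qed.

(** An elementary substitute for the maximum principle. For [x] in a gap [(a, b)] of [S], every [y]
    in [S] lies on one side, so [|x - y|] is the convex combination of [|a - y|] and [|b - y|] with
    the barycentric weights of [x]. The linear terms of [ln_tangent] then cancel and the quadratic
    ones remain; with [D = 2 A] they give [s^2 / (16 A^2)]. *)
Lemma pot_gap x s : `|x| <= A -> 0 < s -> (forall y, S y -> s <= `|x - y|) ->
  (pot rho (tlog A) x <= (g - s ^+ 2 / (16 * A ^+ 2))%:E)%E.
Proof.
move=> xA s0 Hs.
have A0 : 0 < A by exact: lt_le_trans A1.
set c := s ^+ 2 / _.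
have c0 : 0 <= c by rewrite divr_ge0 ?sqr_ge0// mulr_ge0// sqr_ge0.
have SA' y : S y -> `|y| <= A by move=> /SA /=; rewrite in_itv /= ler_norml.
have sub2A z y : `|z| <= A -> `|y| <= A -> `|z - y| <= 2 * A.
  by move=> zA yA; apply: le_trans (ler_normB _ _) _; lra.
have tl z y : `|z| <= A -> S y -> y != z -> tlog A (z - y) = ln (4 * A) - ln `|z - y|.
  move=> zA Sy yz; rewrite tlogE//; first by rewrite subr_eq0 eq_sym.
  by have := sub2A _ _ zA (SA' _ Sy); lra.
(* the tangent bound at [|x - y|], once for each of the two gap endpoints *)
have tang z y : S z -> S y -> y != z ->
    - ln `|x - y| <= - ln `|z - y| + (`|z - y| / `|x - y| - 1) - (`|z - y| - `|x - y|) ^+ 2 / (16 * A ^+ 2).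
  move=> Sz Sy yz; have d0 : 0 < `|x - y| by apply: lt_le_trans (Hs _ Sy).
  have := @ln_tangent `|z - y| `|x - y| (2 * A).
  rewrite normr_gt0 subr_eq0 eq_sym yz d0 (sub2A _ _ (SA' _ Sz) (SA' _ Sy)).
  rewrite (sub2A _ _ xA (SA' _ Sy)) => /(_ isT isT).
  by rewrite (_ : 4 * (2 * A) ^+ 2 = 16 * A ^+ 2); [lra|ring].
have sqs (u d : R) : s <= `|u - d| -> c <= (u - d) ^+ 2 / (16 * A ^+ 2).
  have c16 : 0 <= (16 * A ^+ 2)^-1 by rewrite invr_ge0 ?mulr_ge0 ?(ltW A0).
  move=> h; rewrite ler_wpM2r//.
  by rewrite -[leRHS]real_normK ?num_real// lerXn2r ?nnegrE ?(ltW s0).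
have xS y : S y -> y != x.
  by move=> Sy; apply/eqP => E; have := Hs _ Sy; rewrite E subrr normr0 leNgt s0.
(* Case of [x] outside the convex hull of [S]: the nearest end [z] is closer than [x] to every [y]
   by at least [s], so the linear term of the tangent bound is already nonpositive. *)
have one z : S z -> (forall y, S y -> y != z -> `|z - y| + s <= `|x - y|) ->
    (pot rho (tlog A) x <= (g - c)%:E)%E.
  move=> Sz Hz; apply: (@pot_convex x z z 1 0 c) => //; first by rewrite addr0.
  move=> y Sy yz _; rewrite mul0r mul1r addr0.
  rewrite (tl _ _ xA Sy (xS _ Sy)) (tl _ _ (SA' _ Sz) Sy yz).
  have h := Hz _ Sy yz; have := tang _ _ Sz Sy yz.
  have d0 : 0 < `|x - y| by apply: lt_le_trans (Hs _ Sy).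
  have : `|z - y| / `|x - y| <= 1 by rewrite ler_pdivrMr// mul1r; lra.
  have := @sqs `|z - y| `|x - y|; rewrite ler0_norm; last by lra.
  by move=> /(_ ltac:(lra)); lra.
have [l hl] : exists l, S l.
  apply: contrapT => /forallNP nS; have S0 : ~` S = setT.
    by apply/seteqP; split => // y _; exact: nS.
  by move: rhoS; rewrite S0 probability_setT => -[] /eqP; rewrite oner_eq0.
have cid (B : set R) : {within B, continuous (id : R -> R)}.
  by apply: continuous_subspaceT => z; exact: cvg_id.
have maxL : (exists y, S y /\ y <= x) ->
    exists a, [/\ S a, a <= x & forall y, S y -> y <= x -> y <= a].
  move=> [y0 [Sy0 y0x]].
  have cL : compact (S `&` `]-oo, x]).
    apply: (subclosed_compact _ compact_support_set) => //.
    by apply: closedI => //; exact: interval_closed.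
  have [|a] := compact_EVT_max _ cL (@cid _).
    by exists y0; split => //=; rewrite in_itv.
  rewrite inE /= in_itv /= => -[Sa ax] aM; exists a; split => // y Sy yx.
  by apply: aM; rewrite inE /= in_itv.
have minR : (exists y, S y /\ x <= y) ->
    exists b, [/\ S b, x <= b & forall y, S y -> x <= y -> b <= y].
  move=> [y0 [Sy0 y0x]].
  have cR : compact (S `&` `[x, +oo[).
    apply: (subclosed_compact _ compact_support_set) => //.
    by apply: closedI => //; exact: interval_closed.
  have [|b] := compact_EVT_min _ cR (@cid _).
    by exists y0; split => //=; rewrite in_itv /= andbT.
  rewrite inE /= in_itv /= andbT => -[Sb bx] bM; exists b; split => // y Sy yx.
  by apply: bM; rewrite inE /= in_itv /= andbT.
have [hL|nL] := pselect (exists y, S y /\ y <= x);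
  have [hR|nR] := pselect (exists y, S y /\ x <= y).
- have [a [Sa ax aM]] := maxL hL; have [b [Sb xb bM]] := minR hR.
  have sa : s <= x - a by have := Hs _ Sa; rewrite ger0_norm ?subr_ge0.
  have sb : s <= b - x by have := Hs _ Sb; rewrite distrC ger0_norm ?subr_ge0.
  have ab0 : 0 < b - a by lra.
  pose p := (b - x) / (b - a); pose q := (x - a) / (b - a).
  have p0 : 0 <= p by rewrite divr_ge0 ?(ltW ab0) ?subr_ge0.
  have q0 : 0 <= q by rewrite divr_ge0 ?(ltW ab0) ?subr_ge0.
  have pq : p + q = 1 by rewrite /p /q -mulrDl (_ : b - x + (x - a) = b - a) ?divff ?gt_eqF//; ring.
  apply: (@pot_convex x a b p q c) => // y Sy ya yb.
  rewrite (tl _ _ xA Sy (xS _ Sy)) (tl _ _ (SA' _ Sa) Sy ya) (tl _ _ (SA' _ Sb) Sy yb).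
  have ha := tang _ _ Sa Sy ya; have hb := tang _ _ Sb Sy yb.
  have d0 : 0 < `|x - y| by apply: lt_le_trans (Hs _ Sy).
  have [ca cb lin] : [/\ s <= `| `|a - y| - `|x - y| |, s <= `| `|b - y| - `|x - y| | &
      p * `|a - y| + q * `|b - y| = `|x - y|].
    have [yx|xy] := leP y x.
      have := aM _ Sy yx => yla.
      have -> : `|a - y| = a - y by rewrite ger0_norm//; lra.
      have -> : `|b - y| = b - y by rewrite ger0_norm//; lra.
      have -> : `|x - y| = x - y by rewrite ger0_norm//; lra.
      split.
      - by rewrite ler0_norm; lra.
      - by rewrite ger0_norm; lra.
      - by rewrite /p /q; field; rewrite gt_eqF.
    have := bM _ Sy (ltW xy) => bly.
    have -> : `|a - y| = y - a by rewrite ler0_norm; lra.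
    have -> : `|b - y| = y - b by rewrite ler0_norm; lra.
    have -> : `|x - y| = y - x by rewrite ler0_norm; lra.
    split.
    - by rewrite ger0_norm; lra.
    - by rewrite ler0_norm; lra.
    - by rewrite /p /q; field; rewrite gt_eqF.
  have {}ca := sqs _ _ ca; have {}cb := sqs _ _ cb.
  have lin2 : p * (`|a - y| / `|x - y|) + q * (`|b - y| / `|x - y|) = 1.
    by rewrite !mulrA -mulrDl lin divff// gt_eqF.
  have {}ha : - ln `|x - y| + c <= - ln `|a - y| + (`|a - y| / `|x - y| - 1) by lra.
  have {}hb : - ln `|x - y| + c <= - ln `|b - y| + (`|b - y| / `|x - y| - 1) by lra.
  have := lerD (ler_wpM2l p0 ha) (ler_wpM2l q0 hb).
  rewrite -mulrDl pq mul1r; move: lin2 pq.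
  move: (_ / `|x - y|) (_ / `|x - y|) => r1 r2.
  move: (ln _) (ln _) (ln _) (ln _) => l1 l2 l3 l4 => E1 E2.
  have -> : p = 1 - q by lra.
  have : r1 = r1 by [].
  move: E1; have -> : p = 1 - q by lra.
  by move=> E1 _; nra.
- have [a [Sa ax aM]] := maxL hL; apply: (one a Sa) => y Sy ya.
  have yx : y <= x by rewrite leNgt; apply/negP => /ltW xy; apply: nR; exists y.
  have yla := aM _ Sy yx.
  have := Hs _ Sa; rewrite !ger0_norm ?subr_ge0//; lra.
- have [b [Sb xb bM]] := minR hR; apply: (one b Sb) => y Sy yb.
  have xy : x <= y by rewrite leNgt; apply/negP => /ltW yx; apply: nL; exists y.
  have bly := bM _ Sy xy.
  have := Hs _ Sb; rewrite !ler0_norm ?subr_le0//; lra.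
- exfalso; have [lx|xl] := leP l x; first by apply: nL; exists l.
  by apply: nR; exists l; rewrite ltW.
Qed.

End Gap.

(* The library's Lebesgue measure lives on [measurableTypeR R], whose display
   differs from that of the canonical Borel structure of [R] used in the
   statement. *)
Section BorelLebesgue.
Context (R : realType).

Definition leb (B : set R) : \bar R := @lebesgue_measure R B.

Let leb0 : leb set0 = 0%E.
Proof. exact: (measure0 (@lebesgue_measure R)). Qed.

Let leb_ge0 B : (0 <= leb B)%E.
Proof. exact: (measure_ge0 (@lebesgue_measure R)). Qed.

Let leb_sigma_additive : semi_sigma_additive leb.
Proof. exact: (@measure_semi_sigma_additive _ _ _ (@lebesgue_measure R)). Qed.

HB.instance Definition _ := isMeasure.Build _ R R leb leb0 leb_ge0 leb_sigma_additive.

End BorelLebesgue.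

(** * Bounded logarithmic potentials of Lebesgue measure *)

Section LebesgueLog.
Context {R : realType} (A : R) (A1 : 1 <= A).
Implicit Types (x y d : R).

Let A0 : 0 < 4 * A. Proof. by rewrite mulr_gt0// (lt_le_trans _ A1). Qed.

Let r (j : nat) : R := 4 * A / 2 ^+ j.

(** [N] is the first index with [r N < |d|], so [tlog A d] is at most [ln 2] times the number of
    dyadic radii [r j] that reach [|d|]. *)
Lemma tlog_dyadic d : d != 0 -> exists N : nat,
  tlog A d <= N%:R * ln 2 /\ forall j, (j < N)%N -> `|d| <= r j.
Proof.
move=> d0; have nd0 : 0 < `|d| by rewrite normr_gt0.
have ex : exists n, r n < `|d|.
  have cv : 2^-1 ^+ n @[n --> \oo] --> (0 : R).
    by apply: cvg_expr; rewrite ger0_norm// invf_lt1// ltr1n.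
  have e0 : 0 < `|d| / (4 * A) by rewrite divr_gt0.
  move/cvgrPdist_lt : cv => /(_ _ e0) [M _ HM]; exists M.
  have := HM M (leqnn _); rewrite sub0r normrN ger0_norm ?exprn_ge0//.
  by rewrite ltr_pdivlMr// exprVn mulrC.
exists (ex_minn ex); case: ex_minnP => N hN minN; split.
  rewrite /tlog ge_max mulr_ge0 ?ln_ge0 ?ler1n//=.
  rewrite lerBlDr -lerBlDl -[leLHS]opprK opprB.
  have : ln (r N) <= ln `|d| by rewrite ler_ln ?posrE ?divr_gt0 ?exprn_gt0// ltW.
  rewrite /r ln_div ?posrE ?exprn_gt0// lnXn// -mulr_natl; lra.
by move=> j jN; rewrite leNgt; apply/negP => /minN; rewrite leqNgt jN.
Qed.

(** By [tlog_dyadic] the kernel is dominated off the diagonal by [ln 2] times a sum of indicators of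
    intervals of length [2 r j = 8 A / 2^j]; the lengths add up to [16 A]. *)
Lemma lebesgue_log_bound : exists C : R, 0 <= C /\ forall (D : set R) x, measurable D ->
  (\int[@leb R]_(y in D) elog A x y <= C%:E)%E.
Proof.
have l2 : 0 <= ln (2 : R) by rewrite ln_ge0// ler1n.
have rj j : 0 < r j by rewrite divr_gt0 ?exprn_gt0.
exists (16 * A * ln 2); split; first by rewrite mulr_ge0// mulr_ge0// (le_trans _ A1).
move=> D x mD.
pose I j : set R := [set` `[x - r j, x + r j]].
pose f j y : \bar R := (ln 2 * \1_(I j) y)%:E.
have mf j : measurable_fun setT (f j).
  apply/measurable_EFinP; apply: measurable_funM => //.
  by apply: measurable_indic; exact: measurable_itv.
have f0 j y : (0 <= f j y)%E by rewrite lee_fin mulr_ge0// indicE.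
have If j : (\int[@leb R]_y f j y = (16 * A * ln 2 / (2 ^ j.+1)%:R)%:E)%E.
  have m1 : measurable_fun setT (fun y => (\1_(I j) y)%:E : \bar R).
    by apply/measurable_EFinP; apply: measurable_indic; exact: measurable_itv.
  have p1 y : setT y -> (0 <= (\1_(I j) y)%:E :> \bar R)%E by rewrite lee_fin indicE.
  have p2 : (0 <= (ln 2)%:E :> \bar R)%E by rewrite lee_fin.
  have -> : (\int[@leb R]_y f j y =
      \int[@leb R]_y ((ln 2)%:E * (\1_(I j) y)%:E))%E.
    by apply: eq_integral => y _; rewrite /f EFinM.
  rewrite (ge0_integralZl _ measurableT m1 p1 p2).
  rewrite integral_indic//; last exact: measurable_itv.
  rewrite setIT /= /leb lebesgue_measure_itv /= lte_fin.
  rewrite ltrD2l gtrN ?rj// -EFinB -EFinM; congr EFin.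
  by rewrite /r natrX exprS; field; rewrite expf_neq0.
apply: (@le_trans _ _ (\int[@leb R]_y elog A x y)%E).
  by apply: ge0_subset_integral => //; [exact: measurable_elog|move=> y _; exact: elog_ge0].
apply: (@le_trans _ _ (\int[@leb R]_y \sum_(0 <= j <oo) f j y)%E).
  apply: ae_ge0_le_integral => //.
  - by move=> y _; exact: elog_ge0.
  - exact: measurable_elog.
  - by move=> y _; apply: nneseries_ge0.
  - by apply: ge0_emeasurable_sum.
  apply: (@negligibleS _ _ _ _ [set x]).
    move=> y /= nle; apply: contrapT => yx; apply: nle => _.
    have xy : x - y != 0 by rewrite subr_eq0; apply/eqP => E; exact: yx.
    rewrite /elog -subr_eq0 (negbTE xy).
    have [N [tN jN]] := tlog_dyadic xy.
    apply: (@le_trans _ _ (\sum_(0 <= j < N) f j y)%E); last first.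
      by apply: nneseries_lim_ge.
    rewrite (_ : (\sum_(0 <= j < N) f j y)%E = (N%:R * ln 2)%:E) ?lee_fin//.
    rewrite big_mkord (eq_bigr (fun=> (ln 2)%:E)) => [|j _].
      by rewrite sumEFin sumr_const card_ord mulr_natl.
    rewrite /f indicE mem_set ?mulr1// /I /= in_itv /=.
    by have := jN j (ltn_ord j); rewrite ler_distlC.
  apply: (negligibleP _ (measurable_set1 _)).2; exact: lebesgue_measure_set1.
rewrite integral_nneseries//.
rewrite (eq_eseriesr (fun j _ => If j)).
by apply: epsilon_trick0; rewrite !mulr_ge0// (le_trans _ A1).
Qed.

End LebesgueLog.

(** * Frostman bounds and the support of the equilibrium measure *)

Section EquilibriumSupport.
Context {R : realType} (A : R) (A1 : 1 <= A) (E : set R) (rho : probability R R) (g : R).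
Hypothesis cE : compact E.
Hypothesis EA : E `<=` `[- A, A].
Hypothesis perfE : essentially_perfect E.
Hypothesis rhoE : rho (~` E) = 0%E.
Hypothesis gE : energy A rho rho = g%:E.
Hypothesis gmin : forall nu : probability R R, nu (~` E) = 0%E -> (g%:E <= energy A nu nu)%E.
Implicit Types (x y : R).

Let A0 : 0 < A. Proof. exact: lt_le_trans A1. Qed.

Let mE : measurable E. Proof. exact: compact_measurable. Qed.

Let atomless x : rho [set x] = 0%E.
Proof. by apply: (@energy_atomless _ A); rewrite gE ltry. Qed.

Let S := measure_support rho.

Lemma support_subset : S `<=` E.
Proof.
move=> x Sx; apply: contrapT => nEx.
have : open (~` E) by rewrite openC; apply: compact_closed.
rewrite openE => /(_ x nEx) /nbhs_ballP[e /= e0 He].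
have := Sx e e0; rewrite ltNge -rhoE => /negP; apply.
apply: le_measure; rewrite ?inE//; first exact: measurableC.
move=> y /=; rewrite in_itv /= => /andP[y1 y2]; apply: He.
by rewrite /ball /= ltr_distlC y1.
Qed.

Lemma continuous_tlog d : d != 0 -> {for d, continuous (tlog A)}.
Proof.
move=> d0; have nd0 : 0 < `|d| by rewrite normr_gt0.
rewrite /continuous_at /tlog.
apply: (@continuous_max _ _ (fun=> 0) (fun d => ln (4 * A) - ln `|d|)); first exact: cvg_cst.
apply: cvgB; first exact: cvg_cst.
apply: (@cvg_comp _ _ _ (fun z : R => `|z|) (@ln R) _ (nbhs `|d|)).
  exact: norm_continuous.
exact: continuous_ln.
Qed.

(** Every interval around a point of the support has positive mass, hence meets the set where the
    potential is at most [g], whose complement is null; lower semicontinuity transports the bound to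
    the point itself. *)
Lemma pot_le_support x : S x -> (pot rho (tlog A) x <= g%:E)%E.
Proof.
move=> Sx.
have ex n : exists y, (y \in `](x - n.+1%:R^-1), (x + n.+1%:R^-1)[) /\ (pot rho (tlog A) y <= g%:E)%E.
  apply: contrapT => /forallNP H.
  have n0 : 0 < n.+1%:R^-1 :> R by rewrite invr_gt0.
  have := Sx _ n0; rewrite ltNge => /negP; apply.
  rewrite -(pot_gt_null mE rhoE gE gmin).
  apply: le_measure; rewrite ?inE//.
    by rewrite -[X in measurable X]setTI; apply: emeasurable_fun_o_infty => //; exact: measurable_epot.
  move=> y /= yI; rewrite ltNge; apply/negP => Uy; apply: (H y); split => //.
  by rewrite -(epotE gE).
have [u hu] := choice ex.
apply: (@pot_le_lim _ _ atomless _ u).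
- exact: measurable_tlog.
- exact: tlog_ge0.
- exact: continuous_tlog.
- apply/cvgrPdist_lt => e e0.
  have : n.+1%:R^-1 @[n --> \oo] --> (0 : R) by exact: cvg_harmonic.
  move/cvgrPdist_lt => /(_ e e0); apply: filterS => n.
  rewrite sub0r normrN ger0_norm ?invr_ge0//; apply: lt_trans.
  by have [+ _] := hu n; rewrite in_itv /= -ltr_distlC.
- by move=> n; have [] := hu n.
Qed.

Let SA : S `<=` `[- A, A].
Proof. by move=> x /support_subset /EA. Qed.

Let rhoS : rho (~` S) = 0%E.
Proof. exact: measure_supportC0. Qed.

Let cS : closed S. Proof. exact: closed_measure_support. Qed.

Let gap x s := @pot_gap _ A A1 S rho g cS SA rhoS atomless pot_le_support x s.

Lemma pot_le_dist x s : `|x| <= A -> 0 < s -> (forall y, E y -> s <= `|x - y|) ->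
  (pot rho (tlog A) x <= (g - s ^+ 2 / (16 * A ^+ 2))%:E)%E.
Proof. by move=> xA s0 Hs; apply: gap => // y /support_subset; exact: Hs. Qed.

Lemma pot_le x : `|x| <= A -> (pot rho (tlog A) x <= g%:E)%E.
Proof.
move=> xA; have [Sx|nSx] := pselect (S x); first exact: pot_le_support.
have : open (~` S) by rewrite openC; exact: closed_measure_support.
rewrite openE => /(_ x nSx) /nbhs_ballP[e /= e0 He].
apply: le_trans (gap xA e0 _) _.
  by move=> y Sy; rewrite leNgt; apply/negP => xy; exact: (He y xy).
by rewrite lee_fin lerBlDr lerDl divr_ge0 ?sqr_ge0// mulr_ge0 ?sqr_ge0.
Qed.

(** Essential perfectness enters here. Were [rho] to vanish on an interval around [x], the gap bound
    would hold the potential at or below [g - c] on [D], inside the half interval; but [D] has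
    positive Lebesgue measure and carries a probability of finite energy by [lebesgue_log_bound], so
    [average_epot] forbids this. *)
Lemma subset_support : E `<=` S.
Proof.
move=> x Ex e e0; rewrite lt0e measure_ge0 andbT; apply/eqP => rho0.
have e2 : 0 < e / 2 by rewrite divr_gt0.
pose D := E `&` [set` `](x - e / 2), (x + e / 2)[].
have mD : measurable D by exact: measurableI.
have D0 : (0 < leb D)%E by exact: perfE.
have Doo : (leb D < +oo)%E.
  apply: (@le_lt_trans _ _ (leb [set` `](x - e / 2), (x + e / 2)[])).
    by apply: le_measure; rewrite ?inE//; exact: subIsetr.
  by rewrite /leb lebesgue_measure_itv /=; case: ifP => _; exact: ltry.
have [C [C0 HC]] := lebesgue_log_bound A1.
have mC : measurable_fun setT (cst C%:E : R -> \bar R) by exact: measurable_cst.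
have C1 (z : R) : (0 <= cst C%:E z :> \bar R)%E by rewrite lee_fin.
have iC : (\int[@leb R]_(y in D) cst C%:E y < +oo)%E.
  by rewrite integral_cst// lte_mul_pinfty// lee_fin.
have := average_epot rhoE gE gmin mD (@subIsetl _ _ _) D0 Doo mC
  C1 (fun z => HC D z mD) iC.
pose c := (e / 2) ^+ 2 / (16 * A ^+ 2).
have c0 : 0 < c by rewrite divr_gt0 ?exprn_gt0// mulr_gt0 ?exprn_gt0.
have Uc : (\int[@leb R]_(x in D) epot A rho x <= (g - c)%:E * leb D)%E.
  apply: integral_le_cst => //; first exact: measurable_epot.
    exact: epot_ge0.
  move=> z [Ez]; rewrite /= in_itv /= => /andP[z1 z2].
  rewrite (epotE gE); apply: gap => //.
    by have := EA Ez; rewrite /= in_itv /= ler_norml.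
  move=> y Sy; rewrite leNgt; apply/negP => zy.
  have ye : 0 < e / 2 - `|z - y| by rewrite subr_gt0.
  have := Sy _ ye; rewrite -rho0 ltNge => /negP; apply.
  apply: le_measure; rewrite ?inE//.
  move=> t /=; rewrite !in_itv /= => /andP[t1 t2].
  have := ler_norm (z - y); have := ler_norm (y - z); rewrite (distrC y z) => h1 h2.
  by apply/andP; split; lra.
move=> /le_trans /(_ Uc).
rewrite lee_pmul2r ?ge0_fin_numE// lee_fin lerDl oppr_ge0 leNgt c0.
by [].
Qed.

End EquilibriumSupport.

(** * Zeros of orthogonal polynomials *)

Section RealRootedness.
Context {R : realType} (A : R).
Implicit Types (p q : {poly R}) (s : seq R).

(** As long as the polynomial changes sign on [[- A, A]], the intermediate value theorem supplies a
    root there and its linear factor is split off; the degree bounds the process. *)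
Lemma factor_sign_changes p : exists s q,
  [/\ p = \prod_(z <- s) ('X - z%:P) * q, (forall z, z \in s -> `|z| <= A) &
   (forall x, `|x| <= A -> 0 <= q.[x]) \/ (forall x, `|x| <= A -> q.[x] <= 0)].
Proof.
have [n] := ubnP (size p); elim: n p => // n IH p sp.
have [pos|npos] := pselect (forall x, `|x| <= A -> 0 <= p.[x]).
  by exists [::], p; split => //; [rewrite big_nil mul1r|left].
have [neg|nneg] := pselect (forall x, `|x| <= A -> p.[x] <= 0).
  by exists [::], p; split => //; [rewrite big_nil mul1r|right].
have [x [xA px]] : exists x, `|x| <= A /\ p.[x] < 0.
  apply: contrapT => /forallNP H; apply: npos => x xA; rewrite leNgt; apply/negP => px.
  by apply: (H x).
have [y [yA py]] : exists y, `|y| <= A /\ 0 < p.[y].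
  apply: contrapT => /forallNP H; apply: nneg => y yA; rewrite leNgt; apply/negP => py.
  by apply: (H y).
have p0 : p != 0 by apply/eqP => p0; move: px; rewrite p0 horner0 ltxx.
have [z zA rz] : exists2 z, `|z| <= A & root p z.
  move: xA yA; rewrite !ler_norml => /andP[x1 x2] /andP[y1 y2].
  have pxy : p.[x] * p.[y] <= 0 by rewrite mulr_le0_ge0 ?ltW.
  have [xy|yx] := leP x y.
    have [z] := polyrcf.poly_ivt xy pxy.
    rewrite in_itv /= => /andP[z1 z2] rz; exists z => //.
    by rewrite ler_norml (le_trans x1 z1) (le_trans z2 y2).
  have [|z] := polyrcf.poly_ivt (ltW yx) (_ : p.[y] * p.[x] <= 0); first by rewrite mulrC.
  rewrite in_itv /= => /andP[z1 z2] rz; exists z => //.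
  by rewrite ler_norml (le_trans y1 z1) (le_trans z2 x2).
have /factor_theorem[p1 pE] := rz.
have p10 : p1 != 0 by apply: contra_neq p0 => E; rewrite pE E mul0r.
have [|s [q [p1E sA qs]]] := IH p1.
  move: sp; rewrite pE size_Mmonic ?monicXsubC// size_XsubC addn2 /=.
  by rewrite ltnS.
exists (z :: s), q; split => //; first by rewrite big_cons pE p1E mulrC mulrA.
by move=> w; rewrite inE => /predU1P[->|/sA].
Qed.

(** [rootsR] lists the distinct roots and [mup] weights them; grouping equal entries of [s] turns
    the mean over the list into that weighted sum. *)
Lemma zero_counting_prod s (f : R -> R) :
  zero_counting_integral (\prod_(z <- s) ('X - z%:P)) f = (size s)%:R^-1 * \sum_(z <- s) f z.
Proof.
set p := \prod_(z <- s) _.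
have p0 : p != 0 by rewrite /p monic_neq0// monic_prod_XsubC.
have mupE z : mup z p = count_mem z s.
  rewrite /p; elim: s {p p0} => [|y s IH].
    by rewrite big_nil mupNroot// root1.
  rewrite big_cons mupM ?polyXsubC_eq0 ?monic_neq0 ?monic_prod_XsubC//.
  by rewrite IH /= -['X - y%:P]expr1 mup_XsubCX; case: eqVneq.
rewrite /zero_counting_integral size_prod_XsubC /=; congr (_ * _).
transitivity (\sum_(z <- undup s) (count_mem z s)%:R * f z).
  under eq_bigr do rewrite mupE.
  apply: perm_big; apply: uniq_perm; rewrite ?undup_uniq//; first exact: uniq_roots.
  move=> z; rewrite mem_undup.
  have := roots_on_rootsR p0 z; rewrite in_itv /= => <-.
  by rewrite /p root_prod_XsubC.
rewrite -[RHS](big_undup_iterop_count _ _ xpredT).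
by apply: eq_bigr => z _; rewrite mulr_natl; 
  case: (count_mem z s) => //= n; rewrite Monoid.iteropE /= ?iterSr.
Qed.

Context (mu : {measure set R -> \bar R}).
Hypothesis muT : (mu setT < +oo)%E.
Hypothesis muA : mu (~` `[- A, A]) = 0%E.
Hypothesis muinf : forall r : {poly R}, r != 0 -> mu [set x | r.[x] != 0] != 0%E.

Lemma integrable_horner p : mu.-integrable setT (EFin \o horner p).
Proof.
have mI : measurable (`[- A, A] : set R) by exact: measurable_itv.
have [L L0 HL] := horner_lipschitz p (normr_ge0 A).
apply: (@integrable_bounded_on _ mu muT _ _ (`|p.[0]| + L * `|A|) mI muA).
  by apply: continuous_measurable_fun; exact: continuous_horner.
move=> x /=; rewrite in_itv /= -ler_norml => xA.
have xA' : `|x| <= `|A| by rewrite (le_trans xA)// ler_norm.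
have := HL x 0 xA'; rewrite normr0 subr0 => /(_ (normr_ge0 _)) H.
rewrite -[p.[x]](subrK p.[0]) addrC (le_trans (ler_normD _ _))// lerD2l.
by rewrite (le_trans H)// ler_wpM2l.
Qed.

Lemma monic_OP_orth n p q : monic_OP mu n p -> (size q <= n)%N ->
  (\int[mu]_x (p.[x] * q.[x])%:E = 0)%E.
Proof.
move=> [_ _ orth] sq.
under eq_integral => x _.
  rewrite (horner_coef q x) mulr_sumr -sumEFin.
  over.
rewrite integral_sum//=; last first.
  move=> i; rewrite (_ : (fun x => _) = EFin \o horner (p * (q`_i *: 'X^i))).
    exact: integrable_horner.
  by apply/funext => x /=; rewrite !hornerE.
rewrite big1 // => i _.
rewrite (_ : (fun x => _) = (fun x => (q`_i)%:E * (p.[x] * x ^+ i)%:E)%E).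
  rewrite integralZl ?orth ?mule0//; first exact: leq_trans sq.
  rewrite (_ : (fun x => _) = EFin \o horner (p * 'X^i)); first exact: integrable_horner.
  by apply/funext => x /=; rewrite !hornerE.
by apply/funext => x; rewrite -EFinM; congr EFin; ring.
Qed.

(** With [p = r q] from [factor_sign_changes], a nonconstant [q] would leave [r] of degree below
    [n], hence orthogonal to [p]; but [p r = r^2 q] has constant sign on [[- A, A]], so it would
    vanish [mu]-almost everywhere, against [muinf]. *)
Lemma monic_OP_roots n p : monic_OP mu n p ->
  exists s, [/\ p = \prod_(z <- s) ('X - z%:P), size s = n & forall z, z \in s -> `|z| <= A].
Proof.
move=> OP; have [pm sp _] := OP.
have [s [q [pE sA qs]]] := factor_sign_changes p.
set r := \prod_(z <- s) _ in pE.
have rm : r \is monic by exact: monic_prod_XsubC.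
have p0 : p != 0 by exact: monic_neq0.
have q0 : q != 0 by apply: contra_neq p0 => E; rewrite pE E mulr0.
have szE : (size s + size q = n.+1)%N.
  by rewrite -sp pE size_monicM// size_prod_XsubC addSn.
have [sq1|sq1] := leqP (size q) 1.
  have sqE : size q = 1%N by apply/eqP; rewrite eqn_leq sq1 size_poly_gt0.
  have q1 : q = 1.
    have qm : q \is monic by rewrite -(monicMl _ rm) -pE.
    have /size_poly1P[c c0 qc] : size q == 1%N by rewrite sqE.
    by move: qm; rewrite qc monicE lead_coefC => /eqP ->.
  exists s; split => //; first by rewrite pE q1 mulr1.
  by move: szE; rewrite sqE addn1 => -[].
exfalso.
have sr : (size r <= n)%N by rewrite size_prod_XsubC; lia.
have orth := monic_OP_orth OP sr.
pose h := p * r.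
have h0 : h != 0 by rewrite mulf_neq0// monic_neq0.
apply/negP: (muinf h0); rewrite negbK.
have hE x : h.[x] = r.[x] ^+ 2 * q.[x] by rewrite /h pE !hornerM; ring.
have mh : measurable_fun setT (EFin \o horner h).
  by apply/measurable_EFinP; apply: continuous_measurable_fun; exact: continuous_horner.
have habs : (\int[mu]_x `|(EFin \o horner h) x| = 0)%E.
  have mI : measurable (`[- A, A] : set R) by exact: measurable_itv.
  have orth' : (\int[mu]_x (h.[x])%:E = 0)%E.
    by rewrite -orth; apply: eq_integral => x _; rewrite /h hornerM.
  have m2 : measurable_fun setT (fun x => `|(EFin \o horner h) x|%E) by exact: measurableT_comp.
  have onI (P : R -> Prop) : (forall x, `|x| <= A -> P x) -> {ae mu, forall x, P x}.
    move=> H; apply: (@negligibleS _ _ _ _ (~` `[- A, A])).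
      by move=> x /= nP; rewrite in_itv /= -ler_norml => xA; exact/nP/H.
    by apply: (negligibleP _ _).2 muA; exact: measurableC.
  have r2 x : 0 <= r.[x] ^+ 2 by exact: sqr_ge0.
  case: qs => qs.
    rewrite -[RHS]orth'; apply: ae_eq_integral => //; apply: onI => x xA _ /=.
    by rewrite ger0_norm// hE mulr_ge0// qs.
  have intN : (\int[mu]_x ((-1)%:E * (h.[x])%:E) = 0)%E.
    by rewrite integralZl ?orth' ?mule0//; exact: integrable_horner.
  rewrite -[RHS]intN; apply: ae_eq_integral => //.
    by apply: measurable_funeM.
  by apply: onI => x xA _ /=; rewrite -EFinM mulN1r ler0_norm// hE mulr_ge0_le0// qs.
have /(ae_eq_integral_abs _ measurableT mh) [N [mN N0 sub]] := habs.
apply/eqP; apply: measure_negligible.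
  rewrite (_ : [set x | _] = setT `&` [set x | (EFin \o horner h) x != (cst 0%E) x]).
    exact: emeasurable_neq.
  by rewrite setTI.
apply: (@negligibleS _ _ _ _ N); last by exists N; split.
by move=> x hx; apply: sub => /= /(_ I) [] /eqP; apply/negP.
Qed.

End RealRootedness.

(** * Comparison of the zero distribution with the equilibrium measure *)

Section GoodSet.
Context {R : realType} (A : R) (A1 : 1 <= A) (rho : probability R R) (g : R).
Implicit Types (x y z d e : R).
Hypothesis atomless : forall x, rho [set x] = 0%E.
Hypothesis rhoA : rho (~` `[- A, A]) = 0%E.
Hypothesis potA : forall x, `|x| <= A -> (pot rho (tlog A) x <= g%:E)%E.

(* For [d != 0] this is [- ln |d| + ln (d^2 + e^2) / 2], the loss incurred by the
   regularized kernel; the value at [0] is [0], as [e ^+ 2 / 0 = 0]. *)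
Definition smoothing e d : R := ln (1 + e ^+ 2 / d ^+ 2) / 2.

Lemma smoothing_arg_gt0 e d : 0 < 1 + e ^+ 2 / d ^+ 2.
Proof. by rewrite ltr_wpDr// divr_ge0 ?sqr_ge0. Qed.

Lemma smoothing_ge0 e d : 0 <= smoothing e d.
Proof. by rewrite divr_ge0// ln_ge0// lerDl divr_ge0 ?sqr_ge0. Qed.

Lemma smoothing_norm e d : smoothing e `|d| = smoothing e d.
Proof. by rewrite /smoothing real_normK ?num_real. Qed.

Lemma measurable_smoothing e : measurable_fun setT (smoothing e).
Proof.
rewrite (_ : smoothing e = fun d => if d == cst 0 d then cst 0 d
    else (ln (d ^+ 2 + e ^+ 2) - ln (d ^+ 2)) / 2); last first.
  apply/funext => d; rewrite /smoothing /=; case: eqVneq => [->|d0].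
    by rewrite expr0n invr0 mulr0 addr0 ln1 mul0r.
  have p0 : 0 < d ^+ 2 by rewrite exprn_even_gt0.
  rewrite -ln_div ?posrE// ?ltr_wpDr ?sqr_ge0//.
  by rewrite mulrDl divff ?gt_eqF.
apply: measurable_fun_ifT => //; first exact: measurable_fun_eqr.
apply: measurable_funM => //; apply: measurable_funB; apply: measurableT_comp => //.
by apply: measurable_funD => //; exact: measurable_funX.
Qed.

Lemma continuous_smoothing e d : d != 0 -> {for d, continuous (smoothing e)}.
Proof.
move=> d0; apply: cvgM; last exact: cvg_cst.
apply: (@cvg_comp _ _ _ (fun d => 1 + e ^+ 2 / d ^+ 2) (@ln R) _
  (nbhs (1 + e ^+ 2 / d ^+ 2))); last by apply: continuous_ln; exact: smoothing_arg_gt0.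
apply: cvgD; first exact: cvg_cst.
apply: cvgM; first exact: cvg_cst.
apply: cvgV; first by rewrite expf_neq0.
by have := @exprn_continuous R 2 d.
Qed.

Lemma smoothing_cvg (u : nat -> R) d : u n @[n --> \oo] --> 0 ->
  smoothing (u n) d @[n --> \oo] --> 0.
Proof.
move=> u0; rewrite [X in _ --> X](_ : 0 = ln (1 + 0 ^+ 2 / d ^+ 2) / 2 :> R); last first.
  by rewrite expr0n mul0r addr0 ln1 mul0r.
apply: cvgM; last exact: cvg_cst.
apply: (@cvg_comp _ _ _ (fun n => 1 + u n ^+ 2 / d ^+ 2) (@ln R) _
  (nbhs (1 + 0 ^+ 2 / d ^+ 2))); last by apply: continuous_ln; exact: smoothing_arg_gt0.
apply: cvgD; first exact: cvg_cst.
apply: cvgM; last exact: cvg_cst.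
by rewrite expr2; under eq_fun do rewrite expr2; apply: cvgM.
Qed.

(** A majorant independent of [e], for dominated convergence. The [1] covers [e <= |d|], where
    [e^2 / d^2] is at most [1]; for smaller [|d|] the logarithm dominates because [e <= A]. *)
Lemma smoothing_le e d : 0 <= e <= A -> smoothing e d <= tlog A d + 1.
Proof.
move=> /andP[e0 eA]; have A0 : 0 < A by exact: lt_le_trans A1.
have [->|d0] := eqVneq d 0.
  by rewrite /smoothing expr0n invr0 mulr0 addr0 ln1 mul0r addr_ge0 ?tlog_ge0.
have nd0 : 0 < `|d| by rewrite normr_gt0.
rewrite -smoothing_norm /smoothing /tlog.
have [ed|de] := leP e `|d|.
  apply: (@le_trans _ _ 1); last by rewrite lerDr le_max lexx.
  rewrite ler_pdivrMr// mul1r.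
  have h1 : e ^+ 2 / `|d| ^+ 2 <= 1.
    by rewrite ler_pdivrMr ?exprn_gt0// mul1r lerXn2r ?nnegrE.
  have h2 : -1 < e ^+ 2 / `|d| ^+ 2 by apply: lt_le_trans (divr_ge0 (sqr_ge0 _) (sqr_ge0 _)).
  apply: le_trans (le_ln1Dx h2) _; lra.
apply: (@le_trans _ _ (ln (4 * A) - ln `|d|)); last first.
  by rewrite (@le_trans _ _ (Num.max 0 (ln (4 * A) - ln `|d|)))// ?lerDl// le_max lexx orbT.
rewrite ler_pdivrMr// -ln_div ?posrE ?mulr_gt0// mulr_natr -lnXn ?divr_gt0 ?mulr_gt0//.
rewrite ler_ln ?posrE ?smoothing_arg_gt0 ?exprn_gt0 ?divr_gt0 ?mulr_gt0//.
rewrite expr_div_n ler_pdivlMr ?exprn_gt0// mulrDl mul1r divfK ?gt_eqF ?exprn_gt0//.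
have : `|d| ^+ 2 <= A ^+ 2 by rewrite lerXn2r ?nnegrE ?(ltW A0)// (le_trans (ltW de)).
have : e ^+ 2 <= A ^+ 2 by rewrite lerXn2r ?nnegrE ?(ltW A0).
have : 0 <= A ^+ 2 by exact: sqr_ge0.
by rewrite exprMn; lra.
Qed.

(** Lets an arbitrary [z] be replaced by its nearest point in a closed set: distances to that set at
    most double, at the price of doubling [e]. *)
Lemma smoothing_mono e d d' : d != 0 -> d' != 0 -> `|d'| <= 2 * `|d| ->
  smoothing e d <= smoothing (2 * e) d'.
Proof.
move=> d0 d'0 dd; rewrite /smoothing ler_pM2r ?invr_gt0//.
rewrite ler_ln ?posrE ?smoothing_arg_gt0// lerD2l.
have p0 : 0 < d ^+ 2 by rewrite exprn_even_gt0.
have p1 : 0 < d' ^+ 2 by rewrite exprn_even_gt0.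
rewrite ler_pdivrMr// mulrAC ler_pdivlMr//.
have : d' ^+ 2 <= 4 * d ^+ 2.
  rewrite -[leLHS]real_normK ?num_real// -[X in 4 * X]real_normK ?num_real//.
  rewrite (_ : 4 * `|d| ^+ 2 = (2 * `|d|) ^+ 2); last by ring.
  by rewrite lerXn2r ?nnegrE ?mulr_ge0.
rewrite exprMn => h; have : 0 <= e ^+ 2 by exact: sqr_ge0.
by nra.
Qed.

Lemma measurable_pot (k : R -> R) : measurable_fun setT k -> (forall d, 0 <= k d) ->
  measurable_fun setT (pot rho k).
Proof.
move=> mk k0; pose f (z : R * R) := (k (z.1 - z.2))%:E.
have mf : measurable_fun setT f.
  apply/measurable_EFinP; apply: measurableT_comp => //; exact: measurable_funB.
have := @measurable_fun_fubini_tonelli_F _ _ _ _ _ rho f mf.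
by apply => z; rewrite lee_fin.
Qed.

Lemma smoothing_pot_cvg (u : nat -> R) x : `|x| <= A -> (forall n, 0 <= u n <= A) ->
  u n @[n --> \oo] --> 0 -> pot rho (smoothing (u n)) x @[n --> \oo] --> 0%E.
Proof.
move=> xA uA u0.
have m1 (k : R -> R) : measurable_fun setT k -> measurable_fun setT (fun y => (k (x - y))%:E).
  by move=> mk; apply/measurable_EFinP; exact: measurable_sub.
rewrite [X in _ --> X](_ : 0%E = (\int[rho]_y (0%:E))%E); last by rewrite integral0.
apply: (@dominated_cvg _ _ _ rho _ measurableT _ _ (fun y => (tlog A (x - y) + 1)%:E)).
- by move=> n; apply: m1; exact: measurable_smoothing.
- move=> y _; apply: cvg_EFin; first exact: nearW.
  exact: smoothing_cvg.
- by [].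
- apply/integrableP; split.
    by apply: (m1 (fun d => tlog A d + 1)); apply: measurable_funD => //; exact: measurable_tlog.
  rewrite (eq_integral (fun y => (tlog A (x - y))%:E + cst 1%E y)%E); last first.
    by move=> y _ /=; rewrite ger0_norm// addr_ge0 ?tlog_ge0.
  rewrite ge0_integralD//.
  + rewrite integral_cst//= probability_setT mule1.
    by apply: le_lt_trans (leeD (potA xA) (lexx _)) _; rewrite -EFinD ltry.
  + by move=> y _; rewrite lee_fin tlog_ge0.
  + by apply: m1; exact: measurable_tlog.
- move=> n y _; rewrite /= lee_fin ger0_norm ?smoothing_ge0//.
  exact: smoothing_le.
Qed.

(* [rho] lives up to [delta] on a set [G] where the logarithmic singularity
   contributes little; closedness of [G] carries the bound from [G] to all [z]. *)
Lemma good_set (delta : R) : 0 < delta -> exists e (G : set R),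
  [/\ 0 < e <= A, measurable G, (rho (~` G) <= delta%:E)%E, G `<=` `[- A, A] &
   forall z, (\int[rho]_(y in G) (smoothing e (z - y))%:E <= delta%:E)%E].
Proof.
move=> d0.
pose u (n : nat) : R := n.+1%:R^-1.
have u0 n : 0 < u n by rewrite invr_gt0.
have uA n : 0 <= u n <= A.
  by rewrite ltW//= (le_trans _ A1)// invf_le1// ler1n.
have ucv : u n @[n --> \oo] --> 0 by exact: cvg_harmonic.
pose I : set R := [set` `[- A, A]].
have mI : measurable I by exact: measurable_itv.
pose f n x := fine (pot rho (smoothing (u n)) x).
have mf n : measurable_fun I (f n).
  apply: measurable_funTS; apply: measurableT_comp; first exact: fine_measurable.
  by apply: measurable_pot; [exact: measurable_smoothing|exact: smoothing_ge0].
have fcv x : I x -> f n x @[n --> \oo] --> (cst 0 x).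
  rewrite /I /= in_itv /= -ler_norml => xA.
  by have := smoothing_pot_cvg xA uA ucv => /fine_cvg.
have Ioo : (rho I < +oo)%E by apply: le_lt_trans (probability_le1 rho mI) (ltry _).
(* Egorov's theorem makes the convergence uniform off a set [B] of small mass, so that one index [n]
   serves all remaining points. *)
have [B [mB Bd unif]] := pointwise_almost_uniform mf mI Ioo fcv d0.
have [n Hn] : exists n, forall x, (I `\` B) x -> (pot rho (smoothing (u n)) x <= delta%:E)%E.
  have : \forall n \near \oo, forall x, (I `\` B) x -> `|f n x| < delta.
    apply: (unif (fun h => forall x, (I `\` B) x -> `|h x| < delta)).
    apply/uniform_nbhs; exists [set xy | ball xy.1 (PosNum d0)%:num xy.2].
    split; first exact: entourage_ball.
    move=> h /= Hh x Bx; have := Hh x Bx.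
    by rewrite /ball /= sub0r normrN.
  move=> [n _ Hn]; exists n => x Bx; have := Hn n (leqnn _) x Bx.
  have xA : `|x| <= A by have [] := Bx; rewrite /I /= in_itv /= -ler_norml.
  have p0 : (0 <= pot rho (smoothing (u n)) x)%E.
    by apply: integral_ge0 => y _; rewrite lee_fin smoothing_ge0.
  have pfin : pot rho (smoothing (u n)) x \is a fin_num.
    rewrite ge0_fin_numE//.
    apply: (@le_lt_trans _ _ (\int[rho]_y ((tlog A (x - y))%:E + cst 1%E y))%E).
      apply: ge0_le_integral => //.
      - by move=> y _; rewrite lee_fin smoothing_ge0.
      - by apply/measurable_EFinP; apply: measurable_sub; exact: measurable_smoothing.
      - apply: emeasurable_funD => //.
        by apply/measurable_EFinP; exact: measurable_tlog_sub.
      - by move=> y _; rewrite lee_fin smoothing_le.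
    rewrite ge0_integralD//.
    + rewrite integral_cst//= probability_setT mule1.
      by apply: le_lt_trans (leeD (potA xA) (lexx _)) _; rewrite -EFinD ltry.
    + by move=> y _; rewrite lee_fin tlog_ge0.
    + by apply/measurable_EFinP; exact: measurable_tlog_sub.
  by rewrite /f ger0_norm ?fine_ge0// => /ltW h; rewrite -(fineK pfin) lee_fin.
pose G := closure (I `\` B).
have cG : closed G by exact: closed_closure.
have GI : G `<=` I.
  have cI : closed I by exact: interval_closed.
  move=> x /(closureS (@subDsetl _ I B)).
  by rewrite -((closure_id I).1 cI).
have HG x : G x -> (pot rho (smoothing (u n)) x <= delta%:E)%E.
  move=> Gx.
  have ex k : exists y, (I `\` B) y /\ `|x - y| < k.+1%:R^-1.
    have k0 : 0 < k.+1%:R^-1 :> R by rewrite invr_gt0.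
    by have [y [By xy]] := Gx _ (nbhsx_ballx x _ k0); exists y.
  have [v hv] := choice ex.
  apply: (@pot_le_lim _ _ atomless _ v).
  - exact: measurable_smoothing.
  - exact: smoothing_ge0.
  - exact: continuous_smoothing.
  - apply/cvgrPdist_lt => e e0.
    have : k.+1%:R^-1 @[k --> \oo] --> (0 : R) by exact: cvg_harmonic.
    move/cvgrPdist_lt => /(_ e e0); apply: filterS => k.
    rewrite sub0r normrN ger0_norm ?invr_ge0//; apply: lt_trans.
    by have [] := hv k.
  - by move=> k; apply: Hn; have [] := hv k.
(* Half of [u n], because passing from [z] to its nearest point of [G] doubles the parameter in
   [smoothing_mono]. *)
exists (u n / 2), G; split => //.
- rewrite divr_gt0//= ler_pdivrMr//; have /andP[_] := uA n.
  by have := A1; lra.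
- exact: closed_measurable.
- apply: (@le_trans _ _ (rho (~` I `|` B))).
    apply: le_measure; rewrite ?inE.
    + by apply: measurableC; exact: closed_measurable.
    + by apply: measurableU => //; exact: measurableC.
    + move=> x nG; have [Ix|] := pselect (I x); last by left.
      right; apply: contrapT => nB; apply: nG; exact: subset_closure.
  apply: le_trans (measureU2 _ _ _) _ => //; first exact: measurableC.
  by rewrite [X in (X + _ <= _)%E]rhoA add0e ltW.
move=> z; have [->|/set0P G0] := eqVneq G set0.
  by rewrite integral_set0 lee_fin ltW.
have cptG : compact G by apply: (subclosed_compact cG (@segment_compact _ (- A) A)).
have cont : {within G, continuous (fun y => `|y - z|)}.
  apply: continuous_subspaceT => y; 
  apply: (@cvg_comp _ _ _ (fun y => y - z) (fun t : R => `|t|) _ (nbhs (y - z))).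
    by apply: cvgB; [exact: cvg_id|exact: cvg_cst].
  exact: norm_continuous.
have [y0 + Hy0] := compact_EVT_min G0 cptG cont; rewrite inE => Gy0.
(* every [y] in [G] is at most twice as far from the nearest point [y0] as from [z] *)
apply: le_trans (HG _ Gy0).
rewrite /pot.
apply: (@le_trans _ _ (\int[rho]_(y in G) (smoothing (u n) (y0 - y))%:E)%E); last first.
  apply: ge0_subset_integral => //; first exact: closed_measurable.
    by apply/measurable_EFinP; apply: measurable_sub; exact: measurable_smoothing.
  by move=> y _; rewrite lee_fin smoothing_ge0.
apply: ae_ge0_le_integral => //.
- exact: closed_measurable.
- by move=> y _; rewrite lee_fin smoothing_ge0.
- apply: measurable_funTS; apply/measurable_EFinP; apply: measurable_sub; exact: measurable_smoothing.
- by move=> y _; rewrite lee_fin smoothing_ge0.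
- apply: measurable_funTS; apply/measurable_EFinP; apply: measurable_sub; exact: measurable_smoothing.
apply: (@negligibleS _ _ _ _ ([set z] `|` [set y0])).
  move=> y /= nle; apply: contrapT => yN; apply: nle => Gy.
  rewrite lee_fin; have -> : smoothing (u n) (y0 - y) = smoothing (2 * (u n / 2)) (y0 - y).
    by congr smoothing; rewrite mulrC divfK.
  apply: smoothing_mono.
  - by rewrite subr_eq0; apply/eqP => E; apply: yN; left.
  - by rewrite subr_eq0; apply/eqP => E; apply: yN; right.
  - have := Hy0 y (mem_set Gy); rewrite (distrC y z) => h.
    have -> : y0 - y = (y0 - z) + (z - y) by ring.
    by apply: le_trans (ler_normD _ _) _; lra.
by apply: negligibleU; apply: (negligibleP _ (measurable_set1 _)).2; exact: atomless.
Qed.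

End GoodSet.

(** * Averages over the zeros and their mutual energy with the equilibrium measure *)

Section AverageBounds.
Context {R : realType}.
Implicit Types (s : seq R) (h : R -> R).

(** Integral against the zero counting measure, the zeros being listed with multiplicity; the empty
    list gives [0]. *)
Definition avg s h : R := (size s)%:R^-1 * \sum_(z <- s) h z.

Lemma avgD s h1 h2 : avg s (fun z => h1 z + h2 z) = avg s h1 + avg s h2.
Proof. by rewrite /avg big_split mulrDr. Qed.

Lemma avgZ s c h : avg s (fun z => c * h z) = c * avg s h.
Proof. by rewrite /avg -mulr_sumr mulrCA. Qed.

Lemma eq_avg s h1 h2 : (forall z, z \in s -> h1 z = h2 z) -> avg s h1 = avg s h2.
Proof. by move=> H; rewrite /avg; congr (_ * _); exact: eq_big_seq. Qed.

Lemma avg_cst s c : (0 < size s)%N -> avg s (fun=> c) = c.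
Proof.
move=> s0; rewrite /avg big_const_seq count_predT iter_addr_0 -[c *+ _]mulr_natl mulrA.
by rewrite mulVf ?mul1r// pnatr_eq0 -lt0n.
Qed.

Lemma le_avg s h1 h2 : (forall z, z \in s -> h1 z <= h2 z) -> avg s h1 <= avg s h2.
Proof.
move=> H; rewrite /avg ler_wpM2l ?invr_ge0// big_seq [leRHS]big_seq.
exact: ler_sum.
Qed.

Lemma avg_ge0 s h : (forall z, z \in s -> 0 <= h z) -> 0 <= avg s h.
Proof.
by move=> H; rewrite /avg mulr_ge0 ?invr_ge0// big_seq sumr_ge0.
Qed.

Lemma avg_sum s n (H : nat -> R -> R) :
  avg s (fun z => \sum_(k < n) H k z) = \sum_(k < n) avg s (H k).
Proof. by rewrite /avg exchange_big /= mulr_sumr. Qed.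

Lemma norm_avg s h : `|avg s h| <= avg s (fun z => `|h z|).
Proof.
rewrite /avg normrM ger0_norm ?invr_ge0// ler_wpM2l ?invr_ge0//.
exact: ler_norm_sum.
Qed.

Context (rho : probability R R).
Local Notation Int f := (rho.-integrable setT (EFin \o f)).
Implicit Types (G : set R) (f : R -> R).

Lemma integrable_on G f : measurable G -> Int f -> rho.-integrable G (EFin \o f).
Proof. by move=> mG; exact: integrableS. Qed.

Lemma ae_le_Rintegral G f1 f2 : measurable G -> Int f1 -> Int f2 ->
  {ae rho, forall x, G x -> f1 x <= f2 x} ->
  \int[rho]_(x in G) f1 x <= \int[rho]_(x in G) f2 x.
Proof.
move=> mG i1 i2 H; rewrite -subr_ge0 -RintegralB//; try exact: integrable_on.
have m1 : measurable_fun setT f1 by apply/measurable_EFinP; exact: measurable_int i1.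
have m2 : measurable_fun setT f2 by apply/measurable_EFinP; exact: measurable_int i2.
have -> : \int[rho]_(x in G) (f2 x - f1 x) = \int[rho]_(x in G) `|f2 x - f1 x|.
  congr fine; apply: ae_eq_integral => //.
  - by apply/measurable_EFinP; apply: measurable_funB; apply: measurable_funTS.
  - apply/measurable_EFinP; apply: measurableT_comp => //.
    by apply: measurable_funB; apply: measurable_funTS.
  by apply: filterS H => x Hx Gx; rewrite ger0_norm// subr_ge0 Hx.
exact: Rintegral_ge0.
Qed.

Lemma subset_Rintegral G G' f : measurable G -> measurable G' -> G' `<=` G -> Int f ->
  (forall x, 0 <= f x) -> \int[rho]_(x in G') f x <= \int[rho]_(x in G) f x.
Proof.
move=> mG mG' GG iF f0; apply: fine_le.
- exact: integrable_fin_num (integrable_on mG' iF).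
- exact: integrable_fin_num (integrable_on mG iF).
apply: ge0_subset_integral => //.
- exact: measurable_funTS (measurable_int _ iF).
- by move=> x _; rewrite lee_fin.
Qed.

Lemma integrable_avg s (k : R -> R -> R) : (forall z, z \in s -> Int (fun x => k x z)) ->
  Int (fun x => avg s (k x)).
Proof.
move=> H.
rewrite (_ : EFin \o _ = (fun x => (size s)%:R^-1%:E * (\sum_(z <- s) (k x z)%:E))%E); last first.
  by apply/funext => x; rewrite /= /avg EFinM sumEFin.
apply: integrableZl => //.
elim: s H => [|z s IH] H.
  under eq_fun do rewrite big_nil; exact: integrable0.
under eq_fun do rewrite big_cons; apply: integrableD => //.
  by apply: (H z); rewrite mem_head.
by apply: IH => w ws; apply: H; rewrite in_cons ws orbT.
Qed.

Lemma Rintegral_avg G s (k : R -> R -> R) : measurable G ->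
  (forall z, z \in s -> Int (fun x => k x z)) ->
  \int[rho]_(x in G) avg s (k x) = avg s (fun z => \int[rho]_(x in G) k x z).
Proof.
move=> mG H.
have isum t : {subset t <= s} -> Int (fun x => \sum_(z <- t) k x z).
  elim: t => [|z t IH] ts.
    rewrite (_ : EFin \o _ = cst 0%E); first exact: integrable0.
    by apply/funext => x /=; rewrite big_nil.
  rewrite (_ : EFin \o _ = ((EFin \o (fun x => k x z)) \+ (EFin \o (fun x => (\sum_(w <- t) k x w)%R)))%E).
    apply: integrableD => //; first by apply: H; rewrite ts// mem_head.
    by apply: IH => w wt; rewrite ts// in_cons wt orbT.
  by apply/funext => x /=; rewrite big_cons EFinD.
rewrite /avg RintegralZl//; last exact: integrable_on (isum s _).
congr (_ * _).
have : {subset s <= s} by [].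
elim: {-2}s => [|z t IH] ts.
  by rewrite big_nil; under eq_Rintegral do rewrite big_nil; rewrite Rintegral_cst// mul0r.
under eq_Rintegral do rewrite big_cons.
have tt : {subset t <= s} by move=> w wt; rewrite ts// in_cons wt orbT.
rewrite RintegralD//; last 2 first.
- by apply: integrable_on => //; apply: H; rewrite ts// mem_head.
- exact: integrable_on (isum t tt).
by rewrite big_cons IH.
Qed.

Context (A g : R) (A1 : 1 <= A).
Hypothesis atomless : forall x, rho [set x] = 0%E.
Hypothesis rhoA : rho (~` `[- A, A]) = 0%E.
Hypothesis potA : forall x, `|x| <= A -> (pot rho (tlog A) x <= g%:E)%E.

Lemma rho_A_ae (P : R -> Prop) : (forall x, `|x| <= A -> P x) -> {ae rho, forall x, P x}.
Proof.
move=> H; apply: (@negligibleS _ _ _ _ (~` `[- A, A])).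
  by move=> x /= nP; rewrite in_itv /= -ler_norml => xA; exact/nP/H.
by apply: (negligibleP _ _).2 rhoA; apply: measurableC; exact: measurable_itv.
Qed.

Lemma rho_seq_ae s (P : R -> Prop) : (forall x, x \notin s -> P x) -> {ae rho, forall x, P x}.
Proof.
move=> H; apply: (@negligibleS _ _ _ _ [set` s]).
  by move=> x /= nP; apply: contrapT => /negP xs; exact/nP/H.
elim: s {H} => [|z s IH].
  by rewrite (_ : [set` [::]] = set0); [exact: negligible_set0|apply/seteqP; split].
rewrite (_ : [set` z :: s] = [set z] `|` [set` s]); last first.
  apply/seteqP; split => x /=; rewrite inE; first by move=> /predU1P[]; [left|right].
  by case=> [->|->]; rewrite ?eqxx ?orbT.
apply: negligibleU => //.
exact: (negligibleP _ (measurable_set1 _)).2 (atomless _).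
Qed.

Lemma integrable_tlog z : `|z| <= A -> Int (fun x => tlog A (x - z)).
Proof.
move=> zA; rewrite (_ : (fun x => _) = (fun x => tlog A (z - x))); last first.
  by apply/funext => x; rewrite tlogC.
apply/integrableP; split; first by apply/measurable_EFinP; exact: measurable_tlog_sub.
under eq_integral do rewrite /= ger0_norm ?tlog_ge0//.
by apply: le_lt_trans (potA zA) _; exact: ltry.
Qed.

Definition rpot z : R := \int[rho]_x tlog A (x - z).

Lemma rpotE z : `|z| <= A -> pot rho (tlog A) z = (rpot z)%:E.
Proof.
move=> zA; rewrite /rpot /Rintegral fineK.
  by apply: eq_integral => x _; rewrite tlogC.
exact: integrable_fin_num (integrable_tlog zA).
Qed.

Lemma rpot_le z : `|z| <= A -> rpot z <= g.
Proof. by move=> zA; rewrite -lee_fin -rpotE// potA. Qed.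

Lemma rpot_ge0 z : 0 <= rpot z.
Proof. by apply: Rintegral_ge0 => x _; exact: tlog_ge0. Qed.

Lemma g_ge0 : 0 <= g.
Proof.
have zA : `|0 : R| <= A by rewrite normr0 (le_trans _ A1).
exact: le_trans (rpot_ge0 0) (rpot_le zA).
Qed.

Definition upot s x : R := avg s (fun z => tlog A (x - z)).

Lemma upot_ge0 s x : 0 <= upot s x.
Proof. by apply: avg_ge0 => z _; exact: tlog_ge0. Qed.

Context (s : seq R) (delta : R) (B : set R).
Hypothesis s0 : (0 < size s)%N.
Hypothesis sA : forall z, z \in s -> `|z| <= A.
Hypothesis d0 : 0 < delta.
Hypothesis mB : measurable B.
Hypothesis Bd : (rho B <= delta%:E)%E.
Hypothesis HB : forall x, `|x| <= A -> ~ B x -> x \notin s -> g - delta <= upot s x.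

Lemma integrable_upot : Int (upot s).
Proof. by apply: (@integrable_avg s (fun x z => tlog A (x - z))) => z /sA; exact: integrable_tlog. Qed.

Let r G := fine (rho G).

Let rfin G : measurable G -> rho G = (r G)%:E.
Proof. by move=> mG; rewrite /r fineK// fin_num_measure. Qed.

(** Off [B] the potential is at least [g - delta], and [(g - delta) (rho G - delta)] falls short of
    [g rho G] by at most [delta (1 + g)]. If [g < delta] the claimed bound is negative and
    positivity of [upot] suffices. *)
Lemma upot_lower G : measurable G ->
  g * fine (rho G) - delta * (1 + g) <= \int[rho]_(x in G) upot s x.
Proof.
move=> mG; rewrite -/(r G).
have r1 : r G <= 1 by rewrite -lee_fin -rfin// probability_le1.
have r0 : 0 <= r G by rewrite fine_ge0.
have gg := g_ge0.
have [gd|dg] := ltP g delta.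
  apply: (@le_trans _ _ 0); last by apply: Rintegral_ge0 => x _; exact: upot_ge0.
  by nra.
have mGB : measurable (G `\` B) by exact: measurableD.
have iU := integrable_upot.
have rGB : r G <= r (G `\` B) + delta.
  rewrite -lee_fin -rfin// EFinD -rfin//.
  apply: (@le_trans _ _ (rho (G `\` B) + rho B)%E); last exact: leeD.
  apply: (@le_trans _ _ (rho ((G `\` B) `|` B))).
    apply: le_measure; rewrite ?inE//; first exact: measurableU.
    by move=> x Gx; have [Bx|nBx] := pselect (B x); [right|left].
  exact: measureU2.
apply: (@le_trans _ _ (\int[rho]_(x in G `\` B) upot s x)); last first.
  by apply: subset_Rintegral => //; exact: upot_ge0.
apply: (@le_trans _ _ ((g - delta) * r (G `\` B))).
  have := mulr_ge0 (_ : 0 <= g - delta) (_ : 0 <= r (G `\` B) + delta - r G).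
  rewrite !subr_ge0 => /(_ dg rGB) h.
  have : delta * r G <= delta by rewrite ler_piMr// ltW.
  by have := sqr_ge0 delta; lra.
rewrite -Rintegral_cst//; apply: ae_le_Rintegral => //.
  exact: finite_measure_integrable_cst.
apply: (filterS2 _ _ (rho_A_ae (fun x xA => xA)) (@rho_seq_ae s _ (fun x xs => xs))).
by move=> x xA xs [Gx nBx]; exact: HB.
Qed.

Lemma Rintegral_upot : \int[rho]_x upot s x = avg s rpot.
Proof. by apply: Rintegral_avg => // z /sA; exact: integrable_tlog. Qed.

Lemma avg_rpot_ge : g - delta * (1 + g) <= avg s rpot.
Proof. by rewrite -Rintegral_upot; have := upot_lower measurableT; rewrite probability_setT /= mulr1. Qed.

(** The total integral is the mean of [rpot] over the zeros, hence at most [g]; subtracting the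
    lower bound on the complement of [G] bounds the part on [G]. A pointwise argument is impossible,
    as [upot] is unbounded near the zeros. *)
Lemma upot_upper G : measurable G ->
  \int[rho]_(x in G) upot s x <= g * fine (rho G) + delta * (1 + g).
Proof.
move=> mG; have iU := integrable_upot.
have mGc : measurable (~` G) by exact: measurableC.
have := upot_lower mGc.
have -> : fine (rho (~` G)) = 1 - fine (rho G).
  by rewrite probability_setC// [in LHS]rfin.
have : \int[rho]_(x in G) upot s x + \int[rho]_(x in ~` G) upot s x <= g.
  rewrite -Rintegral_setU//.
  - rewrite setUv Rintegral_upot -[leRHS](avg_cst g s0).
    by apply: le_avg => z /sA; exact: rpot_le.
  - by rewrite setUv.
  - by apply/disj_set2P; rewrite setICr.
by lra.
Qed.

End AverageBounds.

(** * Chebyshev moments through the energy of the regularized kernel *)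

Section MomentClose.
Context {R : realType} (rho : probability R R) (A g : R) (A1 : 1 <= A) (E : set R).
Implicit Types (s : seq R) (x y z : R).
Local Notation Int f := (rho.-integrable setT (EFin \o f)).
Hypothesis atomless : forall x, rho [set x] = 0%E.
Hypothesis rhoA : rho (~` `[- A, A]) = 0%E.
Hypothesis potA : forall x, `|x| <= A -> (pot rho (tlog A) x <= g%:E)%E.
Hypothesis cE : compact E.
Hypothesis EA : forall x, E x -> `|x| <= A.
Hypothesis gap : forall x r, `|x| <= A -> 0 < r -> (forall y, E y -> r <= `|x - y|) ->
  (pot rho (tlog A) x <= (g - r ^+ 2 / (16 * A ^+ 2))%:E)%E.
Hypothesis charge : forall x, E x -> forall e : R, 0 < e -> (0 < rho [set` `](x - e)%R, (x + e)%R[])%E.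

Let A0 : 0 < A. Proof. exact: lt_le_trans A1. Qed.

Definition tcheb (k : nat) x : R := (cheb k).[x / A].

Lemma norm_div x : `|x| <= A -> `|x / A| <= 1.
Proof. by move=> xA; rewrite normrM normfV (gtr0_norm A0) ler_pdivrMr// mul1r. Qed.

Lemma tcheb_le1 k x : `|x| <= A -> `|tcheb k x| <= 1.
Proof.
move=> /norm_div; rewrite ler_norml => x1; rewrite /tcheb -[x / A]acosK ?in_itv//.
by rewrite cheb_cos cos_max.
Qed.

Lemma integrable_tcheb k : Int (tcheb k).
Proof.
apply: (@integrable_bounded_on _ rho _ _ _ 1 _ rhoA).
- by apply: le_lt_trans (probability_le1 rho measurableT) (ltry 1).
- exact: measurable_itv.
- apply: measurableT_comp; last exact: measurable_funM.
  by apply: continuous_measurable_fun; exact: continuous_horner.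
- by move=> x /=; rewrite in_itv /= -ler_norml; exact: tcheb_le1.
Qed.

(** Compactness of [E]: the interval of radius [r] about a point near [x] contains the one of radius
    [r / 2] about [x], so the pointwise lower bound is locally uniform. *)
Lemma charge_uniform r : 0 < r -> exists2 c, 0 < c &
  forall x, E x -> (c%:E <= rho [set` `](x - r)%R, (x + r)%R[])%E.
Proof.
move=> r0; have r2 : 0 < r / 2 by rewrite divr_gt0.
have /compact_near_coveringP := cE.
move=> /(_ R (0 : R)^'+ (fun c x => (c%:E <= rho [set` `](x - r)%R, (x + r)%R[])%E)).
case.
  move=> x Ex; have := charge Ex r2; set m := rho _ => m0.
  have mfin : m \is a fin_num by exact: fin_num_measure.
  have fm0 : 0 < fine m by rewrite fine_gt0// m0 -ge0_fin_numE// ltW.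
  exists (ball x (r / 2), [set c | c < fine m]).
    by split; [exact: nbhsx_ballx|exact: nbhs_right_lt].
  move=> [x' c] /= [xx' cm]; apply: (@le_trans _ _ m).
    by rewrite -(fineK mfin) lee_fin ltW.
  apply: le_measure; rewrite ?inE//; try exact: measurable_itv.
  move=> y /=; rewrite !in_itv /= => /andP[y1 y2].
  by move: xx'; rewrite /ball /= ltr_distl => /andP[h1 h2]; apply/andP; split; lra.
move=> d /= d0 Hd; exists (d / 2); first by rewrite divr_gt0.
apply: Hd => /=; last by rewrite divr_gt0.
by rewrite sub0r normrN gtr0_norm ?divr_gt0//; move: d0 => /=; lra.
Qed.

Lemma integrable_smoothing e z : `|z| <= A -> 0 <= e <= A -> Int (fun x => smoothing e (x - z)).
Proof.
move=> zA eA; have it := integrable_tlog potA zA.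
apply: (@le_integrable _ _ _ rho _ measurableT _ (EFin \o (fun x => tlog A (x - z) + 1))).
- apply/measurable_EFinP; apply: measurableT_comp; first exact: measurable_smoothing.
  exact: measurable_funB.
- move=> x _ /=; rewrite lee_fin ger0_norm ?smoothing_ge0// ger0_norm ?smoothing_le//.
  by rewrite addr_ge0 ?tlog_ge0.
- rewrite (_ : EFin \o _ = ((EFin \o (fun x => tlog A (x - z))) \+ (EFin \o cst 1%R))%E).
    by apply: integrableD => //; exact: finite_measure_integrable_cst.
  by apply/funext => x.
Qed.

Lemma Rintegral_cstT (c : R) : \int[rho]_x c = c.
Proof.
apply: etrans (Rintegral_cst rho measurableT c) _.
exact: etrans (congr1 (fun t => c * fine t) (probability_setT rho)) (mulr1 c).
Qed.

Section Kernel.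
Variables (a : nat -> R) (N : nat).
Hypothesis a0 : forall k, 0 <= a k.

Definition ker x y : R := ln 8 + \sum_(k < N) a k * tcheb k x * tcheb k y.

Lemma ker_avg s x : (0 < size s)%N ->
  avg s (ker x) = ln 8 + \sum_(k < N) a k * tcheb k x * avg s (tcheb k).
Proof.
move=> s0; rewrite /ker avgD avg_cst// (avg_sum s N (fun k z => a k * tcheb k x * tcheb k z)).
by congr (_ + _); apply: eq_bigr => k _; rewrite avgZ.
Qed.

Lemma integrable_comb (b : nat -> R) n :
  Int (fun x => ln 8 + \sum_(k < n) b k * tcheb k x).
Proof.
rewrite (_ : EFin \o _ = (EFin \o cst (ln 8) \+ (fun x => \sum_(k < n) (b k)%:E * (tcheb k x)%:E))%E).
  apply: integrableD => //; first exact: finite_measure_integrable_cst.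
  apply: integrable_sum => // k _; apply: integrableZl => //; exact: integrable_tcheb.
by apply/funext => x /=; rewrite EFinD -sumEFin.
Qed.

Lemma Rintegral_comb (b : nat -> R) n :
  \int[rho]_x (ln 8 + \sum_(k < n) b k * tcheb k x) =
  ln 8 + \sum_(k < n) b k * \int[rho]_x tcheb k x.
Proof.
elim: n => [|n IH].
  under eq_Rintegral do rewrite big_ord0 addr0.
  by rewrite Rintegral_cstT big_ord0 addr0.
under eq_Rintegral do rewrite big_ord_recr /= addrA.
rewrite RintegralD//; first last.
- by rewrite (_ : EFin \o _ = (fun x => (b n)%:E * (tcheb n x)%:E)%E)//;
    apply: integrableZl => //; exact: integrable_tcheb.
- exact: integrable_comb.
by rewrite IH RintegralZl//; [rewrite big_ord_recr /= addrA|exact: integrable_tcheb].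
Qed.

Let m s k := avg s (tcheb k).
Let mu k := \int[rho]_x tcheb k x.

(* The energy of the signed measure [nu_s - rho] for the kernel, expanded. *)
Lemma ker_energy s : (0 < size s)%N ->
  \sum_(k < N) a k * (m s k - mu k) ^+ 2 =
  avg s (fun z => avg s (ker z)) - 2 * \int[rho]_x avg s (ker x)
  + \int[rho]_x \int[rho]_y ker x y.
Proof.
move=> s0.
have kE x : avg s (ker x) = ln 8 + \sum_(k < N) (a k * m s k) * tcheb k x.
  by rewrite ker_avg//; congr (_ + _); apply: eq_bigr => k _; rewrite mulrAC.
have rE x : \int[rho]_y ker x y = ln 8 + \sum_(k < N) (a k * mu k) * tcheb k x.
  rewrite /ker (Rintegral_comb (fun k => a k * tcheb k x)).
  by congr (_ + _); apply: eq_bigr => k _; rewrite mulrAC.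
rewrite (eq_avg (h2 := fun z => ln 8 + \sum_(k < N) (a k * m s k) * tcheb k z)) => [|z _]; last exact: kE.
rewrite avgD avg_cst// (avg_sum s N (fun k z => a k * m s k * tcheb k z)).
under [X in _ = _ + X - _ + _]eq_bigr do rewrite avgZ.
under [X in _ = _ - 2 * X + _]eq_Rintegral do rewrite kE.
under [X in _ = _ + X]eq_Rintegral do rewrite rE.
rewrite (Rintegral_comb (fun k => a k * m s k)) (Rintegral_comb (fun k => a k * mu k)).
have -> : ln 8 + \sum_(k < N) a k * m s k * avg s (tcheb k)
   - 2 * (ln 8 + \sum_(k < N) a k * m s k * \int[rho]_x tcheb k x)
   + (ln 8 + \sum_(k < N) a k * mu k * \int[rho]_x tcheb k x) =
   \sum_(k < N) a k * m s k * m s k + - 2 * (\sum_(k < N) a k * m s k * mu k)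
   + \sum_(k < N) a k * mu k * mu k by rewrite -/(m s) -/mu; ring.
rewrite mulr_sumr -!big_split /=; apply: eq_bigr => k _; ring.
Qed.

Lemma ker_le_sum x y : `|x| <= A -> `|y| <= A -> ker x y <= ln 8 + \sum_(k < N) a k.
Proof.
move=> xA yA; rewrite lerD2l; apply: ler_sum => k _.
rewrite -mulrA ler_piMr//; apply: le_trans (ler_norm _) _; rewrite normrM.
by rewrite mulr_ile1 ?tcheb_le1.
Qed.

Lemma ker_lipschitz : exists2 L, 0 <= L & forall x x' y, `|x| <= A -> `|x'| <= A ->
  `|y| <= A -> ker x y <= ker x' y + L * `|x - x'|.
Proof.
have ex k : exists L, 0 <= L /\ forall u v : R, `|u| <= 1 -> `|v| <= 1 ->
    `|(cheb k).[u] - (cheb k).[v]| <= L * `|u - v|.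
  by have [L L0 HL] := horner_lipschitz (cheb k : {poly R}) ler01; exists L.
have [L HL] := choice ex.
exists (\sum_(k < N) a k * L k / A).
  by apply: sumr_ge0 => k _; rewrite divr_ge0 ?mulr_ge0 ?(ltW A0)//; have [] := HL k.
move=> x x' y xA x'A yA.
rewrite /ker -addrA lerD2l mulr_suml -big_split /=; apply: ler_sum => k _.
rewrite -lerBlDl -mulrBl -mulrBr -!mulrA ler_wpM2l//.
apply: le_trans (ler_norm _) _; rewrite normrM.
have [L0 HLk] := HL k.
have h := HLk _ _ (norm_div xA) (norm_div x'A).
rewrite -mulrBl normrM normfV (gtr0_norm A0) in h.
rewrite -[leRHS]mulr1 ler_pM ?tcheb_le1// (le_trans h)//.
by rewrite [A^-1 * _]mulrC.
Qed.

End Kernel.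

(** [cheb_kernel] rescaled from [[-1, 1]] to [[- A, A]], where [ln 4] turns into the shift
    [ln (4 * A)] of [tlog]. The bound [- d <= K] includes the diagonal, since
    [(x - y)^2 + eps^2 <= 5 A^2 <= (4 A)^2]. *)
Lemma kernel_sandwich (k0 : nat) (eps d : R) : (0 < k0)%N -> 0 < eps <= A -> 0 < d ->
  exists (a : nat -> R) (N : nat), let K := ker a N in
  [/\ forall k, 0 <= a k, k0%:R^-1 <= a k0, (k0 < N)%N &
    forall x y, `|x| <= A -> `|y| <= A ->
    [/\ - d <= K x y, x != y -> K x y <= tlog A (x - y) + d &
      x != y -> tlog A (x - y) - smoothing eps (x - y) - d <= K x y]].
Proof.
move=> k00 /andP[eps0 epsA] d0.
have [a [N [a0 ak0 k0N Hker]]] := cheb_kernel (divr_gt0 eps0 A0) d0 k00.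
exists a, N => K; split => //.
have Kub x y : `|x| <= A -> `|y| <= A -> x != y -> K x y <= tlog A (x - y) + d.
  move=> xA yA xy; have [+ _] := Hker _ _ (norm_div xA) (norm_div yA).
  have nxy : 0 < `|x - y| by rewrite normr_gt0 subr_eq0.
  have -> : 4 / `|x / A - y / A| = 4 * A / `|x - y|.
    rewrite -mulrBl normrM normfV (gtr0_norm A0); field.
    by rewrite !gt_eqF.
  have nA : A^-1 != 0 by rewrite invr_eq0 gt_eqF.
  rewrite (inj_eq (mulIf nA)) => /(_ xy).
  rewrite tlogE ?subr_eq0//; last by apply: le_trans (ler_normB _ _) _; lra.
  by rewrite ln_div ?posrE ?mulr_gt0.
have Klb0 x y : `|x| <= A -> `|y| <= A ->
    ln (4 * A) - ln ((x - y) ^+ 2 + eps ^+ 2) / 2 - d <= K x y.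
  move=> xA yA; have [_] := Hker _ _ (norm_div xA) (norm_div yA).
  have p0 : 0 < (x - y) ^+ 2 + eps ^+ 2 by rewrite ltr_wpDl ?sqr_ge0 ?exprn_gt0.
  have -> : (x / A - y / A) ^+ 2 + (eps / A) ^+ 2 = ((x - y) ^+ 2 + eps ^+ 2) / A ^+ 2.
    by field; rewrite gt_eqF.
  rewrite ln_div ?posrE ?exprn_gt0// lnXn// -[ln A *+ 2]mulr_natl.
  rewrite [ln (4 * A)]lnM ?posrE//; apply: le_trans.
  by rewrite le_eqVlt; apply/orP; left; apply/eqP; field.
have Klb x y : `|x| <= A -> `|y| <= A -> x != y ->
    tlog A (x - y) - smoothing eps (x - y) - d <= K x y.
  move=> xA yA xy; apply: le_trans (Klb0 x y xA yA); rewrite lerD2r.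
  have p1 : 0 < (x - y) ^+ 2 by rewrite exprn_even_gt0//= subr_eq0.
  have p0 : 0 < (x - y) ^+ 2 + eps ^+ 2 by rewrite ltr_wpDl ?sqr_ge0 ?exprn_gt0.
  rewrite tlogE ?subr_eq0//; last by apply: le_trans (ler_normB _ _) _; lra.
  rewrite /smoothing (_ : 1 + _ / _ = ((x - y) ^+ 2 + eps ^+ 2) / (x - y) ^+ 2); last first.
    by rewrite mulrDl divff// gt_eqF.
  rewrite ln_div ?posrE// -[X in _ - (_ - ln X) / 2](@real_normK _ (x - y)) ?num_real//.
  by rewrite lnXn ?normr_gt0 ?subr_eq0// -[_ *+ 2]mulr_natl; lra.
have Kneg x y : `|x| <= A -> `|y| <= A -> - d <= K x y.
  move=> xA yA; apply: le_trans (Klb0 x y xA yA); rewrite -[leLHS]add0r lerD2r subr_ge0.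
  have p0 : 0 < (x - y) ^+ 2 + eps ^+ 2 by rewrite ltr_wpDl ?sqr_ge0 ?exprn_gt0.
  rewrite ler_pdivrMr// mulr_natr -lnXn ?mulr_gt0// ler_ln ?posrE ?exprn_gt0 ?mulr_gt0//.
  have h1 : (x - y) ^+ 2 <= (2 * A) ^+ 2.
    rewrite -[leLHS]real_normK ?num_real// lerXn2r ?nnegrE ?mulr_ge0 ?(ltW A0)//.
    by apply: le_trans (ler_normB _ _) _; lra.
  have h2 : eps ^+ 2 <= A ^+ 2 by rewrite lerXn2r ?nnegrE ?(ltW A0) ?(ltW eps0).
  have : 0 <= A ^+ 2 by exact: sqr_ge0.
  by move: h1; rewrite !exprMn; lra.
by move=> x y xA yA; split; [exact: Kneg|exact: Kub|exact: Klb].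
Qed.

(** Energy of the zeros. The double average contains diagonal pairs, about which the bound by [tlog]
    says nothing; so [x] is moved by at most [r] and averaged over [rho], for which the zeros are
    null. Of the five [d], three arise on [E], one from moving to [E], and one from the zeros far
    from [E]. *)
Lemma avg_ker_le (a : nat -> R) (N : nat) (d : R) : let K := ker a N in
  (forall k, 0 <= a k) -> 0 < d ->
  (forall x y, `|x| <= A -> `|y| <= A -> x != y -> K x y <= tlog A (x - y) + d) ->
  exists2 delta, 0 < delta & forall s (B : set R), (0 < size s)%N ->
    (forall z, z \in s -> `|z| <= A) -> measurable B -> (rho B <= delta%:E)%E ->
    (forall x, `|x| <= A -> ~ B x -> x \notin s -> g - delta <= upot A s x) ->
    avg s (fun z => avg s (K z)) <= g + 5 * d.
Proof.
move=> K a0 d0 Kub; have gg := g_ge0 A1 potA.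
pose M := ln 8 + \sum_(k < N) a k.
have M0 : 0 <= M.
  by apply: addr_ge0; [apply: ln_ge0; rewrite ler1n|apply: sumr_ge0 => k _; exact: a0].
have KM x y : `|x| <= A -> `|y| <= A -> K x y <= M by exact: ker_le_sum.
have [L L0 HL] := ker_lipschitz N a0.
pose r := d / (L + 1).
have L1 : 0 < L + 1 by rewrite ltr_wpDl.
have r0 : 0 < r by rewrite divr_gt0.
have Lr : L * r <= d by rewrite /r mulrCA ler_piMr ?(ltW d0)// ler_pdivrMr// mul1r lerDl.
have [c c0 Hc] := charge_uniform r0.
pose kappa := r ^+ 2 / (16 * A ^+ 2).
have kap0 : 0 < kappa by rewrite divr_gt0 ?exprn_gt0// mulr_gt0// exprn_gt0.
(* [delta (1 + g)] will be [d q]: [q <= c] keeps that error below [d] after division by the mass of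
   an interval, and [q <= kappa / (M + 1)] keeps it below [d] after multiplication by
   [M / kappa]. *)
pose q := Num.min (Num.min c 1) (kappa / (M + 1)).
have M1 : 0 < M + 1 by rewrite ltr_wpDl.
have q0 : 0 < q by rewrite !lt_min c0 ltr01 divr_gt0.
have qc : q <= c by rewrite !ge_min lexx.
have q1 : q <= 1 by rewrite !ge_min lexx !orbT.
have qk : q <= kappa / (M + 1) by rewrite !ge_min lexx !orbT.
have Mk : 0 <= M / kappa by rewrite divr_ge0 ?(ltW kap0).
have qM : M / kappa * q <= 1.
  apply: (@le_trans _ _ (M / kappa * (kappa / (M + 1)))).
    by rewrite ler_wpM2l.
  rewrite mulrA divfK ?gt_eqF// ler_pdivrMr// mul1r lerDl//.
have g1 : 0 < 1 + g by rewrite ltr_wpDr.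
exists (d * q / (1 + g)); first by rewrite divr_gt0// mulr_gt0.
set dl := d * q / (1 + g) => s B s0 sA mB Bd HB.
have dl0 : 0 < dl by rewrite divr_gt0// mulr_gt0.
have dlE : dl * (1 + g) = d * q by rewrite /dl divfK// gt_eqF.
have up := upot_upper A1 atomless rhoA potA s0 sA dl0 mB Bd HB.
have rp := avg_rpot_ge A1 atomless rhoA potA sA dl0 mB Bd HB.
have iU := integrable_upot potA sA.
rewrite dlE in rp.
have dq : d * q <= d by rewrite ler_piMr ?(ltW d0).
pose Ks x := avg s (K x).
have iKs : Int Ks.
  rewrite (_ : Ks = fun x => ln 8 + \sum_(k < N) (a k * avg s (tcheb k)) * tcheb k x).
    exact: (integrable_comb (fun k => a k * avg s (tcheb k)) N).
  apply/funext => x; rewrite /Ks /K ker_avg//; congr (_ + _).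
  by apply: eq_bigr => k _; rewrite mulrAC.
have KsU x : `|x| <= A -> x \notin s -> Ks x <= upot A s x + d.
  move=> xA xs; rewrite /Ks /upot -[X in _ + X](avg_cst d s0) -avgD; apply: le_avg => z zs.
  by apply: Kub => //; [exact: sA|apply: contraNneq xs => ->].
have KsL x x' : `|x| <= A -> `|x'| <= A -> `|x - x'| <= r -> Ks x <= Ks x' + d.
  move=> xA x'A xr; rewrite /Ks -[X in _ + X](avg_cst d s0) -avgD; apply: le_avg => z zs.
  apply: le_trans (HL _ _ _ xA x'A (sA _ zs)) _; rewrite lerD2l.
  by apply: le_trans Lr; rewrite ler_wpM2l.
(* One [d] each for the Lipschitz shift, for the kernel against [tlog], and for the error of
   [upot_upper] divided by the mass of [D], which is at least [c]. *)
have KsE x : E x -> Ks x <= g + 3 * d.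
  move=> Ex; pose D : set R := [set` `](x - r)%R, (x + r)%R[].
  have mD : measurable D by exact: measurable_itv.
  have rD : c <= fine (rho D).
    by rewrite -lee_fin fineK ?fin_num_measure// Hc.
  have rD0 : 0 < fine (rho D) by exact: lt_le_trans rD.
  have : \int[rho]_(y in D) Ks x <= \int[rho]_(y in D) (upot A s y + 2 * d).
    apply: ae_le_Rintegral => //.
    - exact: finite_measure_integrable_cst.
    - rewrite (_ : EFin \o _ = ((EFin \o upot A s) \+ (EFin \o cst (2 * d)%R))%E).
        by apply: integrableD => //; exact: finite_measure_integrable_cst.
      by apply/funext.
    apply: (filterS2 _ _ (rho_A_ae rhoA (fun x xA => xA))
      (rho_seq_ae atomless (fun x (xs : x \notin s) => xs))).
    move=> y yA ys; rewrite /D /= in_itv /= => /andP[y1 y2].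
    apply: le_trans (KsL x y (EA Ex) yA _) _; first by rewrite ler_distl; apply/andP; split; lra.
    by have := KsU _ yA ys; lra.
  rewrite RintegralD//; last 2 first.
  - exact: integrable_on iU.
  - exact: finite_measure_integrable_cst.
  rewrite !Rintegral_cst// => h.
  have := up D mD; rewrite dlE => h2.
  rewrite -(ler_pM2r rD0); apply: le_trans h _.
  have : d * q <= d * fine (rho D) by rewrite ler_pM2l// (le_trans qc).
  by lra.
(* Near [E] the first two terms suffice; away from [E] the potential of [rho] drops
   by [kappa], so that the last term alone exceeds the bound [M] of the kernel. *)
have KsA z : `|z| <= A -> Ks z <= g + 4 * d + M / kappa * (g - rpot rho A z).
  move=> zA.
  have gz : 0 <= g - rpot rho A z by rewrite subr_ge0 rpot_le.
  have [near|far] := pselect (exists x, E x /\ `|z - x| < r).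
    have [x [Ex zx]] := near.
    have h1 := KsL z x zA (EA Ex) (ltW zx); have h2 := KsE _ Ex.
    by have := mulr_ge0 Mk gz; lra.
  have : Ks z <= M.
    by rewrite /Ks -[leRHS](avg_cst M s0); apply: le_avg => w ws; apply: KM => //; exact: sA.
  have : (pot rho (tlog A) z <= (g - kappa)%:E)%E.
    apply: gap => // x Ex; rewrite leNgt; apply/negP => zx; apply: far; by exists x.
  rewrite (rpotE potA)// lee_fin => h1 h2.
  have : M / kappa * kappa <= M / kappa * (g - rpot rho A z).
    by rewrite ler_wpM2l//; lra.
  by rewrite divfK ?gt_eqF//; lra.
  apply: (@le_trans _ _ (avg s (fun z => g + 4 * d + M / kappa * (g + -1 * rpot rho A z)))).
    by apply: le_avg => z /sA zA; rewrite mulN1r; exact: KsA.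
  rewrite avgD avg_cst// avgZ avgD avg_cst// avgZ mulN1r.
  have : M / kappa * (g - avg s (rpot rho A)) <= M / kappa * (d * q).
    by rewrite ler_wpM2l//; lra.
  have : M / kappa * (d * q) <= d by rewrite mulrCA ler_piMr// ltW.
  by lra.
Qed.

(** The diagonal is null for [rho], so the bound by [tlog] integrates to the potential of [rho] plus
    [d], at most [g + d] throughout [[- A, A]]. *)
Lemma Rintegral_ker_le (a : nat -> R) (N : nat) (d : R) : let K := ker a N in
  (forall x y, `|x| <= A -> `|y| <= A -> x != y -> K x y <= tlog A (x - y) + d) ->
  \int[rho]_x \int[rho]_y K x y <= g + d.
Proof.
move=> K Kub.
  have iK x : Int (K x) by exact: (integrable_comb (fun k => a k * tcheb k x) N).
  have KE x : \int[rho]_y K x y = ln 8 + \sum_(k < N) (a k * \int[rho]_y tcheb k y) * tcheb k x.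
    rewrite (Rintegral_comb (fun k => a k * tcheb k x)); congr (_ + _).
    by apply: eq_bigr => k _; rewrite mulrAC.
  rewrite -[leRHS]Rintegral_cstT; apply: ae_le_Rintegral => //.
  - rewrite (_ : (fun x => _) = fun x => ln 8 + \sum_(k < N) (a k * \int[rho]_y tcheb k y) * tcheb k x).
      exact: (integrable_comb (fun k => a k * \int[rho]_y tcheb k y) N).
    by apply/funext => x; exact: KE.
  - exact: finite_measure_integrable_cst.
  apply: filterS (rho_A_ae rhoA (fun x xA => xA)) => x xA _.
  have xx : rpot rho A x + d <= g + d by rewrite lerD2r rpot_le.
  apply: le_trans xx; rewrite -[X in _ + X]Rintegral_cstT -RintegralD//; last 2 first.
  - exact: (integrable_tlog potA xA).
  - exact: finite_measure_integrable_cst.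
  apply: ae_le_Rintegral => //.
  - rewrite (_ : EFin \o _ = ((EFin \o (fun y => tlog A (y - x))) \+ (EFin \o cst d))%E).
      by apply: integrableD => //; [exact: (integrable_tlog potA xA)|exact: finite_measure_integrable_cst].
    by apply/funext.
  apply: (filterS2 _ _ (rho_A_ae rhoA (fun x xA => xA))
      (rho_seq_ae atomless (fun y (ys : y \notin [:: x]) => ys))).
  by move=> y yA ys _; rewrite tlogC; apply: Kub => //; rewrite eq_sym -mem_seq1.
Qed.

(** Here the kernel must be close to the logarithm from below. On [G] the error is [3 d]: one from
    [upot_lower], one from the smoothing loss, one from the kernel. Off [G] the kernel is at least
    [- d], and replacing [rho G] by [1 - d] costs [g d]. *)
Lemma Rintegral_avg_ker_ge (a : nat -> R) (N : nat) (eps d delta : R) (G B : set R) s :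
  let K := ker a N in
  (forall k, 0 <= a k) -> 0 <= eps <= A -> 0 < d ->
  measurable G -> (rho (~` G) <= d%:E)%E ->
  (forall z, (\int[rho]_(y in G) (smoothing eps (z - y))%:E <= d%:E)%E) ->
  (forall x y, `|x| <= A -> `|y| <= A -> - d <= K x y) ->
  (forall x y, `|x| <= A -> `|y| <= A -> x != y ->
    tlog A (x - y) - smoothing eps (x - y) - d <= K x y) ->
  0 < delta -> delta * (1 + g) <= d -> (0 < size s)%N ->
  (forall z, z \in s -> `|z| <= A) -> measurable B -> (rho B <= delta%:E)%E ->
  (forall x, `|x| <= A -> ~ B x -> x \notin s -> g - delta <= upot A s x) ->
  g - g * d - 4 * d <= \int[rho]_x avg s (K x).
Proof.
move=> K a0 epsA' d0 mG Gd HG Kneg Klb dl0 dlE s0 sA mB Bd HB.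
have gg := g_ge0 A1 potA.
have low := upot_lower A1 atomless rhoA potA sA dl0 mB Bd HB.
have iU := integrable_upot potA sA.
pose Ks x := avg s (K x).
have iKs : Int Ks.
  rewrite (_ : Ks = fun x => ln 8 + \sum_(k < N) (a k * avg s (tcheb k)) * tcheb k x).
    exact: (integrable_comb (fun k => a k * avg s (tcheb k)) N).
  apply/funext => x; rewrite /Ks /K ker_avg//; congr (_ + _).
  by apply: eq_bigr => k _; rewrite mulrAC.
have iS z : z \in s -> Int (fun x => smoothing eps (x - z)).
  by move=> /sA zA; exact: integrable_smoothing.
have Gd1 : 1 - d <= fine (rho G).
  have : fine (rho (~` G)) <= d by rewrite -lee_fin fineK ?fin_num_measure//; exact: measurableC.
  rewrite probability_setC// fineB ?fin_num_measure//=; lra.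
have G1 : fine (rho G) <= 1.
  by rewrite -lee_fin fineK ?fin_num_measure//; exact: probability_le1.
have Q12G : g * fine (rho G) - 3 * d <= \int[rho]_(x in G) Ks x.
  pose V x := avg s (fun z => smoothing eps (x - z)).
  have iV : Int V by exact: (@integrable_avg _ rho s (fun x z => smoothing eps (x - z))).
  have VG : \int[rho]_(x in G) V x <= d.
    rewrite (@Rintegral_avg _ rho G s (fun x z => smoothing eps (x - z)))//.
    rewrite -[leRHS](avg_cst d s0); apply: le_avg => z zs.
    rewrite -lee_fin /Rintegral fineK.
      rewrite (_ : (fun x => _) = (fun x => (smoothing eps (z - x))%:E)); first exact: HG.
      by apply/funext => x; rewrite -smoothing_norm distrC smoothing_norm.
    exact: integrable_fin_num (integrable_on mG (iS _ zs)).
  have : \int[rho]_(x in G) (upot A s x - (V x + d)) <= \int[rho]_(x in G) Ks x.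
    have iVd : Int (fun x => V x + d).
      rewrite (_ : EFin \o _ = ((EFin \o V) \+ (EFin \o cst d))%E).
        by apply: integrableD => //; exact: finite_measure_integrable_cst.
      by apply/funext.
    apply: ae_le_Rintegral => //.
      rewrite (_ : EFin \o _ = ((EFin \o upot A s) \- (EFin \o (fun x => V x + d)%R))%E).
        exact: integrableB.
      by apply/funext.
    apply: (filterS2 _ _ (rho_A_ae rhoA (fun x xA => xA))
      (rho_seq_ae atomless (fun x (xs : x \notin s) => xs))).
    move=> x xA xs _; rewrite lerBlDr -[X in _ + (_ + X)](avg_cst d s0) -!avgD.
    apply: le_avg => z zs; have xz : x != z by apply: contraNneq xs => ->.
    by have := Klb x z xA (sA _ zs) xz; lra.
  rewrite RintegralB//; last 2 first.
  - exact: integrable_on iU.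
  - rewrite (_ : EFin \o _ = ((EFin \o V) \+ (EFin \o cst d))%E).
      by apply: integrableD => //; [exact: integrable_on iV|exact: finite_measure_integrable_cst].
    by apply/funext.
  rewrite RintegralD//; last 2 first.
  - exact: integrable_on iV.
  - exact: finite_measure_integrable_cst.
  rewrite Rintegral_cst//.
  have := low G mG.
  have : d * fine (rho G) <= d by rewrite ler_piMr// ltW.
  by lra.
have Q12N : - d <= \int[rho]_(x in ~` G) Ks x.
  have mGc : measurable (~` G) by exact: measurableC.
  have : \int[rho]_(x in ~` G) (- d) <= \int[rho]_(x in ~` G) Ks x.
    apply: ae_le_Rintegral => //; first exact: finite_measure_integrable_cst.
    apply: filterS (rho_A_ae rhoA (fun x xA => xA)) => x xA _.
    by rewrite -[leLHS](avg_cst (- d) s0); apply: le_avg => z zs; apply: Kneg => //; exact: sA.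
  rewrite Rintegral_cst//; apply: le_trans.
  have : fine (rho (~` G)) <= 1.
    by rewrite -lee_fin fineK ?probability_le1// fin_num_measure.
  by nra.
  rewrite -(setUv G) Rintegral_setU//; last 3 first.
  - exact: measurableC.
  - by rewrite setUv.
  - by apply/disj_set2P; rewrite setICr.
  have : g * (1 - d) <= g * fine (rho G) by rewrite ler_wpM2l.
  by lra.
Qed.

Lemma moment_close (k0 : nat) (e : R) : (0 < k0)%N -> 0 < e ->
  exists2 delta, 0 < delta & forall s (B : set R), (0 < size s)%N ->
    (forall z, z \in s -> `|z| <= A) -> measurable B -> (rho B <= delta%:E)%E ->
    (forall x, `|x| <= A -> ~ B x -> x \notin s -> g - delta <= upot A s x) ->
    `|avg s (tcheb k0) - \int[rho]_x tcheb k0 x| <= e.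
Proof.
move=> k00 e0.
have gg := g_ge0 A1 potA.
have k0r : (0 : R) < k0%:R by rewrite ltr0n.
(* The energy of the difference will be at most [(g + 5 d) - 2 (g - g d - 4 d) + (g + d) = (14 + 2
   g) d], and its term of index [k0] is at least the squared moment difference over [k0]; hence [d]
   with [k0 (14 + 2 g) d = e^2]. *)
pose d := e ^+ 2 / (k0%:R * (14 + 2 * g)).
have d0 : 0 < d by rewrite divr_gt0 ?exprn_gt0// mulr_gt0//; lra.
have [eps [G [/andP[eps0 epsA] mG Gd GA HG]]] := good_set A1 atomless rhoA potA d0.
have epsA' : 0 <= eps <= A by rewrite ltW.
have [a [N [a0 ak0 k0N Kb]]] := kernel_sandwich k00 (introT andP (conj eps0 epsA)) d0.
set K := ker a N in Kb.
have Kneg x y : `|x| <= A -> `|y| <= A -> - d <= K x y.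
  by move=> xA yA; have [] := Kb x y xA yA.
have Kub x y : `|x| <= A -> `|y| <= A -> x != y -> K x y <= tlog A (x - y) + d.
  by move=> xA yA; have [] := Kb x y xA yA.
have Klb x y : `|x| <= A -> `|y| <= A -> x != y ->
    tlog A (x - y) - smoothing eps (x - y) - d <= K x y.
  by move=> xA yA; have [] := Kb x y xA yA.
have [dB dB0 HdB] := avg_ker_le a0 d0 Kub.
have g1 : 0 < 1 + g by rewrite ltr_wpDr.
exists (Num.min dB (d / (1 + g))); first by rewrite lt_min dB0 divr_gt0.
set dl := Num.min _ _ => s B s0 sA mB Bd HB.
have dl0 : 0 < dl by rewrite lt_min dB0 divr_gt0.
have dle : dl <= dB by rewrite ge_min lexx.
have dlg : dl * (1 + g) <= d by rewrite -ler_pdivlMr// ge_min lexx orbT.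
have Q11 : avg s (fun z => avg s (K z)) <= g + 5 * d.
  apply: (HdB s B) => //; first by apply: le_trans Bd _; rewrite lee_fin.
  by move=> x xA nB xs; apply: le_trans (HB x xA nB xs); rewrite lerB.
have Q22 := Rintegral_ker_le Kub.
have Q12 := Rintegral_avg_ker_ge a0 epsA' d0 mG Gd HG Kneg Klb dl0 dlg s0 sA mB Bd HB.
have Eq := ker_energy a N s0; rewrite -/K in Eq.
have : a k0 * (avg s (tcheb k0) - \int[rho]_x tcheb k0 x) ^+ 2 <= (14 + 2 * g) * d.
  apply: (@le_trans _ _ (\sum_(k < N) a k * (avg s (tcheb k) - \int[rho]_x tcheb k x) ^+ 2)).
    rewrite (bigD1 (Ordinal k0N))//= lerDl sumr_ge0// => k _.
    by rewrite mulr_ge0 ?sqr_ge0.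
  by rewrite Eq -/K; lra.
set D := avg _ _ - _ => aD.
have D2 : D ^+ 2 <= e ^+ 2.
  have h1 : k0%:R^-1 * D ^+ 2 <= (14 + 2 * g) * d.
    by apply: le_trans aD; rewrite ler_wpM2r ?sqr_ge0.
  rewrite mulrC ler_pdivrMr// in h1; apply: le_trans h1 _.
  rewrite le_eqVlt; apply/orP; left; apply/eqP; rewrite /d; field.
  by rewrite !gt_eqF//; lra.
by rewrite -ler_sqr ?nnegrE ?(ltW e0)// real_normK ?num_real.
Qed.

End MomentClose.

(** * From Chebyshev moments to bounded continuous test functions *)

Section WeakConvergence.
Context {R : realType} (rho : probability R R) (A : R) (A1 : 1 <= A).
Hypothesis rhoA : rho (~` `[- A, A]) = 0%E.
Local Notation Int f := (rho.-integrable setT (EFin \o f)).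

Let A0 : 0 < A. Proof. exact: lt_le_trans A1. Qed.

(** [poly_cheb_ind] extends convergence from the moments to all polynomials; uniform approximation
    of [f] on [[- A, A]] suffices because this interval carries [rho] and every zero. *)
Lemma weak_cvg_of_moments (s : nat -> seq R) :
  (forall j z, z \in s j -> `|z| <= A) -> (\forall j \near \oo, (0 < size (s j))%N) ->
  (forall k, avg (s j) (tcheb A k) @[j --> \oo] --> \int[rho]_x tcheb A k x) ->
  forall (f : R -> R) (M : R), continuous f -> (forall x, `|f x| <= M) ->
  avg (s j) f @[j --> \oo] --> \int[rho]_x f x.
Proof.
move=> sA s0 mom f M cf fM.
pose Q (h : R -> R) := Int h /\ avg (s j) h @[j --> \oo] --> \int[rho]_x h x.
have QT k : Q (fun x => (cheb k).[x / A]).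
  by split; [exact: (integrable_tcheb A1 rhoA)|exact: mom].
have QZ c h : Q h -> Q (fun x => c * h x).
  move=> [ih ch]; split.
    rewrite (_ : EFin \o _ = (fun x => c%:E * (h x)%:E)%E)//; exact: integrableZl.
  rewrite RintegralZl//; under eq_fun do rewrite avgZ; apply: cvgM => //; exact: cvg_cst.
have QD h1 h2 : Q h1 -> Q h2 -> Q (fun x => h1 x + h2 x).
  move=> [i1 c1] [i2 c2]; split.
    by rewrite (_ : EFin \o _ = ((EFin \o h1) \+ (EFin \o h2))%E)//; exact: integrableD.
  by rewrite RintegralD//; under eq_fun do rewrite avgD; exact: cvgD.
have Qp := poly_cheb_ind A0 QT QZ QD.
have iF : Int f.
  apply: (@integrable_bounded_on _ rho _ _ _ M _ rhoA) => //.
  - by apply: le_lt_trans (probability_le1 rho measurableT) (ltry 1).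
  - exact: continuous_measurable_fun.
apply/cvgrPdist_le => e e0.
have e3 : 0 < e / 3 by rewrite divr_gt0.
have [p Hp] := weierstrass cf fM A0 e3.
have [ip /cvgrPdist_le /(_ _ e3) cp] := Qp p.
have Ip : `|\int[rho]_x f x - \int[rho]_x p.[x]| <= e / 3.
  have ae1 : {ae rho, forall x, `|x| <= A} by exact: (rho_A_ae rhoA (fun x xA => xA)).
  have ic : Int (cst (e / 3)) by exact: finite_measure_integrable_cst.
  have ipc (c : R) : Int (fun x => p.[x] + c).
    rewrite (_ : EFin \o _ = ((EFin \o horner p) \+ (EFin \o cst c))%E)//.
    by apply: integrableD => //; exact: finite_measure_integrable_cst.
  have shift (c : R) : \int[rho]_x (p.[x] + c) = \int[rho]_x p.[x] + c.
    rewrite RintegralD//; last exact: finite_measure_integrable_cst.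
    by rewrite (Rintegral_cstT rho c).
  rewrite ler_distl -!shift; apply/andP; split.
    apply: (ae_le_Rintegral measurableT (ipc _) iF); apply: filterS ae1 => x xA _.
    by have := Hp _ xA; rewrite ler_distl => /andP[].
  apply: (ae_le_Rintegral measurableT iF (ipc _)); apply: filterS ae1 => x xA _.
  by have := Hp _ xA; rewrite ler_distl => /andP[].
near=> j.
have j0 : (0 < size (s j))%N by near: j.
have jp : `|\int[rho]_x p.[x] - avg (s j) (horner p)| <= e / 3 by near: j.
have Sp : `|avg (s j) (horner p) - avg (s j) f| <= e / 3.
  rewrite -[avg _ _ - _](_ : avg (s j) (fun z => p.[z] + -1 * f z) = _); last first.
    by rewrite avgD avgZ mulN1r.
  apply: le_trans (norm_avg _ _) _; rewrite -[leRHS](avg_cst (e / 3) j0).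
  by apply: le_avg => z zs; rewrite mulN1r distrC; apply: Hp; exact: sA zs.
have -> : \int[rho]_x f x - avg (s j) f = (\int[rho]_x f x - \int[rho]_x p.[x]) +
   (\int[rho]_x p.[x] - avg (s j) (horner p)) + (avg (s j) (horner p) - avg (s j) f) by ring.
apply: le_trans (ler_normD _ _) _.
have := ler_normD (\int[rho]_x f x - \int[rho]_x p.[x]) (\int[rho]_x p.[x] - avg (s j) (horner p)).
by lra.
Unshelve. all: by end_near. Qed.

End WeakConvergence.

(** * Norm asymptotics and the exceptional set *)

Section BadSet.
Context {R : realType}.

(** Read off from the variation of [rho] viewed as a charge, which bounds [rho] from above. *)
Lemma dominates_epsdelta (mu : {measure set R -> \bar R}) (rho : probability R R) (e : R) :
  rho `<< mu -> 0 < e -> exists2 d, 0 < d &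
  forall B, measurable B -> (mu B < d%:E)%E -> (rho B < e%:E)%E.
Proof.
move=> dom e0.
have [P [N PN]] := Hahn_decomposition (charge_of_finite_measure rho).
have [d [d0 Hd]] := charge_variation_continuous PN (dom : charge_of_finite_measure rho `<< mu) e0.
exists d => // B mB mub; apply: le_lt_trans (Hd B mB mub).
apply: le_trans (abse_charge_variation PN mB).
exact: lee_abs.
Qed.

Lemma ln_norm_prod (s : seq R) x : x \notin s ->
  0 < `|\prod_(z <- s) (x - z)| /\ ln `|\prod_(z <- s) (x - z)| = \sum_(z <- s) ln `|x - z|.
Proof.
elim: s => [|z s IH]; first by rewrite !big_nil normr1 ln1.
rewrite inE negb_or => /andP[xz xs]; have [p0 E] := IH xs.
have d0 : 0 < `|x - z| by rewrite normr_gt0 subr_eq0.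
by rewrite !big_cons normrM; split; [rewrite mulr_gt0|rewrite lnM ?posrE// E].
Qed.

Lemma upot_prod (A : R) (s : seq R) x : 0 < A -> (0 < size s)%N ->
  (forall z, z \in s -> `|z| <= A) -> `|x| <= A -> x \notin s ->
  upot A s x = ln (4 * A) - (size s)%:R^-1 * ln `|(\prod_(z <- s) ('X - z%:P)).[x]|.
Proof.
move=> A0 s0 sA xA xs.
rewrite horner_prod; under eq_bigr do rewrite hornerXsubC.
have [_ ->] := ln_norm_prod xs.
rewrite -[X in X - _](avg_cst _ s0) -mulN1r.
rewrite -[_^-1 * _]/(avg s (fun z => ln `|x - z|)) -avgZ -avgD.
apply: eq_avg => z zs; rewrite mulN1r tlogE ?subr_eq0//.
  by apply: contraNneq xs => ->.
by apply: le_trans (ler_normB _ _) _; have := sA z zs; lra.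
Qed.

(** Markov's inequality for [p^2] at the threshold [|p| = exp (n c')]: below it
    [- ln |p| / n >= - c'], which by [upot_prod] is the claimed bound on [upot]. The factor [2] in
    the exponent comes from squaring. *)
Lemma bad_set (mu : {measure set R -> \bar R}) (A c c' : R) (s : seq R) : 0 < A ->
  (0 < size s)%N -> (forall z, z \in s -> `|z| <= A) ->
  ((L2norm mu (\prod_(z <- s) ('X - z%:P))) `^ ((size s)%:R^-1) <= (expR c)%:E)%E ->
  exists B, [/\ measurable B, (mu B <= (expR (2 * (size s)%:R * (c - c')))%:E)%E &
    forall x, `|x| <= A -> ~ B x -> x \notin s -> ln (4 * A) - c' <= upot A s x].
Proof.
move=> A0 s0 sA; set p := \prod_(z <- s) _; set n := size s => Nc.
have n0 : (0 : R) < n%:R by rewrite ltr0n.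
have nn0 : n%:R != 0 :> R by rewrite gt_eqF.
have N0 : (0 <= L2norm mu p)%E by exact: Lnorm_ge0.
have pos2 (x : \bar R) : (0 <= x)%E -> x \in `[0%E, +oo%E] by move=> x0; rewrite in_itv /= x0 leey.
have epos (t : R) : (0 <= (expR t)%:E)%E by rewrite lee_fin expR_ge0.
have mp : measurable_fun setT (horner p) by apply: continuous_measurable_fun; exact: continuous_horner.
have Nle : (L2norm mu p <= (expR (n%:R * c))%:E)%E.
  rewrite -[leLHS]poweRe1// -[X in (_ `^ X)%E](mulVf nn0) poweRrM.
  have := gt0_ler_poweR (ltW n0) (pos2 _ (poweR_ge0 _ _)) (pos2 _ (epos c)) Nc.
  by move=> /le_trans; apply; rewrite poweR_EFin -expRM mulrC.
have I2 : (\int[mu]_x ((p.[x]) ^+ 2)%:E <= (expR (2 * n%:R * c))%:E)%E.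
  have -> : (\int[mu]_x ((p.[x]) ^+ 2)%:E = (L2norm mu p) `^ 2)%E.
    rewrite poweR_Lnorm//; apply: eq_integral => x _ /=.
    by rewrite powR_mulrn// real_normK ?num_real.
  have := gt0_ler_poweR (ler0n _ 2) (pos2 _ N0) (pos2 _ (epos _)) Nle.
  by move=> /le_trans; apply; rewrite poweR_EFin lee_fin powR_mulrn ?expR_ge0// -expRM_natl mulrA.
pose T := expR (n%:R * c').
have T0 : 0 < T by exact: expR_gt0.
pose B := [set x | T <= `|p.[x]|].
have mB : measurable B.
  rewrite -[B]setTI (_ : B = (fun x => `|p.[x]|) @^-1` [set` `[T, +oo[]).
    have mnp : measurable_fun setT (fun x => `|p.[x]|) by exact: measurableT_comp.
    by apply: mnp => //; exact: measurable_itv.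
  by apply/seteqP; split => x /=; rewrite in_itv /= andbT.
exists B; split=> //.
- have m2 : measurable_fun setT (fun x => ((p.[x]) ^+ 2)%:E).
    by apply/measurable_EFinP; exact: measurable_funX.
  have h : ((T ^+ 2)%:E * mu B <= (expR (2 * n%:R * c))%:E)%E.
    apply: le_trans I2.
    apply: (@le_trans _ _ (\int[mu]_(x in B) ((p.[x]) ^+ 2)%:E)%E); last first.
      by apply: ge0_subset_integral => // x _; rewrite lee_fin sqr_ge0.
    apply: integral_ge_cst => //; rewrite ?sqr_ge0//.
    move=> x Bx; rewrite lee_fin -[leRHS]real_normK ?num_real//.
    by rewrite lerXn2r ?nnegrE ?(ltW T0).
  have T2 : 0 < T ^+ 2 by rewrite exprn_gt0.
  rewrite -(lee_pmul2l _ (_ : 0 < (T ^+ 2)%:E)%E) ?lte_fin//.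
  apply: le_trans h _; rewrite -EFinM lee_fin /T -expRM_natl -expRD.
  by rewrite ler_expR; lra.
move=> x xA nB xs; rewrite (upot_prod A0 s0 sA xA xs) lerD2l lerN2 -/p -/n.
have := ln_norm_prod xs => -[p0 _].
have px : 0 < `|p.[x]|.
  by rewrite /p horner_prod; under eq_bigr do rewrite hornerXsubC.
rewrite mulrC ler_pdivrMr// -[leRHS]expRK mulrC ler_ln ?posrE ?expR_gt0//.
by rewrite leNgt; apply/negP => h; apply: nB; exact: ltW.
Qed.

End BadSet.

(** * Passage from capacity to energy, and conclusion *)

Section Setup.
Context {R : realType}.

Lemma compact_subset_segment (K : set R) : compact K ->
  exists2 A, 1 <= A & K `<=` `[- A, A].
Proof.
move=> /compact_bounded[M [_ HM]]; exists (Num.max 1 (M + 1)); first by rewrite le_max lexx.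
move=> x Kx /=; rewrite in_itv /= -ler_norml.
by apply: HM => //; rewrite lt_max ltrDl ltr01 orbT.
Qed.

Lemma segmentC_null (m : {measure set R -> \bar R}) (K : set R) (A : R) : measurable K ->
  m (~` K) = 0%E -> K `<=` `[- A, A] -> m (~` `[- A, A]) = 0%E.
Proof.
move=> mK mK0 KA; apply/eqP; rewrite eq_le measure_ge0 andbT -mK0.
apply: le_measure; rewrite ?inE; try (by apply: measurableC => //; exact: measurable_itv).
exact: subsetC.
Qed.

(** Infinite energy would make the capacity [0]. The term [ln (4 * A)] in the exponent undoes the
    shift built into [elog]. *)
Lemma capacity_energy (A : R) (E : set R) (rho : probability R R) : 1 <= A ->
  rho (~` `[- A, A]) = 0%E -> equilibrium_measure E rho -> (0 < capacity E)%E ->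
  exists g : R, energy A rho rho = g%:E /\ capacity E = (expR (ln (4 * A) - g))%:E.
Proof.
move=> A1 rhoA [rhoE eqE]; rewrite /capacity -eqE (log_energyE A1 rhoA).
have := energy_ge0 A rho rho; case: (energy A rho rho) => [g||] //= _.
  by move=> _; exists g; split => //; congr (expR _)%:E; ring.
by rewrite ltxx.
Qed.

End Setup.

Unset Implicit Arguments.

Theorem theorem4p2 (R : realType) (mu : {measure set R -> \bar R})
  (E : set R) (rho : probability R R) (P : nat -> {poly R}) (n : nat -> nat) :
  (mu [set: R] < +oo)%E ->
  compact (measure_support mu) ->
  compact E -> E `<=` measure_support mu -> essentially_perfect E ->
  (0 < capacity E)%E ->
  equilibrium_measure E rho ->
  rho `<< mu ->
  (forall k, monic_OP mu k (P k)) ->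
  (forall i j, (i < j)%N -> (n i < n j)%N) ->
  ((L2norm mu (P (n j))) `^ ((n j)%:R^-1))%E @[j --> \oo]
    --> capacity E ->
  forall f : R -> R, continuous f -> (exists M : R, forall x, `|f x| <= M) ->
    (zero_counting_integral (P (n j)) f)%:E @[j --> \oo]
      --> (\int[rho]_x (f x)%:E)%E.
Proof.
move=> muT cS cE ES perfE capE eqE dom OP nincr Lcvg f cf [M fM].
have [A A1 SA] := compact_subset_segment cS.
have A0 : 0 < A by exact: lt_le_trans A1.
have EA x : E x -> `|x| <= A by move=> /ES /SA /=; rewrite in_itv /= -ler_norml.
have EA' : E `<=` `[- A, A] by move=> x /ES /SA.
have mE : measurable E by exact: compact_measurable.
have muA := segmentC_null (measurable_measure_support mu) (measure_supportC0 mu) SA.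
have rhoE : rho (~` E) = 0%E by case: eqE.
have rhoA : rho (~` `[- A, A]) = 0%E by exact: segmentC_null mE rhoE EA'.
have [g [gE capg]] := capacity_energy A1 rhoA eqE capE.
have gmin (nu : probability R R) : nu (~` E) = 0%E -> (g%:E <= energy A nu nu)%E.
  move=> nuE; have nuA : nu (~` `[- A, A]) = 0%E by exact: segmentC_null mE nuE EA'.
  have : (log_energy rho <= log_energy nu)%E.
    by case: eqE => _ ->; apply: ereal_inf_lbound; exists nu.
  by rewrite !(log_energyE A1)// gE leeD2rE.
have atomless x : rho [set x] = 0%E by apply: (@energy_atomless _ A); rewrite gE ltry.
have potA := pot_le A1 cE EA' rhoE gE gmin.
have charge := subset_support A1 cE EA' perfE rhoE gE gmin.
have gap := pot_le_dist A1 cE EA' rhoE gE gmin.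
(* If [mu] lived on the zeros of [r], so would [rho]; but these are finitely many and [rho] has no
   atoms. *)
have muinf (r : {poly R}) : r != 0 -> mu [set x | r.[x] != 0] != 0%E.
  move=> r0; apply/eqP => mu0.
  have mr : measurable [set x | r.[x] != 0].
    rewrite (_ : [set x | _] = setT `&` [set x | (EFin \o horner r) x != (cst 0%E) x]).
      apply: emeasurable_neq => //.
      by apply/measurable_EFinP; apply: continuous_measurable_fun; exact: continuous_horner.
    by rewrite setTI.
  have rho0 : rho [set x | r.[x] != 0] = 0%E.
    by move/null_content_dominatesP : dom; apply.
  have : rho.-negligible setT.
    apply: (@negligibleS _ _ _ _ ([set x | r.[x] != 0] `|` [set x | ~ (x \notin rootsR r)])).
      move=> x _; have [rx|rx] := eqVneq r.[x] 0; last by left.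
      right => /=; apply/negP; rewrite negbK.
      by have := roots_on_rootsR r0 x; rewrite in_itv /= => <-; apply/rootP.
    apply: negligibleU; first exact: (negligibleP _ mr).2 rho0.
    exact: (rho_seq_ae atomless (fun x xs => xs)).
  move/(negligibleP _ measurableT) => h.
  have [/eqP] : (1%E = 0%E :> \bar R) := etrans (esym (probability_setT rho)) h.
  by rewrite oner_eq0.
have [s Hs] := choice (fun j => monic_OP_roots muT muA muinf (OP (n j))).
have PE j : P (n j) = \prod_(z <- s j) ('X - z%:P) by have [] := Hs j.
have szE j : size (s j) = n j by have [] := Hs j.
have njn j : (j <= n j)%N.
  by elim: j => // j IH; apply: leq_ltn_trans IH (nincr _ _ (ltnSn j)).
have sA j z : z \in s j -> `|z| <= A by have [_ _] := Hs j; exact.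
(* The list is empty when [n j = 0], which strict monotonicity allows only at [j = 0]. *)
have s0 : \forall j \near \oo, (0 < size (s j))%N.
  exists 1%N => // j /= j1; rewrite szE.
  exact: leq_trans (njn j).
have iF : rho.-integrable setT (EFin \o f).
  apply: (@integrable_bounded_on _ rho _ _ _ M _ rhoA) => //.
  - by apply: le_lt_trans (probability_le1 rho measurableT) (ltry 1).
  - exact: continuous_measurable_fun.
suff wc : avg (s j) f @[j --> \oo] --> \int[rho]_x f x.
  rewrite -[X in _ --> X]fineK; last exact: integrable_fin_num iF.
  apply: cvg_EFin; first exact: nearW.
  by under eq_fun => j do rewrite /= PE zero_counting_prod.
apply: (weak_cvg_of_moments A1 rhoA sA s0 _ cf fM) => k.
(* The kernel does not see the zeroth moment; it equals [1] for [rho] and for every nonempty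
   list. *)
have [->|k0] := posnP k.
  have t0 x : tcheb A 0 x = 1 by rewrite /tcheb hornerC.
  under eq_Rintegral do rewrite t0.
  rewrite Rintegral_cstT; apply/cvgrPdist_le => e e0; near=> j.
  rewrite (eq_avg (h2 := fun=> 1)) => [|z _]; last exact: t0.
  by rewrite avg_cst ?subrr ?normr0 ?(ltW e0)//; near: j.
apply/cvgrPdist_le => e e0.
have [d d0 Hd] := moment_close A1 atomless rhoA potA cE EA gap charge k0 e0.
have [d' d'0 Hd'] := dominates_epsdelta dom d0.
near=> j.
rewrite distrC.
have sj0 : (0 < size (s j))%N by near: j.
(* The margin [d] in the potential is split: one half pays for the norm asymptotics, the other gives
   [mu B <= exp (- n d)], with [n] standing for [n j]. *)
have Lj : ((L2norm mu (\prod_(z <- s j) ('X - z%:P))) `^ ((size (s j))%:R^-1) <=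
    (expR (ln (4 * A) - g + d / 2))%:E)%E.
  rewrite -PE szE; apply: ltW; near: j.
  apply: (Lcvg [set y | (y < (expR (ln (4 * A) - g + d / 2))%:E)%E]).
  rewrite capg; apply: open_nbhs_nbhs; split; first exact: open_ereal_lt_ereal.
  by rewrite /= lte_fin ltr_expR ltrDl divr_gt0.
have [B [mB muB HB]] := bad_set (ln (4 * A) - g + d) A0 sj0 (sA j) Lj.
apply: (Hd (s j) B sj0 (sA j) mB).
  apply: ltW; apply: Hd' => //; apply: le_lt_trans muB _.
  rewrite szE lte_fin.
  have -> : 2 * (n j)%:R * (ln (4 * A) - g + d / 2 - (ln (4 * A) - g + d)) = - ((n j)%:R * d) by field.
  have jn : j%:R <= (n j)%:R :> R by rewrite ler_nat.
  have jd : (d * d')^-1 < j%:R by near: j; exact: nbhs_infty_gtr.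
  (* By [exp y >= 1 + y], this is enough for [exp (- n d) < d']. *)
  have nd : d'^-1 < (n j)%:R * d.
    rewrite -ltr_pdivrMr//; apply: lt_le_trans jn.
    by rewrite -invfM mulrC.
  rewrite expRN -[ltRHS]invrK ltf_pV2 ?posrE ?invr_gt0 ?expR_gt0//.
  by apply: lt_le_trans nd _; apply: le_trans (expR_ge1Dx _); rewrite lerDr.
by move=> x xA nB xs; have := HB x xA nB xs; lra.
Unshelve. all: by end_near. Qed.
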